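(* A discrete $n$-dimensional rotating motion with two independent principal contact element nets as trajectories is uniquely defined by two skew axes $M$, $N$ of the contact elements in the moving space and the values along the coordinate axes in $\mathbb{Z}^n$.
   Context: Contact elements. An oriented contact element is a pair $(p,\nu)$ consisting of a point $p\in\mathbb{R}^3$ and an oriented plane $\nu$ incident with $p$; the oriented line through $p$ orthogonal to $\nu$ is its axis or normal. For an index $\vec{i}\in\mathbb{Z}^n$, $\tau_j$ denotes the shift of the index by one in the $j$-th coordinate direction. A contact element net is a map $\vec{i}\mapsto(p_{\vec{i}},\nu_{\vec{i}})$ from $\mathbb{Z}^n$ to the space of oriented contact elements. It is a principal contact element net if any two neighbouring contact elements $(p_{\vec{i}},\nu_{\vec{i}})$, $\tau_j(p_{\vec{i}},\nu_{\vec{i}})$ have a common oriented tangent sphere; in other words, neighbouring normals intersect in a point that is at the same oriented distance from $p_{\vec{i}}$ and $\tau_jp_{\vec{i}}$. Two principal contact element nets are independent if there exists a pair of contact elements with the same index $\vec{i}\in\mathbb{Z}^n$ but different normals. Displacements. Dual quaternions $a=\tilde a+\varepsilon\hat a$ (with ordinary quaternions $\tilde a,\hat a$, $\varepsilon^2=0$, $\varepsilon$ commuting with the quaternion units, product denoted $\star$) are identified with vectors $(a_0,\dots,a_7)\in\mathbb{R}^8$, where $\tilde a=(a_0,\dots,a_3)$ and $\hat a=(a_4,\dots,a_7)$. Put $\langle a,b\rangle=\sum_{i=0}^{3}(a_ib_{i+4}+a_{i+4}b_i)$ and $a_\varepsilon=\tilde a-\varepsilon\hat a$. The Study quadric is $\mathcal{S}=\{x\in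 P^7:\langle x,x\rangle=0\}$, where $P^7$ is the projective space over $\mathbb{R}^8$. Its points with $\tilde x\neq 0$ are identified with the proper (orientation-preserving) Euclidean displacements from the moving space to the fixed space: if $\Vert\tilde a\Vert=1$, then $a$ maps the point $x$ (written as a vector-valued quaternion) to $x'$ with $1+\varepsilon x'=a_\varepsilon\star(1+\varepsilon x)\star a^{-1}$. The line joining two displacements $a,b$ is contained in $\mathcal{S}$ if and only if the relative displacement $b\star a^{-1}$ is a pure rotation. Rotating motions. A discrete $n$-dimensional rotating motion (or rotation net) is a quadrilateral net $\vec{i}\mapsto a_{\vec{i}}$, $\vec{i}\in\mathbb{Z}^n$, whose vertices $a_{\vec{i}}$ and edges (the lines joining $a_{\vec{i}}$ and $\tau_ja_{\vec{i}}$) are contained in the Study quadric $\mathcal{S}$, so that any two neighbouring positions correspond in a pure rotation. The trajectory of a contact element of the moving space is the contact element net formed by its images under the displacements $a_{\vec{i}}$. The axes $M$, $N$ are the normals, in the moving space, of the two contact elements whose trajectories are the two independent principal contact element nets. The values along the coordinate axes are the positions $a_{\vec{i}}$ of the motion whose index $\vec{i}$ lies on a coordinate axis of $\mathbb{Z}^n$.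
   Formalization: Proved for generic values along the coordinate axes (a comeagre set of the admissible values), among motions whose elementary quadrilaterals have four distinct vertices; folded quadrilaterals or special values make existence or uniqueness fail. *)

(* Defs.v *)
(* MathComp / MathComp-Analysis *)
From HB Require Import structures.
From mathcomp Require Import all_boot all_order all_algebra.
From mathcomp Require Import all_classical all_reals all_analysis.
Set Implicit Arguments.
Unset Strict Implicit.
Unset Printing Implicit Defensive.
Import Order.TTheory GRing.Theory Num.Theory.
Import numFieldNormedType.Exports.
Local Open Scope classical_set_scope.
Local Open Scope ring_scope.

Section Quaternions.
Variable R : realType.

(* Coordinates with respect to the basis 1, i, j, k. *)
Definition quaternion := 'rV[R]_4.

Definition qmul (a b : quaternion) : quaternion :=
  \row_(k < 4)
    [:: a 0 0 * b 0 0 - a 0 1 * b 0 1 - a 0 2 * b 0 2 - a 0 3 * b 0 3;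
        a 0 0 * b 0 1 + a 0 1 * b 0 0 + a 0 2 * b 0 3 - a 0 3 * b 0 2;
        a 0 0 * b 0 2 - a 0 1 * b 0 3 + a 0 2 * b 0 0 + a 0 3 * b 0 1;
        a 0 0 * b 0 3 + a 0 1 * b 0 2 - a 0 2 * b 0 1 + a 0 3 * b 0 0]`_k.

Definition qconj (a : quaternion) : quaternion :=
  \row_k (if k == 0 then a 0 k else - a 0 k).

Definition qinv (a : quaternion) : quaternion :=
  (\sum_k a 0 k ^+ 2)^-1 *: qconj a.

Definition qone : quaternion := delta_mx 0 0.

Definition qvec (x : 'rV[R]_3) : quaternion := row_mx (0 : 'rV_1) x.

Definition vector_part (a : quaternion) : 'rV[R]_3 :=
  rsubmx (a : 'rV_(1 + 3)).

(* The coordinates 0..3 are the primal part, 4..7 the dual part. *)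
Definition dual_quaternion := 'rV[R]_(4 + 4).

Definition primal_part (a : dual_quaternion) : quaternion := lsubmx a.
Definition dual_part (a : dual_quaternion) : quaternion := rsubmx a.

Definition dqmul (a b : dual_quaternion) : dual_quaternion :=
  row_mx (qmul (primal_part a) (primal_part b))
         (qmul (primal_part a) (dual_part b) +
          qmul (dual_part a) (primal_part b)).

Definition eps_conj (a : dual_quaternion) : dual_quaternion :=
  row_mx (primal_part a) (- dual_part a).

(* (p + eps d)^-1 = p^-1 - eps p^-1 d p^-1, for p != 0. *)
Definition dqinv (a : dual_quaternion) : dual_quaternion :=
  row_mx (qinv (primal_part a))
         (- qmul (qmul (qinv (primal_part a)) (dual_part a))
                 (qinv (primal_part a))).

Definition study_form (a b : dual_quaternion) : R :=
  \sum_(i < 4) (primal_part a 0 i * dual_part b 0 i +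
                dual_part a 0 i * primal_part b 0 i).

Definition in_study (a : dual_quaternion) := study_form a a = 0.

(* Points of P^7 are given by homogeneous coordinate vectors; this is equality
   of the points. *)
Definition proj_eq (a b : dual_quaternion) :=
  exists2 k : R, k != 0 & b = k *: a.

Definition displacement (a : dual_quaternion) :=
  in_study a /\ primal_part a != 0.

Definition line_in_study (a b : dual_quaternion) :=
  forall s t : R, in_study (s *: a + t *: b).

(* The point x' with 1 + eps x' = a_eps (1 + eps x) a^-1; this expression is
   homogeneous of degree 0 in a, so a need not be normalized. *)
Definition move_point (a : dual_quaternion) (x : 'rV[R]_3) : 'rV[R]_3 :=
  vector_part
    (dual_part (dqmul (dqmul (eps_conj a) (row_mx qone (qvec x))) (dqinv a))).

End Quaternions.

Section ContactElements.
Variable R : realType.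

(* A point together with the unit normal vector that orients the plane. *)
Definition contact_element := ('rV[R]_3 * 'rV[R]_3)%type.

Definition is_contact (c : contact_element) := \sum_k c.2 0 k ^+ 2 = 1.

(* A unit direction vector and the set of points of the line. *)
Definition oriented_line := ('rV[R]_3 * set 'rV[R]_3)%type.

Definition normal_line (c : contact_element) : oriented_line :=
  (c.2, [set x | exists t : R, x = c.1 + t *: c.2]).

Definition is_line (M : oriented_line) :=
  exists2 c, is_contact c & normal_line c = M.

Definition skew_lines (M N : oriented_line) :=
  M.2 `&` N.2 = set0 /\ ~ exists k : R, M.1 = k *: N.1.

(* r is the oriented radius; the centre is the common point of the normals. *)
Definition common_tangent_sphere (c d : contact_element) :=
  exists r : R, c.1 + r *: c.2 = d.1 + r *: d.2.

Definition move_contact (a : dual_quaternion R) (c : contact_element)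
    : contact_element :=
  (move_point a c.1, move_point a (c.1 + c.2) - move_point a c.1).

End ContactElements.

Section Nets.
Variables (R : realType) (n : nat).

Definition shift_index (i : 'rV[int]_n) (j : 'I_n) : 'rV[int]_n :=
  i + delta_mx 0 j.

Definition on_axis (i : 'rV[int]_n) : bool :=
  [forall j, forall k, (j != k) ==> (i 0 j == 0) || (i 0 k == 0)].

Definition axis_index := {i : 'rV[int]_n | on_axis i}.

(* Families indexed by a type I, each index i being located at pos i in Z^n.
   Used with pos = id for nets and with pos = val for families that are defined
   along the coordinate axes only. *)
Section Families.
Variables (I : Type) (pos : I -> 'rV[int]_n).

Definition neighbours (i k : I) := exists j, pos k = shift_index (pos i) j.

Definition rotating (a : I -> dual_quaternion R) :=
  (forall i, displacement (a i)) /\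
  (forall i k, neighbours i k ->
     ~ proj_eq (a i) (a k) /\ line_in_study (a i) (a k)).

Definition principal (c : I -> contact_element R) :=
  (forall i, is_contact (c i)) /\
  (forall i k, neighbours i k -> common_tangent_sphere (c i) (c k)).

Definition trajectory (a : I -> dual_quaternion R) (c : contact_element R) :
  I -> contact_element R := fun i => move_contact (a i) c.

Definition independent (c d : I -> contact_element R) :=
  exists i, normal_line (c i) <> normal_line (d i).

Definition principal_trajectories (M N : oriented_line R)
    (a : I -> dual_quaternion R) :=
  exists c d : contact_element R,
    [/\ is_contact c /\ is_contact d, normal_line c = M /\ normal_line d = N,
        principal (trajectory a c), principal (trajectory a d)
      & independent (trajectory a c) (trajectory a d)].

End Families.

(* The elementary quadrilaterals have four distinct vertices.  Neighbouring
   vertices are distinct already by [rotating]; without the conditions on the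
   diagonals a quadrilateral could always be closed by folding it, i.e. by
   taking the vertex opposite to a i equal to a i. *)
Definition rotating_motion (a : 'rV[int]_n -> dual_quaternion R) :=
  rotating id a /\
  forall i j k, j != k ->
    ~ proj_eq (a i) (a (shift_index (shift_index i j) k)) /\
    ~ proj_eq (a (shift_index i j)) (a (shift_index i k)).

Definition motion_with_axes (M N : oriented_line R)
    (a : 'rV[int]_n -> dual_quaternion R) :=
  rotating_motion a /\ principal_trajectories id M N a.

Definition axis_values (M N : oriented_line R)
    (f : axis_index -> dual_quaternion R) :=
  rotating val f /\ principal_trajectories val M N f.

Definition takes_values (f : axis_index -> dual_quaternion R)
    (a : 'rV[int]_n -> dual_quaternion R) :=
  forall i : axis_index, proj_eq (f i) (a (val i)).

(* A motion is a net in P^7: uniqueness is up to the choice of homogeneous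
   coordinates. *)
Definition uniquely_defines (M N : oriented_line R)
    (f : axis_index -> dual_quaternion R) :=
  exists a, [/\ motion_with_axes M N a, takes_values f a
    & forall b, motion_with_axes M N b -> takes_values f b ->
        forall i, proj_eq (a i) (b i)].

End Nets.

(* P holds on a comeagre subset of the subspace D: the sets D `&` U k are
   relatively open and dense in D.  Some genericity of the values along the axes
   is unavoidable: for positions a, b, c of special mutual location the fourth
   vertex of a quadrilateral need not exist or need not be unique. *)
Definition generically (T : topologicalType) (D P : set T) :=
  exists U : nat -> set T,
    (forall k, open (U k) /\ D `<=` closure (D `&` U k)) /\
    D `&` \bigcap_k U k `<=` P.

(* Main.v *)
Require Import Defs.
From mathcomp Require Import all_boot all_order all_algebra.
From mathcomp Require Import all_classical all_reals all_analysis.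
From mathcomp Require Import complex.
From mathcomp Require Import ring lra zify.
Set Implicit Arguments.
Unset Strict Implicit.
Unset Printing Implicit Defensive.
Import Order.TTheory GRing.Theory Num.Theory.
Import numFieldNormedType.Exports.
Local Open Scope classical_set_scope.
Local Open Scope ring_scope.

(** Two neighbouring positions a, b of a motion are described by the relative
    displacement r = conj a * b, which acts on the moving space, where the axes
    M, N are fixed.  In coordinates adapted to M and N (edge_psi), r is an edge of
    a motion with the required trajectories if and only if it lies on the Study
    quadric and in a fixed linear space L, and a certain coordinate of r is
    nonzero.  So adjacency is a bilinear condition on P^7.

    Uniqueness.  Let a, b1, b2 be three vertices of a quadrilateral.  The common
    neighbours of b1 and b2 in P^7 are the solutions of six linear equations in
    eight unknowns.  One solution is a, and generically the solutions form a line
    that is not tangent to the Study quadric at a (opposite_rigid), so the fourth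
    vertex is the second point of intersection (opposite_unique).  The genericity
    condition is that b1, b2 are not conjugate and that a real invariant of the
    edges, the label, differs on the edges from a to b1 and to b2.  Labels agree
    on opposite edges (quad_lab).

    Existence.  The fourth vertex is constructed by a polynomial map (flip), and
    the net is built up by completing quadrilaterals, with increasing distance
    from the origin.  In dimension n > 2 a vertex is the end of several
    quadrilaterals, and these constructions agree by the theorem on cubes (cube).
    Each axis defines a complex structure on the dual quaternions, for which
    adjacency is orthogonality with respect to a hermitian form.  The four even
    vertices of the cube then determine the odd ones up to complex factors, and
    the relations of the three known faces at one vertex say that a binary
    quadratic form has three distinct zeros.  So it vanishes identically, which
    gives the missing orthogonality relation.

    Genericity.  All conditions that are needed say that certain polynomials in
    finitely many axis values do not vanish, hence they are open (cts_net,
    good_open).  They are dense (good_dense): a single edge of the net, at the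
    first vertex where a condition fails, can be moved freely on the cone of
    edges.  Completing quadrilaterals backwards transports this deformation to an
    axis, where the remaining part of the axis values is displaced as a rigid
    body (lift_curve).  Countably many conditions are involved, which is the
    comeagre set of the statement. *)

(** * Relative displacements in coordinates adapted to the two axes *)

(** Coordinates with respect to 1, I, J, K = I * J and their multiples by a
    dual unit eps, where I and J are the orthogonal vectors (mu + nu) / 2 and
    (mu - nu) / 2 built from the unit directions mu, nu of the two axes. *)
Record dq (R : Type) := DQ
  {x0 : R; x1 : R; x2 : R; x3 : R; x4 : R; x5 : R; x6 : R; x7 : R}.

Section Model.
Variable R : rcfType.
Variable p : R.
Local Notation q := (1 - p).
Local Notation dq := (dq R).

(** With p = |I|^2 and 1 - p = |J|^2 the multiplication table is I^2 = - p,
    J^2 = - (1 - p), I J = K, J K = (1 - p) I, K I = p J.  This basis keeps every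
    formula rational in p: half the angle between the axes never appears. *)
Definition dmul (a b : dq) : dq :=
  let: DQ a0 a1 a2 a3 a4 a5 a6 a7 := a in
  let: DQ b0 b1 b2 b3 b4 b5 b6 b7 := b in
  DQ (a0 * b0 - p * (a1 * b1) - q * (a2 * b2) - p * q * (a3 * b3))
     (a0 * b1 + a1 * b0 + q * (a2 * b3 - a3 * b2))
     (a0 * b2 + a2 * b0 + p * (a3 * b1 - a1 * b3))
     (a0 * b3 + a3 * b0 + a1 * b2 - a2 * b1)
     (a0 * b4 - p * (a1 * b5) - q * (a2 * b6) - p * q * (a3 * b7) +
      (a4 * b0 - p * (a5 * b1) - q * (a6 * b2) - p * q * (a7 * b3)))
     (a0 * b5 + a1 * b4 + q * (a2 * b7 - a3 * b6) +
      (a4 * b1 + a5 * b0 + q * (a6 * b3 - a7 * b2)))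
     (a0 * b6 + a2 * b4 + p * (a3 * b5 - a1 * b7) +
      (a4 * b2 + a6 * b0 + p * (a7 * b1 - a5 * b3)))
     (a0 * b7 + a3 * b4 + a1 * b6 - a2 * b5 +
      (a4 * b3 + a7 * b0 + a5 * b2 - a6 * b1)).

Definition dadd (a b : dq) : dq :=
  DQ (x0 a + x0 b) (x1 a + x1 b) (x2 a + x2 b) (x3 a + x3 b)
     (x4 a + x4 b) (x5 a + x5 b) (x6 a + x6 b) (x7 a + x7 b).

Definition dsc (k : R) (a : dq) : dq :=
  DQ (k * x0 a) (k * x1 a) (k * x2 a) (k * x3 a)
     (k * x4 a) (k * x5 a) (k * x6 a) (k * x7 a).

Definition dconj (a : dq) : dq :=
  DQ (x0 a) (- x1 a) (- x2 a) (- x3 a) (x4 a) (- x5 a) (- x6 a) (- x7 a).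

Definition dzero : dq := DQ 0 0 0 0 0 0 0 0.

(** The eps-component of dconj a * b, i.e. the Study form up to a constant. *)
Definition form (a b : dq) : R :=
  x0 a * x4 b + x4 a * x0 b + p * (x1 a * x5 b + x5 a * x1 b)
  + q * (x2 a * x6 b + x6 a * x2 b) + p * q * (x3 a * x7 b + x7 a * x3 b).

(** The norm of the primal part. *)
Definition nrm (a : dq) : R :=
  x0 a ^+ 2 + p * x1 a ^+ 2 + q * x2 a ^+ 2 + p * q * x3 a ^+ 2.

(** The displacement from the position a to the position b, seen from the moving
    space, where the two axes are fixed. *)
Definition rel (a b : dq) : dq := dmul (dconj a) b.

Lemma dmulA a b c : dmul a (dmul b c) = dmul (dmul a b) c.
Proof. by case: a => *; case: b => *; case: c => *; congr DQ; ring. Qed.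

Lemma dscalel k a b : dmul (dsc k a) b = dsc k (dmul a b).
Proof. by case: a => *; case: b => *; congr DQ; rewrite /=; ring. Qed.

Lemma dscaler k a b : dmul a (dsc k b) = dsc k (dmul a b).
Proof. by case: a => *; case: b => *; congr DQ; rewrite /=; ring. Qed.

Lemma dmulDr a b c : dmul a (dadd b c) = dadd (dmul a b) (dmul a c).
Proof. by case: a => *; case: b => *; case: c => *; congr DQ; rewrite /=; ring. Qed.

Lemma dconjM a b : dconj (dmul a b) = dmul (dconj b) (dconj a).
Proof. by case: a => *; case: b => *; congr DQ; rewrite /=; ring. Qed.

Lemma dconjK a : dconj (dconj a) = a.
Proof. by case: a => *; congr DQ; rewrite /=; ring. Qed.

Lemma dscA k l a : dsc k (dsc l a) = dsc (k * l) a.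
Proof. by case: a => *; congr DQ; rewrite /=; ring. Qed.

Lemma dsc1 a : dsc 1 a = a.
Proof. by case: a => *; congr DQ; rewrite /=; ring. Qed.

(** Elements of the Study quadric are invertible up to the real factor nrm,
    because the dual part of a * dconj a is a multiple of the Study form. *)
Lemma mul_null_conj a b : form a a = 0 -> dmul a (dmul (dconj a) b) = dsc (nrm a) b.
Proof.
case: a => a0 a1 a2 a3 a4 a5 a6 a7; case: b => b0 b1 b2 b3 b4 b5 b6 b7.
rewrite /form /nrm /= => h.
have h' : a0 * a4 + p * (a1 * a5) + q * (a2 * a6) + p * q * (a3 * a7) = 0.
  by apply: (@mulfI _ 2%:R); rewrite ?pnatr_eq0 // mulr0 -[RHS]h; ring.
congr DQ => /=; try ring.
- by rewrite -[RHS]addr0 -[X in _ = _ + X](mulr0 (2%:R * b0)) -h'; ring.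
- by rewrite -[RHS]addr0 -[X in _ = _ + X](mulr0 (2%:R * b1)) -h'; ring.
- by rewrite -[RHS]addr0 -[X in _ = _ + X](mulr0 (2%:R * b2)) -h'; ring.
- by rewrite -[RHS]addr0 -[X in _ = _ + X](mulr0 (2%:R * b3)) -h'; ring.
Qed.

Lemma mul_conj_null a b : form a a = 0 -> dmul (dmul b a) (dconj a) = dsc (nrm a) b.
Proof.
move=> na; have e : dconj (dmul (dmul b a) (dconj a)) = dsc (nrm a) (dconj b).
  by rewrite !dconjM dconjK mul_null_conj.
by rewrite -[LHS]dconjK e; case: b {e} => *; congr DQ; rewrite /=; ring.
Qed.

Lemma nrm_conj a : nrm (dconj a) = nrm a.
Proof. by case: a => *; rewrite /nrm /=; ring. Qed.

Lemma form_conj a b : form (dconj a) (dconj b) = form a b.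
Proof. by rewrite /form /=; ring. Qed.

Lemma formC a b : form a b = form b a.
Proof. by rewrite /form; ring. Qed.

Lemma relC a b : rel b a = dconj (rel a b).
Proof. by rewrite /rel dconjM dconjK. Qed.

Lemma rel_form a b : x4 (rel a b) = form a b.
Proof. by case: a => *; case: b => *; rewrite /form /=; ring. Qed.

Lemma nrmM a b : nrm (dmul a b) = nrm a * nrm b.
Proof. by case: a => *; case: b => *; rewrite /nrm /=; ring. Qed.

Lemma nrm_sc k a : nrm (dsc k a) = k ^+ 2 * nrm a.
Proof. by case: a => *; rewrite /nrm /=; ring. Qed.

Lemma nrm_rel a b : nrm (rel a b) = nrm a * nrm b.
Proof. by rewrite nrmM nrm_conj. Qed.

Lemma form_mul a b c : form (dmul a b) (dmul a c) = nrm a * form b c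
   + form a a * (x0 (dmul (dconj b) c)).
Proof. by case: a => *; case: b => *; case: c => *; rewrite /form /nrm /=; ring. Qed.

Lemma rel_from a b c : form a a = 0 ->
  rel (rel a b) (rel a c) = dsc (nrm a) (rel b c).
Proof.
move=> na; rewrite /rel dconjM dconjK -dmulA mul_null_conj //.
by rewrite dscaler.
Qed.

Lemma form_rel a b : form (rel a b) (rel a b) =
  nrm a * form b b + form a a * nrm b.
Proof.
rewrite /rel form_mul nrm_conj form_conj; congr (_ + _ * _).
by case: b => *; rewrite /nrm /=; ring.
Qed.

(** For a rotation r different from the identity, the contact elements with
    either axis and their images under r have common tangent spheres exactly
    when r satisfies these linear equations and x3 r does not vanish.  The
    linear span contains the scalars, so adjacency is a relation between points
    of P^7 that is linear in each argument. *)
Definition inL (r : dq) := [/\ x4 r = 0, x5 r = q * x1 r & x6 r = - (p * x2 r)].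
Definition adj a b := inL (rel a b).

Lemma inL_conj r : inL r -> inL (dconj r).
Proof. by case=> h4 h5 h6; split=> /=; rewrite ?h4 ?h5 ?h6; ring. Qed.

Lemma adjC a b : adj a b -> adj b a.
Proof. by rewrite /adj (relC a b); apply: inL_conj. Qed.

Lemma inL_sc k r : inL r -> inL (dsc k r).
Proof. by case=> h4 h5 h6; split=> /=; rewrite ?h4 ?h5 ?h6; ring. Qed.

Lemma rel_scr k a b : rel a (dsc k b) = dsc k (rel a b).
Proof. exact: dscaler. Qed.

Lemma rel_scl k a b : rel (dsc k a) b = dsc k (rel a b).
Proof. by rewrite relC rel_scr [in RHS]relC; case: (rel b a) => *; congr DQ => /=; ring. Qed.

Lemma adj_scr k a b : adj a b -> adj a (dsc k b).
Proof. by rewrite /adj rel_scr; apply: inL_sc. Qed.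

Lemma adj_scl k a b : adj a b -> adj (dsc k a) b.
Proof. by rewrite /adj rel_scl; apply: inL_sc. Qed.

Lemma rel_addr a b c : rel a (dadd b c) = dadd (rel a b) (rel a c).
Proof. exact: dmulDr. Qed.

Lemma inL_add r s : inL r -> inL s -> inL (dadd r s).
Proof. by case=> h4 h5 h6 [k4 k5 k6]; split=> /=; rewrite ?h4 ?h5 ?h6 ?k4 ?k5 ?k6; ring. Qed.

Lemma adj_add a b c : adj a b -> adj a c -> adj a (dadd b c).
Proof. by rewrite /adj rel_addr; apply: inL_add. Qed.

Local Notation C := R[i].
Local Open Scope complex_scope.

Definition cdet (c d : C) : R := complex.Re c * complex.Im d - complex.Im c * complex.Re d.

(** The quadric cone x3 x7 = (x2 - x1) (x2 + x1) in the imaginary part of L is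
    ruled by two families of planes, so it is parametrised by the rank one
    2 x 2 matrices, i.e. by pairs c, d of vectors of R^2, here complex numbers. *)
Definition cone (c d : C) : dq :=
  let: c0 +i* c1 := c in let: e0 +i* e1 := d in
  DQ 0 (c0 * e1 - c1 * e0) (c0 * e1 + c1 * e0) (2%:R * (c0 * e0))
     0 (q * (c0 * e1 - c1 * e0)) (- (p * (c0 * e1 + c1 * e0))) (2%:R * (c1 * e1)).

Definition scal (w : R) : dq := DQ w 0 0 0 0 0 0 0.
Definition edge (w : R) (c d : C) : dq := dadd (scal w) (cone c d).

Hypothesis p01 : 0 < p < 1.

Let p_neq0 : p != 0. Proof. by case/andP: p01 => h _; rewrite gt_eqF. Qed.
Let q_neq0 : q != 0. Proof. by case/andP: p01 => _ h; rewrite subr_eq0 gt_eqF. Qed.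
Let p_gt0 : 0 < p. Proof. by case/andP: p01. Qed.
Let q_gt0 : 0 < q. Proof. by case/andP: p01 => _ ?; rewrite subr_gt0. Qed.

Lemma inL_edge w c d : inL (edge w c d).
Proof. by case: c => *; case: d => *; split=> /=; ring. Qed.

Lemma null_edge w c d : form (edge w c d) (edge w c d) = 0.
Proof. by case: c => *; case: d => *; rewrite /form /=; ring. Qed.

(** When the coordinate z = x3 r vanishes, the cone equation factors and c or d
    can be taken to be the imaginary unit. *)
Lemma edgeP r : inL r -> form r r = 0 -> r <> scal (x0 r) ->
  exists w c d, [/\ r = edge w c d, c != 0 & d != 0].
Proof.
case: r => w x y z u x' y' z' [/= -> -> ->] hr hs.
(* the Study equation on L, divided by 2 p (1 - p) *)
have hz : z * z' = (y - x) * (y + x).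
  apply: (@mulfI _ (2%:R * (p * q))); first by rewrite !mulf_neq0 ?pnatr_eq0.
  by rewrite -[LHS]addr0 -[X in _ + X]oppr0 -hr /form /=; ring.
exists w; have [z0|z0] := eqVneq z 0; last first.
  exists (z +i* (y - x)), (2%:R^-1 +i* (2%:R^-1 * ((x + y) / z))).
  split; last 2 [by rewrite eq_complex /= negb_and z0].
    have h2 : (2%:R : R) != 0 by rewrite pnatr_eq0.
    have ez : z' = (y - x) * (y + x) / z by rewrite -hz mulrAC divff // mul1r.
    by congr DQ; rewrite /= ?ez; field; rewrite ?z0.
  by rewrite eq_complex /= negb_and invr_eq0 pnatr_eq0.
move: hz hs; rewrite z0 mul0r => /esym/eqP; rewrite mulf_eq0 subr_eq0 addr_eq0.
case/orP=> /eqP -> hs.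
  exists (x +i* (z' / 2%:R)), (0 +i* 1); split.
  - by congr DQ; rewrite /=; field.
  - rewrite eq_complex /=; apply/negP => /andP[/eqP ex /eqP]; move/(congr1 ( *%R^~ 2%:R)).
    rewrite mul0r divfK ?pnatr_eq0 // => ez; apply: hs.
    by rewrite ex ez /scal; congr DQ; rewrite /= ?mulr0 ?oppr0.
  - by rewrite eq_complex /= negb_and oner_eq0 orbT.
exists (0 +i* 1), ((- x) +i* (z' / 2%:R)); split.
- by congr DQ; rewrite /=; field.
- by rewrite eq_complex /= negb_and oner_eq0 orbT.
- rewrite eq_complex /= oppr_eq0; apply/negP => /andP[/eqP ex /eqP]; move/(congr1 ( *%R^~ 2%:R)).
  rewrite mul0r divfK ?pnatr_eq0 // => ez; apply: hs.
  by rewrite ex ez /scal; congr DQ; rewrite /=; ring.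
Qed.

(** The line coordinates m = I + J + eps (p J - (1 - p) I) of the first axis
    satisfy m^2 = - 1, hence right multiplication by u + v m is a complex
    structure commuting with all left multiplications.  With respect to it
    hM (rel a b) is the hermitian and OM (rel a b) the alternating bilinear
    form of a 4-dimensional complex vector space, up to constant factors.  The
    real part of hM is the Study form.  Orthogonality with respect to hM says
    that the contact elements on the first axis have a common tangent sphere. *)
Definition hM (r : dq) : C :=
  x4 r +i* (p * (x5 r - q * x1 r) + q * (x6 r + p * x2 r)).
Definition OM (r : dq) : C :=
  (x3 r + x7 r) +i* (x6 r + p * x2 r - x5 r - (1 + p) * x1 r).
(** Right multiplication by u + v m, the complex structure attached to the first axis. *)
Definition act (r : dq) (z : C) : dq :=
  let: u +i* v := z in dmul r (DQ u v v 0 0 (- (q * v)) (p * v) 0).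
(** The automorphism that interchanges the two axes: whatever is proved with hM
    and OM for the first axis holds for the second one after dsig. *)
Definition dsig (r : dq) : dq :=
  DQ (x0 r) (x1 r) (- x2 r) (- x3 r) (x4 r) (x5 r) (- x6 r) (- x7 r).

Ltac ceq := apply/eqP; rewrite eq_complex /=; apply/andP; split; apply/eqP; ring.

Lemma hM_act r z : hM (act r z) = hM r * z.
Proof. by case: r => *; case: z => *; ceq. Qed.
Lemma OM_act r z : OM (act r z) = OM r * z.
Proof. by case: r => *; case: z => *; ceq. Qed.
Lemma hM_conj r : hM (dconj r) = ((hM r)^*)%C.
Proof. by case: r => *; ceq. Qed.
Lemma OM_conj r : OM (dconj r) = - OM r.
Proof. by case: r => *; ceq. Qed.
Lemma hM_add r s : hM (dadd r s) = hM r + hM s.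
Proof. by case: r => *; case: s => *; ceq. Qed.
Lemma OM_add r s : OM (dadd r s) = OM r + OM s.
Proof. by case: r => *; case: s => *; ceq. Qed.
Lemma hM_sc k r : hM (dsc k r) = k%:C * hM r.
Proof. by case: r => *; ceq. Qed.
Lemma OM_sc k r : OM (dsc k r) = k%:C * OM r.
Proof. by case: r => *; ceq. Qed.
Lemma OM_edge w c d : OM (edge w c d) = 2%:R * c * (d^*)%C.
Proof. by case: c => *; case: d => *; ceq. Qed.
Lemma rel_act a b z : rel a (act b z) = act (rel a b) z.
Proof. by case: z => u v; rewrite /act /rel dmulA. Qed.

Lemma dsigM a b : dsig (dmul a b) = dmul (dsig a) (dsig b).
Proof. by case: a => *; case: b => *; congr DQ; rewrite /=; ring. Qed.
Lemma dsig_conj a : dsig (dconj a) = dconj (dsig a).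
Proof. by []. Qed.
Lemma rel_sig a b : rel (dsig a) (dsig b) = dsig (rel a b).
Proof. by rewrite /rel dsigM dsig_conj. Qed.
Lemma form_sig a b : form (dsig a) (dsig b) = form a b.
Proof. by rewrite /form /=; ring. Qed.
Lemma nrm_sig a : nrm (dsig a) = nrm a.
Proof. by rewrite /nrm /=; ring. Qed.
Lemma inL_sig r : inL r -> inL (dsig r).
Proof. by case=> h4 h5 h6; split=> /=; rewrite ?h4 ?h5 ?h6; ring. Qed.
Lemma edge_sig w c d : dsig (edge w c d) = edge w d (- c).
Proof. by case: c => *; case: d => *; congr DQ; rewrite /=; ring. Qed.

Lemma inL_hM r : inL r <-> hM r = 0 /\ hM (dsig r) = 0.
Proof.
split=> [[h4 h5 h6]|].
  by split; rewrite /hM /= ?h4 ?h5 ?h6; ceq.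
case; rewrite /hM /=; case=> h4 h5; case=> _ h6.
have e5 : x5 r - q * x1 r = 0.
  apply: (@mulfI _ (2%:R * p)); first by rewrite mulf_neq0 ?pnatr_eq0.
  by rewrite mulr0 -[RHS]addr0 -{1}h5 -h6; ring.
have e6 : x6 r + p * x2 r = 0.
  apply: (@mulfI _ (2%:R * q)); first by rewrite mulf_neq0 ?pnatr_eq0.
  by rewrite mulr0 -[RHS]subr0 -{1}h5 -h6; ring.
split=> //; first by apply/eqP; rewrite -subr_eq0 e5.
by apply/eqP; rewrite -addr_eq0 e6.
Qed.

Lemma form_edges w1 c1 e1 w2 c2 e2 :
  x4 (rel (edge w1 c1 e1) (edge w2 c2 e2)) = 4%:R * (p * q) * (cdet c1 c2 * cdet e1 e2).
Proof. by case: c1 => *; case: e1 => *; case: c2 => *; case: e2 => *; rewrite /cdet /=; ring. Qed.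

Lemma hM_edges w1 c1 e1 w2 c2 e2 :
  hM (rel (edge w1 c1 e1) (edge w2 c2 e2)) =
  (4%:R * (p * q) * cdet e1 e2)%:C * (- 'i * ((c1^*)%C * c2)).
Proof. by case: c1 => *; case: e1 => *; case: c2 => *; case: e2 => *; rewrite /cdet; ceq. Qed.

End Model.

(** * Quadrilaterals *)

(** The Vandermonde determinant of three distinct points of the projective line. *)
Lemma quadratic_three_zeros (F : fieldType) (A B C o1 b1 o2 b2 o3 b3 : F) :
  b2 * o3 - b3 * o2 != 0 -> b3 * o1 - b1 * o3 != 0 -> b1 * o2 - b2 * o1 != 0 ->
  A * b1 ^+ 2 - B * (o1 * b1) + C * o1 ^+ 2 = 0 ->
  A * b2 ^+ 2 - B * (o2 * b2) + C * o2 ^+ 2 = 0 ->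
  A * b3 ^+ 2 - B * (o3 * b3) + C * o3 ^+ 2 = 0 ->
  [/\ A = 0, B = 0 & C = 0].
Proof.
move=> h1 h2 h3 q1 q2 q3.
have hV : (b2 * o3 - b3 * o2) * (b3 * o1 - b1 * o3) * (b1 * o2 - b2 * o1) != 0.
  by rewrite !mulf_neq0.
split; apply: (mulfI hV); rewrite mulr0.
- transitivity (- ((A * b1 ^+ 2 - B * (o1 * b1) + C * o1 ^+ 2) * (o2 * o3 * (o3 * b2 - o2 * b3))
   + (A * b2 ^+ 2 - B * (o2 * b2) + C * o2 ^+ 2) * (o1 * o3 * (o1 * b3 - o3 * b1))
   + (A * b3 ^+ 2 - B * (o3 * b3) + C * o3 ^+ 2) * (o1 * o2 * (o2 * b1 - o1 * b2)))).
    by ring.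
  by rewrite q1 q2 q3; ring.
- transitivity (- ((A * b1 ^+ 2 - B * (o1 * b1) + C * o1 ^+ 2) * (b2 ^+ 2 * o3 ^+ 2 - b3 ^+ 2 * o2 ^+ 2)
   + (A * b2 ^+ 2 - B * (o2 * b2) + C * o2 ^+ 2) * (b3 ^+ 2 * o1 ^+ 2 - b1 ^+ 2 * o3 ^+ 2)
   + (A * b3 ^+ 2 - B * (o3 * b3) + C * o3 ^+ 2) * (b1 ^+ 2 * o2 ^+ 2 - b2 ^+ 2 * o1 ^+ 2))).
    by ring.
  by rewrite q1 q2 q3; ring.
- transitivity (- ((A * b1 ^+ 2 - B * (o1 * b1) + C * o1 ^+ 2) * (b2 * b3 * (o3 * b2 - o2 * b3))
   + (A * b2 ^+ 2 - B * (o2 * b2) + C * o2 ^+ 2) * (b1 * b3 * (o1 * b3 - o3 * b1))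
   + (A * b3 ^+ 2 - B * (o3 * b3) + C * o3 ^+ 2) * (b1 * b2 * (o2 * b1 - o1 * b2)))).
    by ring.
  by rewrite q1 q2 q3; ring.
Qed.

(** The hypotheses say that the binary quadratic form with coefficients
    A, - B, C below vanishes at the three points (b_k : o_k).  These are distinct,
    so A = B = C = 0, and the conclusion is the value at (a1 : p1), up to the
    factor n1. *)
Lemma cube_scalars (F : fieldType) (o1 o2 o3 p1 p2 p3 a1 a2 a3 b1 b2 b3 n1 n2 n3 : F) :
  n1 != 0 -> n2 != 0 -> n3 != 0 ->
  b2 * o3 - b3 * o2 != 0 -> b3 * o1 - b1 * o3 != 0 -> b1 * o2 - b2 * o1 != 0 ->
  n2 * (b3 * o1 - b1 * o3) * (p3 * b1 - o1 * a3) =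
    n3 * (b1 * o2 - b2 * o1) * (p2 * b1 - o1 * a2) ->
  n3 * (b1 * o2 - b2 * o1) * (p1 * b2 - o2 * a1) =
    n1 * (b2 * o3 - b3 * o2) * (p3 * b2 - o2 * a3) ->
  n1 * (b2 * o3 - b3 * o2) * (p2 * b3 - o3 * a2) =
    n2 * (b3 * o1 - b1 * o3) * (p1 * b3 - o3 * a1) ->
  n3 * (p1 * b2 - o2 * a1) * (p1 * a2 - p2 * a1) =
    n2 * (p1 * b3 - o3 * a1) * (p3 * a1 - p1 * a3).
Proof.
move=> h1 h2 h3 d1 d2 d3 e1 e2 e3.
pose A := n2 * n3 * (o1 * p1) + n1 * n3 * (o2 * p2) + n1 * n2 * (o3 * p3).
pose B := n2 * n3 * (o1 * a1 + b1 * p1) + n1 * n3 * (o2 * a2 + b2 * p2) + n1 * n2 * (o3 * a3 + b3 * p3).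
pose C := n2 * n3 * (a1 * b1) + n1 * n3 * (a2 * b2) + n1 * n2 * (a3 * b3).
have [] := @quadratic_three_zeros _ A B C o1 b1 o2 b2 o3 b3 d1 d2 d3.
- transitivity (n1 * (n3 * (b1 * o2 - b2 * o1) * (p2 * b1 - o1 * a2)
     - n2 * (b3 * o1 - b1 * o3) * (p3 * b1 - o1 * a3))); first by rewrite /A /B /C; ring.
  by rewrite e1 subrr mulr0.
- transitivity (n2 * (n1 * (b2 * o3 - b3 * o2) * (p3 * b2 - o2 * a3)
     - n3 * (b1 * o2 - b2 * o1) * (p1 * b2 - o2 * a1))); first by rewrite /A /B /C; ring.
  by rewrite e2 subrr mulr0.
- transitivity (n3 * (n2 * (b3 * o1 - b1 * o3) * (p1 * b3 - o3 * a1)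
     - n1 * (b2 * o3 - b3 * o2) * (p2 * b3 - o3 * a2))); first by rewrite /A /B /C; ring.
  by rewrite e3 subrr mulr0.
move=> hA hB hC; apply: (mulfI h1); apply/eqP; rewrite -subr_eq0; apply/eqP.
transitivity (A * a1 ^+ 2 - B * (p1 * a1) + C * p1 ^+ 2); first by rewrite /A /B /C; ring.
by rewrite hA hB hC; ring.
Qed.

Section Quads.
Variable R : rcfType.
Variable p : R.
Local Notation q := (1 - p).
Hypothesis p01 : 0 < p < 1.
Local Notation dq := (dq R).
Local Notation C := R[i].
Local Open Scope complex_scope.
Local Notation rel := (rel p).
Local Notation form := (form p).
Local Notation nrm := (nrm p).
Local Notation adj := (adj p).
Local Notation edge := (edge p).
Local Notation hM := (hM p).
Local Notation OM := (OM p).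
Local Notation act := (act p).

Let p_neq0 : p != 0. Proof. by case/andP: p01 => h _; rewrite gt_eqF. Qed.
Let q_neq0 : q != 0. Proof. by case/andP: p01 => _ h; rewrite subr_eq0 gt_eqF. Qed.
Let p_gt0 : 0 < p. Proof. by case/andP: p01. Qed.
Let q_gt0 : 0 < q. Proof. by case/andP: p01 => _ ?; rewrite subr_gt0. Qed.

Ltac ceq := apply/eqP; rewrite eq_complex /=; apply/andP; split; apply/eqP; ring.

Definition proper (a : dq) := form a a = 0 /\ nrm a != 0.
Definition sqn (c : C) : R := complex.Re c ^+ 2 + complex.Im c ^+ 2.
(** A real invariant of an edge that takes equal values on opposite edges of a
    quadrilateral (quad_lab); sqn (OM _) turns it into a function on P^7. *)
Definition lab (a b : dq) : R := nrm a * nrm b / sqn (OM (rel a b)).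

Lemma sqn_neq0 c : (sqn c != 0) = (c != 0).
Proof. by case: c => a b; rewrite /sqn /= paddr_eq0 ?sqr_ge0 // !sqrf_eq0 eq_complex. Qed.
Lemma sqn_ge0 c : 0 <= sqn c.
Proof. by rewrite /sqn addr_ge0 ?sqr_ge0. Qed.
Lemma sqnM c d : sqn (c * d) = sqn c * sqn d.
Proof. by case: c => *; case: d => *; rewrite /sqn /=; ring. Qed.
Lemma sqnE c : (sqn c)%:C = c * (c^*)%C.
Proof. by case: c => *; rewrite /sqn; ceq. Qed.
Lemma sqn_conj c : sqn (c^*)%C = sqn c.
Proof. by case: c => *; rewrite /sqn /=; ring. Qed.
Lemma sqn_real (k : R) : sqn k%:C = k ^+ 2.
Proof. by rewrite /sqn /=; ring. Qed.
Lemma realC_eq0 (k : R) : (k%:C == 0) = (k == 0).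
Proof. by rewrite eq_complex /= eqxx andbT. Qed.
Lemma conjC_eq0' (c : C) : ((c^*)%C == 0) = (c == 0).
Proof. by case: c => a b; rewrite !eq_complex /= oppr_eq0. Qed.

Lemma nrm_ge0 a : 0 <= nrm a.
Proof.
by do ?[exact: sqr_ge0 | exact: ltW | apply: addr_ge0 | apply: mulr_ge0].
Qed.

Lemma sqn_OM_edge w c d : sqn (OM (edge w c d)) = 4%:R * (sqn c * sqn d).
Proof. by rewrite OM_edge !sqnM sqn_conj; rewrite /sqn /=; ring. Qed.

Lemma sqnN c : sqn (- c) = sqn c.
Proof. by case: c => *; rewrite /sqn /=; ring. Qed.

Lemma labC a b : lab a b = lab b a.
Proof. rewrite /lab (relC p b a). rewrite OM_conj. rewrite sqnN. by rewrite (mulrC (nrm a)). Qed.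

Let one : dq := scal 1.

Lemma act_scale o z : proper o -> forall v, rel o v = act one z ->
  v = act o (((nrm o)^-1)%:C * z).
Proof.
move=> [no ho] v hv.
have -> : v = dsc (nrm o)^-1 (dmul p o (rel o v)).
  by rewrite mul_null_conj // dscA mulVf // dsc1.
rewrite hv; case: z {hv} => s t; case: o no ho => *.
by congr DQ; rewrite /=; ring.
Qed.

Let hM_edge_cone w c d v : hM (rel (edge w c d) v) =
  (c^*)%C * ((2%:R * complex.Re d)%:C * hM (rel (DQ 0 0 0 1 0 0 0 0) v)
             + (complex.Im d)%:C * hM (rel (DQ 0 1 1 0 0 q (- p) 0) v))
  + hM v * (((w + complex.Im c * complex.Im d)
             +i* - ((q - p) * complex.Im c * complex.Re d))).
Proof. by case: c => *; case: d => *; case: v => *; ceq. Qed.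

(** Three vectors of a 4-dimensional complex space with nondegenerate hermitian
    form have a one-dimensional orthogonal complement; o is orthogonal to
    itself and to its neighbours e, e', so the complement is spanned by o. *)
Lemma perp_three o e e' v : proper o -> adj o e -> adj o e' ->
  form e e = 0 -> form e' e' = 0 ->
  hM (rel e e') != 0 ->
  hM (rel o v) = 0 -> hM (rel e v) = 0 -> hM (rel e' v) = 0 ->
  exists z, v = act o z.
Proof.
move=> po ae ae' ne ne' hee ho he he'; have [no no0] := po.
have edg x y : adj o x -> form x x = 0 -> hM (rel x y) != 0 -> adj o y ->
    exists w c d, [/\ rel o x = edge w c d, c != 0 & d != 0].
  move=> ax nx hxy ay; apply: (edgeP p01) => //.
    by rewrite form_rel nx no; ring.
  move=> hs; move/eqP: hxy; apply.
  have : hM (rel (rel o x) (rel o y)) = 0.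
    rewrite hs; have [/= h4 h5 h6] := ay.
    by case: (rel o y) h4 h5 h6 => ? ? ? ? ? ? ? ? /= -> -> ->; ceq.
  rewrite rel_from // hM_sc => /eqP; rewrite mulf_eq0 realC_eq0 (negbTE no0) /=.
  by move/eqP.
have [w [c [d [E c0 _]]]] := edg _ _ ae ne hee ae'.
have hee' : hM (rel e' e) != 0 by rewrite relC hM_conj conjC_eq0'.
have [w' [c' [d' [E' c0' _]]]] := edg _ _ ae' ne' hee' ae.
have hdd : cdet d d' != 0.
  apply: contra hee => /eqP hd.
  have := rel_from e e' no; rewrite E E' => /(congr1 hM).
  rewrite hM_edges hd mulr0 mul0r hM_sc => /esym/eqP.
  by rewrite mulf_eq0 realC_eq0 (negbTE no0).
have key x u (c1 d1 : C) : rel o x = edge u c1 d1 -> c1 != 0 -> hM (rel x v) = 0 ->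
   (2%:R * complex.Re d1)%:C * hM (rel (DQ 0 0 0 1 0 0 0 0) (rel o v))
     + (complex.Im d1)%:C * hM (rel (DQ 0 1 1 0 0 q (- p) 0) (rel o v)) = 0.
  move=> ex c10 hx; have := rel_from x v no; rewrite ex => /(congr1 hM).
  rewrite hM_edge_cone hM_sc hx ho mulr0 mul0r addr0 => /eqP.
  by rewrite mulf_eq0 conjC_eq0' (negbTE c10) => /eqP.
have k1 := key _ _ _ _ E c0 he; have k2 := key _ _ _ _ E' c0' he'.
set K := hM (rel (DQ 0 0 0 1 0 0 0 0) (rel o v)) in k1 k2 *.
set M := hM (rel (DQ 0 1 1 0 0 q (- p) 0) (rel o v)) in k1 k2 *.
have hD : (cdet d d')%:C != 0 by rewrite realC_eq0.
have hK : K = 0.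
  apply: (mulfI (mulf_neq0 (_ : 2%:R != 0) hD)); first by rewrite pnatr_eq0.
  transitivity (((2%:R * complex.Re d)%:C * K + (complex.Im d)%:C * M) * (complex.Im d')%:C
     - ((2%:R * complex.Re d')%:C * K + (complex.Im d')%:C * M) * (complex.Im d)%:C).
    by rewrite /cdet !(rmorphM, rmorphB, rmorph_nat) /=; ring.
  by rewrite k1 k2; ring.
have hM0 : M = 0.
  apply: (mulfI (mulf_neq0 (_ : 2%:R != 0) hD)); first by rewrite pnatr_eq0.
  transitivity (((2%:R * complex.Re d')%:C * K + (complex.Im d')%:C * M) * (2%:R * complex.Re d)%:C
     - ((2%:R * complex.Re d)%:C * K + (complex.Im d)%:C * M) * (2%:R * complex.Re d')%:C).
    by rewrite /cdet !(rmorphM, rmorphB, rmorph_nat) /=; ring.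
  by rewrite k1 k2; ring.
suff hz : exists z, rel o v = act one z.
  by have [z hz'] := hz; exists (((nrm o)^-1)%:C * z); apply: act_scale.
move: ho hK hM0; rewrite /K /M.
case: (rel o v) => v0 v1 v2 v3 v4 v5 v6 v7.
exists (v0 +i* v1).
move: ho hK hM0 => /eqP; rewrite !eq_complex /= => /andP[/eqP a1 /eqP a2].
move=> /eqP; rewrite !eq_complex /= => /andP[/eqP b1 /eqP b2].
move=> /eqP; rewrite !eq_complex /= => /andP[/eqP d1 /eqP d2].
have pq0 : p * q != 0 by rewrite mulf_neq0.
have e7 : v7 = 0 by apply: (mulfI pq0); rewrite mulr0 -b1; ring.
have e4 : v4 = 0 by [].
have e3 : v3 = 0.
  apply: (mulfI (mulf_neq0 (_ : 2%:R != 0) pq0)); first by rewrite pnatr_eq0.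
  move: d2; rewrite e7 e4; move=> d2'; rewrite mulr0 -d2' ; ring.
have e2 : v2 = v1.
  apply: (mulfI (mulf_neq0 (_ : 2%:R != 0) pq0)); first by rewrite pnatr_eq0.
  apply/eqP; rewrite -subr_eq0; apply/eqP; rewrite -[RHS](subrr 0) -{1}a2 -d1; ring.
have e56 : v6 = v5 + v1.
  apply: (mulfI pq0); apply/eqP; rewrite -subr_eq0; apply/eqP; rewrite -[RHS]b2 e2; ring.
have e5 : v5 = - (q * v1).
  apply/eqP; rewrite -subr_eq0; apply/eqP; rewrite -[RHS]a2 e56 e2; ring.
have e6 : v6 = p * v1 by rewrite e56 e5; ring.
by rewrite e2 e3 e4 e5 e6 e7; congr DQ; rewrite /=; ring.
Qed.


Lemma adj_hM a b : adj a b -> hM (rel a b) = 0.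
Proof. by move/(inL_hM p01) => []. Qed.
Lemma adj_edge a b x : proper a -> form b b = 0 -> adj a b -> adj a x -> form b x != 0 ->
  exists w c d, [/\ rel a b = edge w c d, c != 0 & d != 0].
Proof.
move=> [na a0] nb ab ax h; apply: (edgeP p01) => //.
  by rewrite form_rel nb na; ring.
move=> hs; move/eqP: h; apply.
have := rel_from b x na; rewrite hs => /(congr1 (@x4 R)).
have [h4 _ _] := ax; case: (rel a x) h4 => ? ? ? ? ? ? ? ? /= ->.
have /= -> : x4 (dsc (nrm a) (rel b x)) = nrm a * form b x by rewrite -rel_form.
move=> hh; apply: (mulfI a0); rewrite -hh; ring.
Qed.

(** The two last conditions exclude that the quadrilateral is folded along one
    of its diagonals. *)
Record quad (a b1 b2 d : dq) : Prop := Quad {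
  quad_a : proper a; quad_b1 : proper b1; quad_b2 : proper b2; quad_d : proper d;
  quad_ab1 : adj a b1; quad_ab2 : adj a b2; quad_db1 : adj d b1; quad_db2 : adj d b2;
  quad_bb : form b1 b2 != 0; quad_ad : form a d != 0 }.

Lemma quad_swap a b1 b2 d : quad a b1 b2 d -> quad a b2 b1 d.
Proof. by case=> *; split=> //; rewrite formC. Qed.

Lemma proper_sig a : proper a -> proper (dsig a).
Proof. by case=> h1 h2; split; rewrite ?form_sig ?nrm_sig. Qed.

Lemma adj_sig a b : adj a b -> adj (dsig a) (dsig b).
Proof. by rewrite /adj rel_sig; apply: inL_sig. Qed.

Lemma quad_sig a b1 b2 d : quad a b1 b2 d -> quad (dsig a) (dsig b1) (dsig b2) (dsig d).
Proof.
by case=> *; split; rewrite ?form_sig; do ?[exact: proper_sig | exact: adj_sig | done].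
Qed.

(** Both sides of the first two equations are values of the hermitian forms of
    the two axes on the pair b1, b2, computed from the edge parameters at a and
    at d; the third and the fourth compare the Study forms. *)
Lemma edge_pair_diag a b1 b2 d w1 w2 w3 w4 c1 c2 c3 c4 e1 e2 e3 e4 :
  form a a = 0 -> form d d = 0 ->
  rel a b1 = edge w1 c1 e1 -> rel a b2 = edge w2 c2 e2 ->
  rel d b1 = edge w3 c3 e3 -> rel d b2 = edge w4 c4 e4 ->
  [/\ (nrm d * cdet e1 e2)%:C * ((c1^*)%C * c2) = (nrm a * cdet e3 e4)%:C * ((c3^*)%C * c4),
      (nrm d * cdet c1 c2)%:C * ((e1^*)%C * e2) = (nrm a * cdet c3 c4)%:C * ((e3^*)%C * e4),
      nrm d * (cdet c1 c2 * cdet e1 e2) = nrm a * (cdet c3 c4 * cdet e3 e4)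
    & 4%:R * (p * q) * (cdet c1 c2 * cdet e1 e2) = nrm a * form b1 b2].
Proof.
move=> na nd E1 E2 E3 E4.
have h1 := rel_from b1 b2 na; have h2 := rel_from b1 b2 nd.
have h : dsc (nrm d) (rel (edge w1 c1 e1) (edge w2 c2 e2)) =
         dsc (nrm a) (rel (edge w3 c3 e3) (edge w4 c4 e4)).
  by rewrite -E1 -E2 -E3 -E4 h1 h2 !dscA mulrC.
have pq0 : 4%:R * (p * q) != 0 by rewrite !mulf_neq0 ?pnatr_eq0.
have pq0' : (4%:R * (p * q))%:C * (- 'i)%C != 0 :> C.
  by rewrite mulf_neq0 ?realC_eq0 // eq_complex /= negb_and !oppr_eq0 oner_eq0 orbT.
split.
- have := congr1 hM h; rewrite !hM_sc !hM_edges.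
  move: (cdet e1 e2) (cdet e3 e4) ((c1^*)%C * c2) ((c3^*)%C * c4) => k l z z' h'.
  apply: (mulfI pq0'); move: h'; rewrite !(rmorphM, rmorphB, rmorph_nat, rmorph1) /= => h'.
  by transitivity ((nrm d)%:C * (4 * (p%:C * (1 - p%:C)) * k%:C * (- 'i * z)));
    [ring | rewrite h'; ring].
- have := congr1 (fun x => hM (dsig x)) h.
  have sg k x : dsig (dsc k x) = dsc k (dsig x) by case: x => *; congr DQ; rewrite /=; ring.
  have cN (x y : C) : cdet (- x) (- y) = cdet x y.
    by case: x => *; case: y => *; rewrite /cdet /=; ring.
  rewrite !sg -!rel_sig !edge_sig !hM_sc !hM_edges !cN.
  move: (cdet c1 c2) (cdet c3 c4) ((e1^*)%C * e2) ((e3^*)%C * e4) => k l z z' h'.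
  apply: (mulfI pq0'); move: h'; rewrite !(rmorphM, rmorphB, rmorph_nat, rmorph1) /= => h'.
  by transitivity ((nrm d)%:C * (4 * (p%:C * (1 - p%:C)) * k%:C * (- 'i * z)));
    [ring | rewrite h'; ring].
- have := congr1 (@x4 R) h.
  have sc4 k x : x4 (dsc k x) = k * x4 x by [].
  rewrite !sc4 !form_edges => h'; apply: (mulfI pq0).
  by rewrite mulrCA h'; ring.
- have := congr1 (@x4 R) h1; rewrite E1 E2 form_edges => ->.
  by rewrite -rel_form.
Qed.

Lemma edge_conj w c e : dconj (edge w c e) = edge w (- c) e.
Proof. by case: c => *; case: e => *; congr DQ; rewrite /=; ring. Qed.

Lemma cdetNN (x y : C) : cdet (- x) (- y) = cdet x y.
Proof. by case: x => *; case: y => *; rewrite /cdet /=; ring. Qed.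

Lemma quad_edges a b1 b2 d : quad a b1 b2 d ->
  exists w1 w2 w3 w4 c1 c2 c3 c4 e1 e2 e3 e4,
    [/\ [/\ rel a b1 = edge w1 c1 e1, rel a b2 = edge w2 c2 e2,
            rel d b1 = edge w3 c3 e3 & rel d b2 = edge w4 c4 e4],
        [/\ c1 != 0, c2 != 0, c3 != 0 & c4 != 0]
      & [/\ e1 != 0, e2 != 0, e3 != 0 & e4 != 0]].
Proof.
case=> pa [n1 _] [n2 _] pd a1 a2 d1 d2 h12 had.
have h21 : form b2 b1 != 0 by rewrite formC.
have [w1 [c1 [e1 [-> ? ?]]]] := adj_edge pa n1 a1 a2 h12.
have [w2 [c2 [e2 [-> ? ?]]]] := adj_edge pa n2 a2 a1 h21.
have [w3 [c3 [e3 [-> ? ?]]]] := adj_edge pd n1 d1 d2 h12.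
have [w4 [c4 [e4 [-> ? ?]]]] := adj_edge pd n2 d2 d1 h21.
by exists w1, w2, w3, w4, c1, c2, c3, c4, e1, e2, e3, e4.
Qed.

Let pair_sqn (n m k l : R) (c1 c2 c3 c4 : C) :
  (n * k)%:C * ((c1^*)%C * c2) = (m * l)%:C * ((c3^*)%C * c4) ->
  (n * k) ^+ 2 * (sqn c1 * sqn c2) = (m * l) ^+ 2 * (sqn c3 * sqn c4).
Proof. by move/(congr1 sqn); rewrite !sqnM !sqn_conj !sqn_real. Qed.

Let pair_nu (n m k l s t : R) (c1 c2 c3 c4 e1 e2 e3 e4 : C) :
  n * (l * k) = m * (s * t) -> n * (l * k) != 0 ->
  (n * k)%:C * ((c1^*)%C * c2) = (m * t)%:C * ((c3^*)%C * c4) ->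
  (n * l)%:C * ((e1^*)%C * e2) = (m * s)%:C * ((e3^*)%C * e4) ->
  n ^+ 2 * (sqn c1 * sqn e1 * (sqn c2 * sqn e2)) = m ^+ 2 * (sqn c3 * sqn e3 * (sqn c4 * sqn e4)).
Proof.
move=> h h0 /pair_sqn hc /pair_sqn he.
have h2 : (n * (l * k)) ^+ 2 != 0 by rewrite expf_neq0.
apply: (mulfI h2).
transitivity ((n * k) ^+ 2 * (sqn c1 * sqn c2) * ((n * l) ^+ 2 * (sqn e1 * sqn e2))); first by ring.
by rewrite hc he h; ring.
Qed.

(** Taking squared absolute values in edge_pair_diag at the pairs a, d and b1, b2
    of opposite vertices and multiplying cancels all but two opposite edges; labels
    are nonnegative, so their squares determine them. *)
Lemma quad_lab a b1 b2 d : quad a b1 b2 d -> lab a b1 = lab d b2.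
Proof.
move=> Q; have Q' := Q; case: Q' => [[na a0]] [nb1 b10] [nb2 b20] [nd dn0] _ _ _ _ h12 had.
have [w1 [w2 [w3 [w4 [c1 [c2 [c3 [c4 [e1 [e2 [e3 [e4]]]]]]]]]]]] := quad_edges Q.
case=> -[E1 E2 E3 E4] [C1 C2 C3 C4] [D1 D2 D3 D4].
have pq0 : 4%:R * (p * q) != 0 by rewrite !mulf_neq0 ?pnatr_eq0.
have [k1 k2 k3 k4] := edge_pair_diag na nd E1 E2 E3 E4.
have E1' : rel b1 a = edge w1 (- c1) e1 by rewrite relC E1 edge_conj.
have E2' : rel b2 a = edge w2 (- c2) e2 by rewrite relC E2 edge_conj.
have E3' : rel b1 d = edge w3 (- c3) e3 by rewrite relC E3 edge_conj.
have E4' : rel b2 d = edge w4 (- c4) e4 by rewrite relC E4 edge_conj.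
have [l1 l2 l3 l4] := edge_pair_diag nb1 nb2 E1' E3' E2' E4'.
have k0 : nrm d * (cdet c1 c2 * cdet e1 e2) != 0.
  rewrite mulf_neq0 //; apply: contraTneq isT => z; move: k4; rewrite z mulr0 => /esym/eqP.
  by rewrite mulf_eq0 (negbTE a0) (negbTE h12).
have l0 : nrm b2 * (cdet (- c1) (- c3) * cdet e1 e3) != 0.
  rewrite mulf_neq0 //; apply: contraTneq isT => z; move: l4; rewrite z mulr0 => /esym/eqP.
  by rewrite mulf_eq0 (negbTE b10) (negbTE had).
have A := pair_nu k3 k0 k1 k2; have B := pair_nu l3 l0 l1 l2.
rewrite !sqnN in B.
have u : (nrm d * nrm b2 * (sqn c1 * sqn e1)) ^+ 2 = (nrm a * nrm b1 * (sqn c4 * sqn e4)) ^+ 2.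
  have h : sqn c2 * sqn e2 * (sqn c3 * sqn e3) != 0 by rewrite !mulf_neq0 ?sqn_neq0.
  apply: (mulfI h).
  transitivity (nrm d ^+ 2 * (sqn c1 * sqn e1 * (sqn c2 * sqn e2)) *
     (nrm b2 ^+ 2 * (sqn c1 * sqn e1 * (sqn c3 * sqn e3)))); first by ring.
  by rewrite A B; ring.
have v : nrm d * nrm b2 * (sqn c1 * sqn e1) = nrm a * nrm b1 * (sqn c4 * sqn e4).
  apply: (pexpIrn (n := 2)) => //; rewrite qualifE /= !mulr_ge0 ?nrm_ge0 ?sqn_ge0 //.
rewrite /lab E1 E4 !sqn_OM_edge.
have n1 : sqn c1 * sqn e1 != 0 by rewrite mulf_neq0 ?sqn_neq0.
have n4 : sqn c4 * sqn e4 != 0 by rewrite mulf_neq0 ?sqn_neq0.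
have f4 : (4%:R : R) != 0 by rewrite pnatr_eq0.
have m1 : 4%:R * (sqn c1 * sqn e1) != 0 by rewrite mulf_neq0.
have m4 : 4%:R * (sqn c4 * sqn e4) != 0 by rewrite mulf_neq0.
apply/eqP; rewrite (eqr_div _ _ m1 m4); apply/eqP.
transitivity (4%:R * (nrm a * nrm b1 * (sqn c4 * sqn e4))); first by ring.
by rewrite -v; ring.
Qed.

(** The complex refinement of quad_lab: the phases of the edge parameters are
    tied together as well, since both hermitian forms are used. *)
Lemma quad_OM a b1 b2 d : quad a b1 b2 d ->
  OM (rel a b1) * OM (rel d b2) * (lab a b1)%:C = OM (rel a b2) * OM (rel d b1) * (lab a b2)%:C.
Proof.
move=> Q; have Q' := Q; case: Q' => [[na a0]] [nb1 b10] [nb2 b20] [nd dn0] _ _ _ _ h12 had.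
have := quad_lab (quad_swap Q); move: Q.
move=> /quad_edges [w1 [w2 [w3 [w4 [c1 [c2 [c3 [c4 [e1 [e2 [e3 [e4]]]]]]]]]]]].
case=> -[E1 E2 E3 E4] [C1 C2 C3 C4] [D1 D2 D3 D4].
rewrite /lab E1 E2 E3 E4 !sqn_OM_edge !OM_edge.
set n1 := sqn c1 * sqn e1; set n2 := sqn c2 * sqn e2; set n3 := sqn c3 * sqn e3; set n4 := sqn c4 * sqn e4.
have [k1 k2 k3 k4] := edge_pair_diag na nd E1 E2 E3 E4.
have pq0 : 4%:R * (p * q) != 0 by rewrite !mulf_neq0 ?pnatr_eq0.
have k0 : nrm d * (cdet c1 c2 * cdet e1 e2) != 0.
  rewrite mulf_neq0 //; apply: contraTneq isT => z; move: k4; rewrite z mulr0 => /esym/eqP.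
  by rewrite mulf_eq0 (negbTE a0) (negbTE h12).
have f4 : (4%:R : R) != 0 by rewrite pnatr_eq0.
have N2 : n2 != 0 by rewrite mulf_neq0 ?sqn_neq0.
have N3 : n3 != 0 by rewrite mulf_neq0 ?sqn_neq0.
have N4 : n4 != 0 by rewrite mulf_neq0 ?sqn_neq0.
(* the two products of edge parameters agree up to a positive real factor *)
have key : (nrm d * n1)%:C * (c2 * c3 * ((e2^*)%C * (e3^*)%C)) =
           (nrm a * n3)%:C * (c1 * c4 * ((e1^*)%C * (e4^*)%C)).
  have h : (nrm d * (cdet c1 c2 * cdet e1 e2))%:C != 0 by rewrite realC_eq0.
  apply: (mulfI h).
  have k2' : (nrm d * cdet c1 c2)%:C * (e1 * (e2^*)%C) = (nrm a * cdet c3 c4)%:C * (e3 * (e4^*)%C).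
    have := congr1 (fun z : C => (z^*)%C) k2.
    have cJ (k : R) (z w : C) : ((k%:C * ((z^*)%C * w))^*)%C = k%:C * (z * (w^*)%C).
      by case: z => *; case: w => *; ceq.
    by rewrite !cJ.
  transitivity (((nrm d * cdet e1 e2)%:C * ((c1^*)%C * c2)) * (c1 * c3) *
    ((nrm d * cdet c1 c2)%:C * (e1 * (e2^*)%C) * ((e1^*)%C * (e3^*)%C))).
    rewrite /n1; move: k0 k3 (cdet c1 c2) (cdet e1 e2) => _ _ k l.
    by rewrite !rmorphM /= !sqnE; ring.
  rewrite k1 k2' k3 /n3; move: (cdet c3 c4) (cdet e3 e4) => k l.
  by rewrite !rmorphM /= !sqnE; ring.
move=> e23.
have hb : nrm b2 * nrm a * n3 = nrm d * nrm b1 * n2.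
  have m2 : 4%:R * n2 != 0 by rewrite mulf_neq0.
  have m3 : 4%:R * n3 != 0 by rewrite mulf_neq0.
  move/eqP: e23; rewrite (eqr_div _ _ m2 m3) => /eqP e23.
  by apply: (mulfI f4); transitivity (nrm a * nrm b2 * (4%:R * n3)); [ring | rewrite e23; ring].
have hd : ((nrm a * n3)%:C : C) != 0 by rewrite realC_eq0 mulf_neq0.
apply: (mulfI hd).
transitivity (4%:R * ((nrm a * nrm b1 / (4%:R * n1)))%:C *
    ((nrm a * n3)%:C * (c1 * c4 * ((e1^*)%C * (e4^*)%C)))); first by ring.
rewrite -key.
have N1 : n1 != 0 by rewrite mulf_neq0 ?sqn_neq0.
transitivity (4%:R * ((nrm a * nrm b1 / (4%:R * n1)) * (nrm d * n1))%:C *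
   (c2 * c3 * ((e2^*)%C * (e3^*)%C))); first by rewrite [in RHS]rmorphM /=; ring.
have -> : nrm a * nrm b1 / (4%:R * n1) * (nrm d * n1) =
          nrm a * n3 * (nrm a * nrm b2 / (4%:R * n2)).
  transitivity (nrm a / 4%:R * (nrm d * nrm b1 * n2) / n2); first by field; rewrite N2 N1.
  by rewrite -hb; field; rewrite N2.
by rewrite rmorphM /=; ring.
Qed.
End Quads.

(** * Rigidity of opposite vertices *)

Section Rigidity.
Variable R : rcfType.
Variable p : R.
Local Notation q := (1 - p).
Hypothesis p01 : 0 < p < 1.
Local Notation dq := (dq R).
Local Notation C := R[i].
Local Open Scope complex_scope.
Local Notation rel := (rel p).
Local Notation form := (form p).
Local Notation nrm := (nrm p).
Local Notation adj := (adj p).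
Local Notation edge := (edge p).
Local Notation cone := (cone p).
Local Notation hM := (hM p).
Local Notation dmul := (dmul p).
Local Notation inL := (inL p).
Local Notation proper := (proper p).
Local Notation lab := (lab p).

Let p_neq0 : p != 0. Proof. by case/andP: p01 => h _; rewrite gt_eqF. Qed.
Let q_neq0 : q != 0. Proof. by case/andP: p01 => _ h; rewrite subr_eq0 gt_eqF. Qed.

Ltac ceq := apply/eqP; rewrite eq_complex /=; apply/andP; split; apply/eqP; ring.

(** The tangent vectors of the cone of edges at the edge with parameters c, d:
    l rescales, f and g rotate c and d, and w is the scalar part. *)
Definition tang (w l f g : R) (c d : C) : dq :=
  dadd (scal w) (dadd (dsc l (cone c d))
    (dadd (dsc f (cone ('i * c) d)) (dsc g (cone c ('i * d))))).

Lemma tangentP t w c d : inL t -> form t (edge w c d) = 0 -> c != 0 -> d != 0 ->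
  exists w' l f g, t = tang w' l f g c d.
Proof.
case: c => c0 c1; case: d => e0 e1; case: t => t0 t1 t2 t3 t4 t5 t6 t7 [/= -> -> ->] ht hc he.
have hn : (c0 ^+ 2 + c1 ^+ 2) * (e0 ^+ 2 + e1 ^+ 2) != 0.
  by rewrite mulf_neq0 // paddr_eq0 ?sqr_ge0 // !sqrf_eq0 -?(eq_complex (_ +i* _) 0).
have pq0 : 2%:R * (p * q) != 0 by rewrite !mulf_neq0 ?pnatr_eq0.
have h : c1 * e1 * t3 - c1 * e0 * (t1 + t2) - c0 * e1 * (t2 - t1) + c0 * e0 * t7 = 0.
  by apply: (mulfI pq0); rewrite mulr0 -[RHS]ht /form /=; ring.
have kill (k x y : R) : x - k * (c1 * e1 * t3 - c1 * e0 * (t1 + t2) - c0 * e1 * (t2 - t1) + c0 * e0 * t7) = y -> x = y.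
  by rewrite h mulr0 subr0.
set N := (c0 ^+ 2 + c1 ^+ 2) * (e0 ^+ 2 + e1 ^+ 2) in hn.
pose T (a0 a1 b0 b1 : R) := (a0 * b0 * t3 + a0 * b1 * (t1 + t2) + a1 * b0 * (t2 - t1) + a1 * b1 * t7) / 2%:R / N.
exists t0, (T c0 c1 e0 e1), (T (- c1) c0 e0 e1), (T c0 c1 (- e1) e0).
have f2 : (2%:R : R) != 0 by rewrite pnatr_eq0.
rewrite /tang; congr DQ; rewrite /= /T.
- by ring.
- apply: (mulfI hn); apply: (kill (2%:R^-1 * (- c1 * e0 - c0 * - e1))).
  by rewrite /N; field; move: hn; rewrite /N mulf_eq0 negb_or => /andP[-> ->].
- apply: (mulfI hn); apply: (kill (2%:R^-1 * (- c1 * e0 + c0 * - e1))).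
  by rewrite /N; field; move: hn; rewrite /N mulf_eq0 negb_or => /andP[-> ->].
- apply: (mulfI hn); apply: (kill (c1 * e1)).
  by rewrite /N; field; move: hn; rewrite /N mulf_eq0 negb_or => /andP[-> ->].
- by ring.
- apply: (mulfI hn); apply: (kill (q * (2%:R^-1 * (- c1 * e0 - c0 * - e1)))).
  by rewrite /N; field; move: hn; rewrite /N mulf_eq0 negb_or => /andP[-> ->].
- apply: (mulfI hn); apply: (kill (- p * (2%:R^-1 * (- c1 * e0 + c0 * - e1)))).
  by rewrite /N; field; move: hn; rewrite /N mulf_eq0 negb_or => /andP[-> ->].
- apply: (mulfI hn); apply: (kill (c0 * e0)).
  by rewrite /N; field; move: hn; rewrite /N mulf_eq0 negb_or => /andP[-> ->].
Qed.

Lemma hM_tang_l w' l f g c1 d1 w2 c2 d2 :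
  hM (rel (tang w' l f g c1 d1) (edge w2 c2 d2)) =
  (4%:R * (p * q))%:C * (- 'i * ((c1^*)%C * c2)) *
  ((l * cdet d1 d2 + g * cdet ('i * d1) d2) +i* (- (f * cdet d1 d2))).
Proof. by case: c1 => *; case: c2 => *; case: d1 => *; case: d2 => *; rewrite /cdet; ceq. Qed.

Lemma hM_tang_r w' l f g c1 d1 w2 c2 d2 :
  hM (rel (edge w2 c2 d2) (tang w' l f g c1 d1)) =
  (4%:R * (p * q))%:C * (- 'i * ((c2^*)%C * c1)) *
  ((l * cdet d2 d1 + g * cdet d2 ('i * d1)) +i* (f * cdet d2 d1)).
Proof. by case: c1 => *; case: c2 => *; case: d1 => *; case: d2 => *; rewrite /cdet; ceq. Qed.

Lemma tang_sig w' l f g c d : dsig (tang w' l f g c d) = tang w' l g f d (- c).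
Proof. by case: c => *; case: d => *; congr DQ; rewrite /=; ring. Qed.

Lemma hM_tang_self w' l f g w c d :
  hM (dmul (tang w' l f g c d) (dconj (edge w c d))) =
  (4%:R * (p * q))%:C * 'i * (g * (sqn c * sqn d))%:C.
Proof. by case: c => *; case: d => *; rewrite /sqn; ceq. Qed.

Lemma tang_self w' l w c d : exists s,
  dmul (tang w' l 0 0 c d) (dconj (edge w c d)) = dadd (scal s) (dsc (l * w - w') (cone c d)).
Proof.
exists (x0 (dmul (tang w' l 0 0 c d) (dconj (edge w c d)))).
by case: c => *; case: d => *; congr DQ; rewrite /=; ring.
Qed.

Lemma form_mulr u r : form (dmul u r) r = nrm r * x4 u + form r r * x0 u.
Proof. by case: u => *; case: r => *; rewrite /form /nrm /=; ring. Qed.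

Lemma form_edge w1 c1 e1 w2 c2 e2 :
  form (edge w1 c1 e1) (edge w2 c2 e2) = 4%:R * (p * q) * (cdet c1 c2 * cdet e1 e2).
Proof. by rewrite -rel_form form_edges. Qed.

(** The imaginary part of the hermitian form of a tangent vector with the other
    edge is the rotation parameter f times cdet d1 d2, up to a common factor. *)
Let rigid w1 c1 d1 w2 c2 d2 w1' l1 f1 g1 w2' l2 f2 g2 :
  cdet c1 c2 != 0 -> cdet d1 d2 != 0 ->
  c1 != 0 -> c2 != 0 -> 
  hM (rel (tang w1' l1 f1 g1 c1 d1) (edge w2 c2 d2)) +
  hM (rel (edge w1 c1 d1) (tang w2' l2 f2 g2 c2 d2)) = 0 -> f1 = f2.
Proof.
move=> hc hd c10 c20; rewrite hM_tang_l hM_tang_r -mulrDr => /eqP.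
rewrite mulf_eq0 => /orP[|].
  rewrite !mulf_eq0 conjC_eq0' (negbTE c10) (negbTE c20) /= orbF.
  by rewrite !eq_complex /= !mulf_eq0 pnatr_eq0 (negbTE p_neq0) (negbTE q_neq0) !oppr_eq0 oner_eq0 andbF.
rewrite eq_complex /= => /andP[_]; rewrite addrC subr_eq0 => /eqP.
by move/(mulIf hd).
Qed.

(** The tangent vectors v r1 and v r2 cancel in the hermitian forms of both axes,
    which gives f1 = f2 and g1 = g2.  Multiplying back by dconj r1 and dconj r2
    recovers v, and comparing the coefficients makes f and g vanish unless the
    labels of r1 and r2 agree.  Then v is proportional to the imaginary parts of
    both edges, which are not conjugate, so v = 0. *)
Lemma tangent_rigid w1 c1 d1 w2 c2 d2 v :
  c1 != 0 -> c2 != 0 -> d1 != 0 -> d2 != 0 ->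
  cdet c1 c2 != 0 -> cdet d1 d2 != 0 ->
  nrm (edge w1 c1 d1) != 0 -> nrm (edge w2 c2 d2) != 0 ->
  nrm (edge w2 c2 d2) * (sqn c1 * sqn d1) != nrm (edge w1 c1 d1) * (sqn c2 * sqn d2) ->
  x0 v = 0 -> x4 v = 0 ->
  inL (dmul v (edge w1 c1 d1)) -> inL (dmul v (edge w2 c2 d2)) -> v = dzero R.
Proof.
move=> c10 c20 d10 d20 hc hd n1 n2 hn v0 v4 L1 L2.
set r1 := edge w1 c1 d1 in n1 hn L1 *; set r2 := edge w2 c2 d2 in n2 hn L2 *.
have r1n : form r1 r1 = 0 by exact: null_edge.
have r2n : form r2 r2 = 0 by exact: null_edge.
have T1 : form (dmul v r1) r1 = 0 by rewrite form_mulr v4 r1n; ring.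
have T2 : form (dmul v r2) r2 = 0 by rewrite form_mulr v4 r2n; ring.
have [u1 [l1 [f1 [g1 t1]]]] := tangentP L1 T1 c10 d10.
have [u2 [l2 [f2 [g2 t2]]]] := tangentP L2 T2 c20 d20.
have vc : dconj v = dsc (-1) v by case: v v0 v4 {L1 L2 T1 T2 t1 t2} => ? ? ? ? ? ? ? ? /= -> ->; congr DQ; rewrite /=; ring.
have s0 : dadd (rel (dmul v r1) r2) (rel r1 (dmul v r2)) = dzero R.
  rewrite /rel dconjM vc dscaler dscalel -dmulA.
  by move: (dmul _ _) => z; case: z => *; congr DQ; rewrite /=; ring.
have ff : f1 = f2.
  apply: (@rigid w1 c1 d1 w2 c2 d2 u1 l1 f1 g1 u2 l2 f2 g2) => //.
  by rewrite -t1 -t2 -hM_add s0; ceq.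
have gg : g1 = g2.
  apply: (@rigid w1 d1 (- c1) w2 d2 (- c2) u1 l1 g1 f1 u2 l2 g2 f2) => //.
    by rewrite cdetNN.
  rewrite -!tang_sig -!edge_sig !rel_sig -t1 -t2 -hM_add.
  have -> x y : dadd (dsig x) (dsig y) = dsig (dadd x y) by case: x => *; case: y => *; congr DQ; rewrite /=; ring.
  by rewrite s0; ceq.
have self r : form r r = 0 -> dmul (dmul v r) (dconj r) = dsc (nrm r) v.
  exact: mul_conj_null.
have S1 := self _ r1n; have S2 := self _ r2n; rewrite t1 in S1; rewrite t2 in S2.
have fz (f g : R) : f = g -> nrm r2 * (f * (sqn c1 * sqn d1)) = nrm r1 * (g * (sqn c2 * sqn d2)) -> f = 0.
  move=> <- h; apply/eqP; case: eqVneq => // f0; case/eqP: hn.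
  by apply: (mulfI f0); transitivity (nrm r2 * (f * (sqn c1 * sqn d1))); [ring | rewrite h; ring].
have pqi : (4%:R * (p * q))%:C * 'i != 0 :> C.
  apply: mulf_neq0; last by rewrite eq_complex /= negb_and oner_eq0 orbT.
  by rewrite realC_eq0 !mulf_neq0 ?pnatr_eq0.
have g0 : g1 = 0.
  apply: (fz _ _ gg).
  have h1 := congr1 hM S1; have h2 := congr1 hM S2.
  rewrite hM_tang_self hM_sc in h1; rewrite hM_tang_self hM_sc in h2.
  have : ((nrm r2 * (g1 * (sqn c1 * sqn d1)))%:C : C) = (nrm r1 * (g2 * (sqn c2 * sqn d2)))%:C.
    apply: (mulfI pqi); rewrite ![(nrm _ * _)%:C]rmorphM /=.
    transitivity ((nrm r2)%:C * ((nrm r1)%:C * hM v)); first by rewrite -h1; ring.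
    by rewrite mulrCA -h2; ring.
  by case.
have f0 : f1 = 0.
  apply: (fz _ _ ff).
  have h1 := congr1 (fun x => hM (dsig x)) S1; have h2 := congr1 (fun x => hM (dsig x)) S2.
  have sg k x : dsig (dsc k x) = dsc k (dsig x) by case: x => *; congr DQ; rewrite /=; ring.
  rewrite !sg !dsigM !tang_sig !dsig_conj !edge_sig !hM_tang_self !hM_sc in h1 h2.
  have : ((nrm r2 * (f1 * (sqn c1 * sqn d1)))%:C : C) = (nrm r1 * (f2 * (sqn c2 * sqn d2)))%:C.
    apply: (mulfI pqi); rewrite ![(nrm _ * _)%:C]rmorphM /=.
    rewrite !sqnN in h1 h2.
    transitivity ((nrm r2)%:C * ((nrm r1)%:C * hM (dsig v))); first by rewrite -h1 ![in RHS]rmorphM /= !rmorphM /=; ring.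
    by rewrite mulrCA -h2 ![in LHS]rmorphM /= !rmorphM /=; ring.
  by case.
rewrite f0 g0 in S1; rewrite -ff -gg f0 g0 in S2.
have [s1 e1] := tang_self u1 l1 w1 c1 d1; have [s2 e2] := tang_self u2 l2 w2 c2 d2.
rewrite e1 in S1; rewrite e2 in S2.
have dir n s m c d : n != 0 -> dadd (scal s) (dsc m (cone c d)) = dsc n v -> exists k, v = dsc k (cone c d).
  move=> n0 h; exists (m / n).
  have sz : s = 0.
    have := congr1 (@x0 R) h; case: c {h} => ? ?; case: d => ? ? /=; rewrite v0 !mulr0 addr0 //.
  transitivity (dsc n^-1 (dsc n v)); first by rewrite dscA mulVf // dsc1.
  by rewrite -h sz; case: c {h} => *; case: d => *; congr DQ; rewrite /=; ring.
have [k1 vk1] := dir _ _ _ _ _ n1 S1; have [k2 vk2] := dir _ _ _ _ _ n2 S2.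
have : k1 = 0.
  have pq0 : 4%:R * (p * q) * (cdet c1 c2 * cdet d1 d2) != 0 by rewrite !mulf_neq0 ?pnatr_eq0.
  apply: (mulIf pq0); rewrite mul0r.
  have fs k x y : form (dsc k x) y = k * form x y by case: x => *; case: y => *; rewrite /form /=; ring.
  have ce c d : cone c d = edge 0 c d by case: c => *; case: d => *; congr DQ; rewrite /=; ring.
  transitivity (form v (cone c2 d2)); first by rewrite vk1 fs !ce form_edge.
  by rewrite vk2 fs ce null_edge mulr0.
move=> k0; rewrite vk1 k0; move: (cone c1 d1) => x.
by case: x => *; congr DQ; rewrite /=; ring.
Qed.

(** An element x <> a of this kind would be an infinitesimal deformation of the
    position a that keeps the edges to b1 and b2: for the imaginary part v of the
    relative displacement both v * rel a b1 and v * rel a b2 are tangent to the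
    cone of edges, which tangent_rigid excludes. *)
Lemma opposite_rigid a b1 b2 x : proper a -> proper b1 -> proper b2 ->
  adj a b1 -> adj a b2 -> adj x b1 -> adj x b2 ->
  form b1 b2 != 0 -> lab a b1 != lab a b2 -> form a x = 0 ->
  exists k, x = dsc k a.
Proof.
move=> pa [nb1 b10] [nb2 b20] a1 a2 x1 x2 h12 hl hax; have [na a0] := pa.
have h21 : form b2 b1 != 0 by rewrite formC.
have [w1 [c1 [d1 [E1 c10 d10]]]] := adj_edge p01 pa nb1 a1 a2 h12.
have [w2 [c2 [d2 [E2 c20 d20]]]] := adj_edge p01 pa nb2 a2 a1 h21.
have hcd : cdet c1 c2 * cdet d1 d2 != 0.
  apply: contraTneq isT => z; have := rel_form p (rel a b1) (rel a b2).
  rewrite {1}E1 {1}E2 form_edges z mulr0 => /esym; rewrite -rel_form rel_from // => /eqP.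
  by rewrite /= mulf_eq0 (negbTE a0) -/(rel b1 b2) rel_form (negbTE h12).
move: hcd; rewrite mulf_eq0 negb_or => /andP[hc hd].
pose y := rel a x; pose v := dconj (dadd y (scal (- x0 y))).
have n1 : nrm (edge w1 c1 d1) = nrm a * nrm b1 by rewrite -E1 nrm_rel.
have n2 : nrm (edge w2 c2 d2) = nrm a * nrm b2 by rewrite -E2 nrm_rel.
have vz : v = dzero R.
  apply: (@tangent_rigid w1 c1 d1 w2 c2 d2) => //.
  - by rewrite n1 mulf_neq0.
  - by rewrite n2 mulf_neq0.
  - rewrite n1 n2; apply: contra hl => /eqP e; rewrite /lab E1 E2 !sqn_OM_edge.
    have u1 : 4%:R * (sqn c1 * sqn d1) != 0 by rewrite !mulf_neq0 ?sqn_neq0 ?pnatr_eq0.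
    have u2 : 4%:R * (sqn c2 * sqn d2) != 0 by rewrite !mulf_neq0 ?sqn_neq0 ?pnatr_eq0.
    rewrite (eqr_div _ _ u1 u2); apply/eqP.
    by rewrite mulrCA -e; ring.
  - by rewrite /v /=; ring.
  - by rewrite /v /= addr0 /y rel_form.
  - have -> : dmul v (edge w1 c1 d1) = dadd (dsc (nrm a) (rel x b1)) (dsc (- x0 y) (rel a b1)).
      rewrite -E1 -rel_from // -/y /v /rel -/(rel a b1); move: (rel a b1) => z.
      by case: (y) => *; case: z => *; congr DQ; rewrite /=; ring.
    by apply: inL_add; apply: inL_sc.
  - have -> : dmul v (edge w2 c2 d2) = dadd (dsc (nrm a) (rel x b2)) (dsc (- x0 y) (rel a b2)).
      rewrite -E2 -rel_from // -/y /v /rel -/(rel a b2); move: (rel a b2) => z.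
      by case: (y) => *; case: z => *; congr DQ; rewrite /=; ring.
    by apply: inL_add; apply: inL_sc.
have ys : y = scal (x0 y).
  move: vz; rewrite /v; case: (y) => ? ? ? ? ? ? ? ? [*]; rewrite /scal /=; congr DQ; lra.
exists (x0 y / nrm a).
have -> : x = dsc (nrm a)^-1 (dmul a y) by rewrite mul_null_conj // dscA mulVf // dsc1.
rewrite ys; move: (x0 y) (nrm a) => k m.
by move: a {pa a1 a2 hl hax na a0 E1 E2 y v n1 n2 vz ys} => [*]; congr DQ; rewrite /=; ring.
Qed.

(** Two solutions differ by a solution that is conjugate to a, hence by a
    multiple of a; being null vectors they are then proportional. *)
Lemma opposite_unique a b1 b2 x y : proper a -> proper b1 -> proper b2 ->
  adj a b1 -> adj a b2 -> form b1 b2 != 0 -> lab a b1 != lab a b2 ->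
  adj x b1 -> adj x b2 -> adj y b1 -> adj y b2 ->
  form x x = 0 -> form y y = 0 -> form a x != 0 -> form a y != 0 ->
  exists2 k, k != 0 & y = dsc k x.
Proof.
move=> pa pb1 pb2 a1 a2 hb hl x1 x2 y1 y2 xn yn hx hy.
have [k k0 kE] : exists2 k, k != 0 & form a y = k * form a x.
  by exists (form a y / form a x); rewrite ?divfK // mulf_neq0 ?invr_neq0.
pose z := dadd y (dsc (- k) x).
have z1 : adj z b1 by apply: adjC; apply: adj_add; [|apply: adj_scr]; apply: adjC.
have z2 : adj z b2 by apply: adjC; apply: adj_add; [|apply: adj_scr]; apply: adjC.
have hz : form a z = 0.
  transitivity (form a y - k * form a x); first by rewrite /form /z /=; ring.
  by rewrite kE subrr.
have [m zm] := opposite_rigid pa pb1 pb2 a1 a2 z1 z2 hb hl hz.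
have ye : y = dadd (dsc k x) (dsc m a).
  by rewrite -zm /z; case: (y) => *; case: (x) => *; congr DQ; rewrite /=; ring.
have [na _] := pa.
have : 2%:R * (k * m) * form a x = 0.
  rewrite -[RHS]yn ye.
  transitivity (k ^+ 2 * form x x + 2%:R * (k * m) * form a x + m ^+ 2 * form a a).
    by rewrite xn na; ring.
  by rewrite /form /=; ring.
move/eqP; rewrite !mulf_eq0 pnatr_eq0 (negbTE hx) (negbTE k0) /= orbF => /eqP m0.
by exists k => //; rewrite ye m0; case: (x) => *; case: (a) => *; congr DQ; rewrite /=; ring.
Qed.

(** An element d with vanishing primal part determines the primal part of each
    neighbour up to a factor.  So the primal parts of b1 and b2 would be
    proportional, and null vectors of this kind are conjugate. *)
Lemma common_neighbour_proper b1 b2 d : proper b1 -> proper b2 -> form b1 b2 != 0 ->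
  form d d = 0 -> d <> dzero R -> adj b1 d -> adj b2 d -> nrm d != 0.
Proof.
move=> [nb1 b10] [nb2 b20] h12 nd d0 a1 a2; apply: contra_notN d0 => /eqP n0.
have pr0 : [/\ x0 d = 0, x1 d = 0, x2 d = 0 & x3 d = 0].
  have [p_gt0 q_gt0] : 0 < p /\ 0 < q by case/andP: p01 => ? ?; rewrite subr_gt0.
  have pq_gt0 : 0 < p * q by rewrite mulr_gt0.
  have m0 := sqr_ge0 (x0 d).
  have m1 : 0 <= p * x1 d ^+ 2 by rewrite mulr_ge0 ?sqr_ge0 ?ltW.
  have m2 : 0 <= q * x2 d ^+ 2 by rewrite mulr_ge0 ?sqr_ge0 ?ltW.
  have m3 : 0 <= p * q * x3 d ^+ 2 by rewrite mulr_ge0 ?sqr_ge0 ?ltW.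
  move: n0; rewrite /nrm => hs.
  have sq (k x : R) : k != 0 -> k * x ^+ 2 = 0 -> x = 0.
    by move=> kk /eqP; rewrite mulf_eq0 (negbTE kk) sqrf_eq0 => /eqP.
  split; [apply: (@sq 1) | apply: (@sq p) | apply: (@sq q) | apply: (@sq (p * q))];
    rewrite ?oner_eq0 ?mulf_neq0 //; lra.
have shape b : form b b = 0 -> nrm b != 0 -> adj b d -> exists t,
    [/\ x4 d = - (p * q) * (t * x3 b), x5 d = q * (t * x2 b), x6 d = - p * (t * x1 b) & x7 d = t * x0 b].
  move=> nb b0 ab; exists (x7 (rel b d) / nrm b).
  have : d = dsc (nrm b)^-1 (dmul b (rel b d)) by rewrite mul_null_conj // dscA mulVf // dsc1.
  have -> : rel b d = DQ 0 0 0 0 0 0 0 (x7 (rel b d)).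
    have [h4 h5 h6] := ab; move: pr0 h4 h5 h6 => [].
    case: (d) => d0 d1 d2 d3 d4 d5 d6 d7 /= -> -> -> ->; case: (b) => ? ? ? ? ? ? ? ? /= h4 h5 h6.
    rewrite /rel /=; congr DQ; try ring.
    - lra.
    - lra.
    - lra.
  move: (x7 (rel b d)) (nrm b) => z n ->.
  case: (b) => ? ? ? ? ? ? ? ?; rewrite /=.
  by split; ring.
have [t [e4 e5 e6 e7]] := shape _ nb1 b10 a1; have [u [f4 f5 f6 f7]] := shape _ nb2 b20 a2.
have k0 : t * x0 b1 = u * x0 b2 by rewrite -e7 -f7.
have k1 : t * x1 b1 = u * x1 b2.
  have pN : - p != 0 by rewrite oppr_eq0.
  by apply: (mulfI pN); rewrite -e6 -f6.
have k2 : t * x2 b1 = u * x2 b2 by apply: (mulfI q_neq0); rewrite -e5 -f5.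
have k3 : t * x3 b1 = u * x3 b2.
  have pN : - (p * q) != 0 by rewrite oppr_eq0 mulf_neq0.
  by apply: (mulfI pN); rewrite -e4 -f4.
have : 2%:R * (t * u) * form b1 b2 = 0.
  transitivity (u ^+ 2 * form b2 b2 + t ^+ 2 * form b1 b1 ); last by rewrite nb1 nb2; ring.
  transitivity (2%:R * u * (t * x0 b1 * x4 b2 + p * (t * x1 b1 * x5 b2) + q * (t * x2 b1 * x6 b2) + p * q * (t * x3 b1 * x7 b2))
     + 2%:R * t * (u * x0 b2 * x4 b1 + p * (u * x1 b2 * x5 b1) + q * (u * x2 b2 * x6 b1) + p * q * (u * x3 b2 * x7 b1))).
    by rewrite /form; ring.
  by rewrite k0 k1 k2 k3 -{2}k0 -{2}k1 -{2}k2 -{2}k3 /form; ring.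
move/eqP; rewrite !mulf_eq0 pnatr_eq0 (negbTE h12) /= orbF => tu0.
have [] := pr0; case: (d) e4 e5 e6 e7 f4 f5 f6 f7 => ? ? ? ? ? ? ? ? /= e4 e5 e6 e7 f4 f5 f6 f7 -> -> -> ->.
case/orP: tu0 => /eqP z; [rewrite e4 e5 e6 e7 z | rewrite f4 f5 f6 f7 z]; congr DQ; ring.
Qed.
End Rigidity.

(** * Three-dimensional consistency *)

Section Cube.
Variable R : rcfType.
Variable p : R.
Local Notation q := (1 - p).
Hypothesis p01 : 0 < p < 1.
Local Notation dq := (dq R).
Local Notation C := R[i].
Local Open Scope complex_scope.
Local Notation rel := (rel p).
Local Notation form := (form p).
Local Notation nrm := (nrm p).
Local Notation adj := (adj p).
Local Notation edge := (edge p).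
Local Notation hM := (hM p).
Local Notation OM := (OM p).
Local Notation act := (act p).
Local Notation proper := (proper p).
Local Notation lab := (lab p).
Local Notation quad := (quad p).

Let p_neq0 : p != 0. Proof. by case/andP: p01 => h _; rewrite gt_eqF. Qed.
Let q_neq0 : q != 0. Proof. by case/andP: p01 => _ h; rewrite subr_eq0 gt_eqF. Qed.

Ltac ceq := apply/eqP; rewrite eq_complex /=; apply/andP; split; apply/eqP; ring.

Local Notation h a b := (hM (rel a b)).
Local Notation o a b := (OM (rel a b)).

Lemma h_act a b z : h a (act b z) = h a b * z.
Proof. by rewrite rel_act hM_act. Qed.
Lemma o_act a b z : o a (act b z) = o a b * z.
Proof. by rewrite rel_act OM_act. Qed.
Lemma h_add a b c : h a (dadd b c) = h a b + h a c.
Proof. by rewrite rel_addr hM_add. Qed.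
Lemma o_add a b c : o a (dadd b c) = o a b + o a c.
Proof. by rewrite rel_addr OM_add. Qed.
Lemma h_C a b : h b a = ((h a b)^*)%C.
Proof. by rewrite relC hM_conj. Qed.
Lemma o_C a b : o b a = - o a b.
Proof. by rewrite relC OM_conj. Qed.
Lemma h_self a : form a a = 0 -> h a a = 0.
Proof.
move=> na; have -> : rel a a = scal (nrm a).
  have -> : rel a a = DQ (nrm a) 0 0 0 (form a a) 0 0 0.
    by case: (a) => *; congr DQ; rewrite /form /nrm /=; ring.
  by rewrite na.
by ceq.
Qed.
Lemma o_self a : o a a = 0.
Proof. by case: a => *; ceq. Qed.
Lemma form_h a b : form a b != 0 -> h a b != 0.
Proof. by apply: contra => /eqP e; rewrite -rel_form -[x4 _]/(complex.Re (h a b)) e. Qed.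

Lemma quad_o_neq0 a b1 b2 d : quad a b1 b2 d -> o a b1 != 0.
Proof.
case/(quad_edges p01) => [w1 [w2 [w3 [w4 [c1 [c2 [c3 [c4 [e1 [e2 [e3 [e4]]]]]]]]]]]].
case=> -[-> _ _ _] [c10 _ _ _] [e10 _ _ _].
by rewrite OM_edge !mulf_neq0 ?conjC_eq0' ?pnatr_eq0.
Qed.

(** Over a common neighbour o0 the phase of h is a coboundary: each factor is an
    imaginary multiple of conj c * c', and the phases cancel around the triangle. *)
Lemma triangle_imaginary o0 e0 e1 e2 : proper o0 -> adj o0 e0 -> adj o0 e1 -> adj o0 e2 ->
  form e0 e0 = 0 -> form e1 e1 = 0 -> form e2 e2 = 0 ->
  form e0 e1 != 0 -> form e0 e2 != 0 ->
  ((h e0 e1 * h e1 e2 * h e2 e0)^*)%C = - (h e0 e1 * h e1 e2 * h e2 e0).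
Proof.
move=> po a0 a1 a2 n0 n1 n2 h01 h02; have [no no0] := po.
have h10 : form e1 e0 != 0 by rewrite formC.
have h20 : form e2 e0 != 0 by rewrite formC.
have [w0 [c0 [d0 [E0 _ _]]]] := adj_edge p01 po n0 a0 a1 h01.
have [w1 [c1 [d1 [E1 _ _]]]] := adj_edge p01 po n1 a1 a0 h10.
have [w2 [c2 [d2 [E2 _ _]]]] := adj_edge p01 po n2 a2 a0 h20.
have n0' : (nrm o0)%:C != 0 :> C by rewrite realC_eq0.
have H x y w c d w' c' d' : rel o0 x = edge w c d -> rel o0 y = edge w' c' d' ->
  exists k : R, (nrm o0)%:C * h x y = k%:C * (- 'i * ((c^*)%C * c')).
  move=> ex ey; exists (4%:R * (p * q) * cdet d d').
  by rewrite -(hM_edges p w c d w' c' d') -ex -ey rel_from // hM_sc.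
have [k0 H01] := H _ _ _ _ _ _ _ _ E0 E1.
have [k1 H12] := H _ _ _ _ _ _ _ _ E1 E2.
have [k2 H20] := H _ _ _ _ _ _ _ _ E2 E0.
have n3 : (nrm o0)%:C ^+ 3 != 0 :> C by rewrite expf_neq0.
apply: (mulfI n3).
have e : (nrm o0)%:C ^+ 3 * (h e0 e1 * h e1 e2 * h e2 e0) = (k0 * k1 * k2 * (sqn c0 * sqn c1 * sqn c2))%:C * 'i.
  transitivity ((nrm o0)%:C * h e0 e1 * ((nrm o0)%:C * h e1 e2) * ((nrm o0)%:C * h e2 e0)); first by ring.
  rewrite H01 H12 H20 !rmorphM /= !sqnE.
  have ii : ('i : C) ^+ 3 = - 'i by rewrite !exprS expr0; ceq.
  transitivity (- ('i ^+ 3) * (k0%:C * k1%:C * k2%:C * (c0 * c0^* * (c1 * c1^*) * (c2 * c2^*)))); first by ring.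
  by rewrite ii; ring.
rewrite [RHS]mulrN [in RHS]e.
have cM (k : R) (z : C) : k%:C * (z^*)%C = ((k%:C * z)^*)%C by case: z => *; ceq.
have e3 : (nrm o0)%:C ^+ 3 = (nrm o0 ^+ 3)%:C :> C by rewrite rmorphXn.
rewrite e3 cM -e3 e; move: (k0 * _ * _ * _) => k; ceq.
Qed.

(** The vectors e_i with equal ratio o e0 e_i : h e0 e_i are excluded in the cube,
    where three such ratios are the zeros of a quadratic form. *)
Definition spread a b c := o a c * h a b - o a b * h a c.

(** Let e0, ..., e3 and o1, o2, o3, y be the vertices of a cube, e and o in even
    and odd position, where y is the eighth vertex, completed on one face only.
    The products of perp_three express o1, o2, o3 through e0, ..., e3.  Inserting
    them into the relations quad_OM of the three faces at e0 gives three
    equations for the values of h and OM on the even vertices (R1, R2, R3), which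
    cube_scalars turns into the face relation of the completed face for the
    vector X.  So X agrees with y up to a complex factor, and h y X, a nonzero multiple
    of h y e1, vanishes like h y y. *)
Section CubeM.
Variables e0 e1 e2 e3 o1 o2 o3 y : dq.
Hypothesis Q1 : quad e0 o2 o3 e1.
Hypothesis Q2 : quad e0 o1 o3 e2.
Hypothesis Q3 : quad e0 o1 o2 e3.
Hypothesis Qy : quad o1 e2 e3 y.
Hypothesis N23 : lab e0 o2 != lab e0 o3.
Hypothesis Z1 : spread e0 e2 e3 != 0.
Hypothesis Z2 : spread e0 e1 e3 != 0.
Hypothesis Z3 : spread e0 e1 e2 != 0.

Let n0 : form e0 e0 = 0. Proof. by case: Q1 => -[]. Qed.
Let n1 : form e1 e1 = 0. Proof. by case: Q1 => _ _ _ []. Qed.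
Let n2 : form e2 e2 = 0. Proof. by case: Q2 => _ _ _ []. Qed.
Let n3 : form e3 e3 = 0. Proof. by case: Q3 => _ _ _ []. Qed.
Let po1 : proper o1. Proof. by case: Q2. Qed.
Let po2 : proper o2. Proof. by case: Q1. Qed.
Let po3 : proper o3. Proof. by case: Q1. Qed.
Let o10 : adj o1 e0. Proof. by case: Q2 => *; apply: adjC. Qed.
Let o12 : adj o1 e2. Proof. by case: Q2 => *; apply: adjC. Qed.
Let o13 : adj o1 e3. Proof. by case: Q3 => *; apply: adjC. Qed.
Let o20 : adj o2 e0. Proof. by case: Q1 => *; apply: adjC. Qed.
Let o21 : adj o2 e1. Proof. by case: Q1 => *; apply: adjC. Qed.
Let o23 : adj o2 e3. Proof. by case: Q3 => *; apply: adjC. Qed.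
Let o30 : adj o3 e0. Proof. by case: Q1 => *; apply: adjC. Qed.
Let o31 : adj o3 e1. Proof. by case: Q1 => *; apply: adjC. Qed.
Let o32 : adj o3 e2. Proof. by case: Q2 => *; apply: adjC. Qed.
Let f01 : form e0 e1 != 0. Proof. by case: Q1. Qed.
Let f02 : form e0 e2 != 0. Proof. by case: Q2. Qed.
Let f03 : form e0 e3 != 0. Proof. by case: Q3. Qed.
Let f23 : form e2 e3 != 0. Proof. by case: Qy. Qed.

Let H1 := h e0 e1. Let H2 := h e0 e2. Let H3 := h e0 e3.
Let b1 := H1 * (H1^*)%C. Let b2 := H2 * (H2^*)%C. Let b3 := H3 * (H3^*)%C.
Let a1 := - 'i * (H2 * h e2 e3 * (H3^*)%C).
Let a2 := - 'i * (H3 * h e3 e1 * (H1^*)%C).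
Let a3 := - 'i * (H1 * h e1 e2 * (H2^*)%C).

Let real_of (r s t : C) : ((r * s * t)^*)%C = - (r * s * t) ->
  ((- 'i * (r * s * t))^*)%C = - 'i * (r * s * t).
Proof. by move: (r * s * t) => w; case: w => k l /eqP; rewrite eq_complex /= => /andP[/eqP ? /eqP ?]; apply/eqP; rewrite eq_complex /=; apply/andP; split; apply/eqP; lra. Qed.

Let a1r : (a1^*)%C = a1.
Proof.
apply: real_of; rewrite -[(H3^*)%C]h_C; apply: (@triangle_imaginary o1) => //.
Qed.
Let a2r : (a2^*)%C = a2.
Proof.
by apply: real_of; rewrite -[(H1^*)%C]h_C; apply: (@triangle_imaginary o2).
Qed.
Let a3r : (a3^*)%C = a3.
Proof.
by apply: real_of; rewrite -[(H2^*)%C]h_C; apply: (@triangle_imaginary o3).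
Qed.

Let t1 := 'i * (H1^*)%C. Let t2 := 'i * (H2^*)%C. Let t3 := 'i * (H3^*)%C.

(* By perp_three the combinations O1, O2, O3 are complex multiples of o1, o2, o3;
   X will turn out to be a multiple of the vertex y. *)
Let O1 := dadd (act e0 a1) (dadd (act e2 (- (t2 * b3))) (act e3 (t3 * b2))).
Let O2 := dadd (act e0 a2) (dadd (act e3 (- (t3 * b1))) (act e1 (t1 * b3))).
Let O3 := dadd (act e0 a3) (dadd (act e1 (- (t1 * b2))) (act e2 (t2 * b1))).
Let X := dadd (act e1 (t1 * a1)) (dadd (act e2 (t2 * a2)) (act e3 (t3 * a3))).

Let hE := (h_add, h_act, o_add, o_act).

Let aC1 : a1 = 'i * ((H2^*)%C * h e3 e2 * H3).
Proof.
by rewrite -a1r /a1 (h_C e2 e3); case: H2 => ? ?; case: H3 => ? ?; case: (h e2 e3) => *; ceq.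
Qed.
Let aC2 : a2 = 'i * ((H3^*)%C * h e1 e3 * H1).
Proof.
by rewrite -a2r /a2 (h_C e3 e1); case: H3 => ? ?; case: H1 => ? ?; case: (h e3 e1) => *; ceq.
Qed.
Let aC3 : a3 = 'i * ((H1^*)%C * h e2 e1 * H2).
Proof.
by rewrite -a3r /a3 (h_C e1 e2); case: H1 => ? ?; case: H2 => ? ?; case: (h e1 e2) => *; ceq.
Qed.

Let O1_e0 : h e0 O1 = 0.
Proof. by rewrite !hE h_self // -/H2 -/H3 /t2 /t3 /b2 /b3; ring. Qed.
Let O1_e2 : h e2 O1 = 0.
Proof. by rewrite !hE (h_self n2) (h_C e0 e2) -/H2 /a1 /t3 /b2; ring. Qed.
Let O1_e3 : h e3 O1 = 0.
Proof. by rewrite !hE (h_self n3) (h_C e0 e3) -/H3 aC1 /t2 /b3; ring. Qed.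
Let O2_e0 : h e0 O2 = 0.
Proof. by rewrite !hE h_self // -/H1 -/H3 /t1 /t3 /b1 /b3; ring. Qed.
Let O2_e3 : h e3 O2 = 0.
Proof. by rewrite !hE (h_self n3) (h_C e0 e3) -/H3 /a2 /t1 /b3; ring. Qed.
Let O2_e1 : h e1 O2 = 0.
Proof. by rewrite !hE (h_self n1) (h_C e0 e1) -/H1 aC2 /t3 /b1; ring. Qed.
Let O3_e0 : h e0 O3 = 0.
Proof. by rewrite !hE h_self // -/H1 -/H2 /t1 /t2 /b1 /b2; ring. Qed.
Let O3_e1 : h e1 O3 = 0.
Proof. by rewrite !hE (h_self n1) (h_C e0 e1) -/H1 /a3 /t2 /b1; ring. Qed.
Let O3_e2 : h e2 O3 = 0.
Proof. by rewrite !hE (h_self n2) (h_C e0 e2) -/H2 aC3 /t1 /b2; ring. Qed.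

Let adj0 a b : adj a b -> h a b = 0. Proof. exact: adj_hM. Qed.

Let O1P : exists z, O1 = act o1 z.
Proof.
apply: (@perp_three _ p p01 o1 e0 e2) => //; first exact: form_h.
by rewrite !hE !adj0 //; ring.
Qed.
Let O2P : exists z, O2 = act o2 z.
Proof.
apply: (@perp_three _ p p01 o2 e0 e1) => //; first exact: form_h.
by rewrite !hE !adj0 //; ring.
Qed.
Let O3P : exists z, O3 = act o3 z.
Proof.
apply: (@perp_three _ p p01 o3 e0 e1) => //; first exact: form_h.
by rewrite !hE !adj0 //; ring.
Qed.

Let u1 := o e0 e1 * t1. Let u2 := o e0 e2 * t2. Let u3 := o e0 e3 * t3.
Let v1 := o e2 e3 * t2 * t3. Let v2 := o e3 e1 * t3 * t1. Let v3 := o e1 e2 * t1 * t2.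

Let i0 : ('i : C) != 0. Proof. by rewrite eq_complex /= negb_and oner_eq0 orbT. Qed.
Let H10 : H1 != 0. Proof. exact: form_h. Qed.
Let H20 : H2 != 0. Proof. exact: form_h. Qed.
Let H30 : H3 != 0. Proof. exact: form_h. Qed.
Let t10 : t1 != 0. Proof. by rewrite mulf_neq0 ?conjC_eq0'. Qed.
Let t20 : t2 != 0. Proof. by rewrite mulf_neq0 ?conjC_eq0'. Qed.
Let t30 : t3 != 0. Proof. by rewrite mulf_neq0 ?conjC_eq0'. Qed.
Let a10 : a1 != 0.
Proof. by rewrite !mulf_neq0 ?oppr_eq0 ?conjC_eq0' ?form_h. Qed.

Let D1 : b2 * u3 - b3 * u2 != 0.
Proof.
have -> : b2 * u3 - b3 * u2 = 'i * (H2^*)%C * (H3^*)%C * spread e0 e2 e3.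
  by rewrite /spread /b2 /b3 /u2 /u3 /t2 /t3 /H2 /H3; ring.
by rewrite !mulf_neq0 ?conjC_eq0'.
Qed.
Let D2 : b3 * u1 - b1 * u3 != 0.
Proof.
have -> : b3 * u1 - b1 * u3 = - ('i * (H1^*)%C * (H3^*)%C * spread e0 e1 e3).
  by rewrite /spread /b1 /b3 /u1 /u3 /t1 /t3 /H1 /H3; ring.
by rewrite oppr_eq0 !mulf_neq0 ?conjC_eq0'.
Qed.
Let D3 : b1 * u2 - b2 * u1 != 0.
Proof.
have -> : b1 * u2 - b2 * u1 = 'i * (H1^*)%C * (H2^*)%C * spread e0 e1 e2.
  by rewrite /spread /b2 /b1 /u2 /u1 /t2 /t1 /H2 /H1; ring.
by rewrite !mulf_neq0 ?conjC_eq0'.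
Qed.

Let m1 : C := (lab e0 o1)%:C. Let m2 : C := (lab e0 o2)%:C. Let m3 : C := (lab e0 o3)%:C.

Let lab_neq0 a x x' d : quad a x x' d -> (lab a x)%:C != 0 :> C.
Proof.
move=> Q; rewrite realC_eq0 /lab !mulf_neq0 ?invr_eq0 ?sqn_neq0 ?(quad_o_neq0 Q) //.
  by case: Q => -[].
by case: Q => _ [].
Qed.

(* quad_OM for the three faces at e0 *)
Let R1 : m2 * (b3 * u1 - b1 * u3) * (v3 * b1 - u1 * a3) = m3 * (b1 * u2 - b2 * u1) * (v2 * b1 - u1 * a2).
Proof.
have [z2 E2] := O2P; have [z3 E3] := O3P.
have -> : b3 * u1 - b1 * u3 = o e0 O2 by rewrite !hE o_self /u1 /u3; ring.
have -> : b1 * u2 - b2 * u1 = o e0 O3 by rewrite !hE o_self /u1 /u2; ring.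
have -> : v3 * b1 - u1 * a3 = o e1 O3 * t1 by rewrite !hE o_self (o_C e0 e1) /u1 /v3; ring.
have -> : v2 * b1 - u1 * a2 = o e1 O2 * t1 by rewrite !hE o_self (o_C e0 e1) (o_C e3 e1) /u1 /v2; ring.
rewrite E2 E3 !o_act.
transitivity (o e0 o2 * o e1 o3 * m2 * (z2 * z3 * t1)); first by ring.
have := quad_OM p01 Q1; rewrite -/m2 -/m3 => ->; ring.
Qed.
Let R2 : m3 * (b1 * u2 - b2 * u1) * (v1 * b2 - u2 * a1) = m1 * (b2 * u3 - b3 * u2) * (v3 * b2 - u2 * a3).
Proof.
have [z1 E1] := O1P; have [z3 E3] := O3P.
have -> : b2 * u3 - b3 * u2 = o e0 O1 by rewrite !hE o_self /u2 /u3; ring.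
have -> : b1 * u2 - b2 * u1 = o e0 O3 by rewrite !hE o_self /u1 /u2; ring.
have -> : v1 * b2 - u2 * a1 = o e2 O1 * t2 by rewrite !hE o_self (o_C e0 e2) /u2 /v1; ring.
have -> : v3 * b2 - u2 * a3 = o e2 O3 * t2 by rewrite !hE o_self (o_C e0 e2) (o_C e1 e2) /u2 /v3; ring.
rewrite E1 E3 !o_act.
transitivity (o e0 o3 * o e2 o1 * m3 * (z1 * z3 * t2)); first by ring.
have := quad_OM p01 Q2; rewrite -/m1 -/m3 => <-; ring.
Qed.
Let R3 : m1 * (b2 * u3 - b3 * u2) * (v2 * b3 - u3 * a2) = m2 * (b3 * u1 - b1 * u3) * (v1 * b3 - u3 * a1).
Proof.
have [z1 E1] := O1P; have [z2 E2] := O2P.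
have -> : b2 * u3 - b3 * u2 = o e0 O1 by rewrite !hE o_self /u2 /u3; ring.
have -> : b3 * u1 - b1 * u3 = o e0 O2 by rewrite !hE o_self /u1 /u3; ring.
have -> : v2 * b3 - u3 * a2 = o e3 O2 * t3 by rewrite !hE o_self (o_C e0 e3) /u3 /v2; ring.
have -> : v1 * b3 - u3 * a1 = o e3 O1 * t3 by rewrite !hE o_self (o_C e0 e3) (o_C e2 e3) /u3 /v1; ring.
rewrite E1 E2 !o_act.
transitivity (o e0 o1 * o e3 o2 * m1 * (z1 * z2 * t3)); first by ring.
have := quad_OM p01 Q3; rewrite -/m1 -/m2 => ->; ring.
Qed.

Let X_e2 : h e2 X = 0.
Proof. by rewrite !hE (h_self n2) aC3 /a1 /t1 /t3; ring. Qed.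
Let X_e3 : h e3 X = 0.
Proof. by rewrite !hE (h_self n3) aC1 /a2 /t1 /t2; ring. Qed.

Lemma cube_hM : h y e1 = 0.
Proof.
have K := cube_scalars (lab_neq0 Q3) (lab_neq0 Q1) (lab_neq0 (quad_swap Q1)) D1 D2 D3 R1 R2 R3.
rewrite -/m2 -/m3 in K.
have [z1 E1] := O1P.
have z10 : z1 != 0.
  apply: contra D1 => /eqP z0; have -> : b2 * u3 - b3 * u2 = o e0 O1 by rewrite !hE o_self /u2 /u3; ring.
  by rewrite E1 o_act z0 mulr0.
have F : m3 * o e2 o1 * o e3 X = m2 * o e3 o1 * o e2 X.
  have t0 : - z1 * t2 * t3 != 0 by rewrite (mulf_neq0 _ t30) ?(mulf_neq0 _ t20) ?oppr_eq0.
  apply: (mulIf t0).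
  have k1 : v1 * b2 - u2 * a1 = o e2 o1 * z1 * t2.
    by rewrite -o_act -E1 !hE o_self (o_C e0 e2) /u2 /v1; ring.
  have k2 : v1 * b3 - u3 * a1 = o e3 o1 * z1 * t3.
    by rewrite -o_act -E1 !hE o_self (o_C e0 e3) (o_C e2 e3) /u3 /v1; ring.
  have k3 : v1 * a2 - v2 * a1 = - (o e3 X * t3) by rewrite !hE o_self (o_C e2 e3) /v1 /v2; ring.
  have k4 : v3 * a1 - v1 * a3 = - (o e2 X * t2) by rewrite !hE o_self (o_C e1 e2) /v1 /v3; ring.
  rewrite k1 k2 k3 k4 in K.
  by transitivity (m3 * (o e2 o1 * z1 * t2) * - (o e3 X * t3)); [ring | rewrite K; ring].
have FY : m3 * o e2 o1 * o e3 y = m2 * o e3 o1 * o e2 y.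
  have := quad_OM p01 Qy; rewrite (labC p o1 e2) (labC p o1 e3).
  rewrite -(quad_lab p01 (quad_swap Q2)) -(quad_lab p01 (quad_swap Q3)) -/m2 -/m3.
  rewrite (o_C o1 e2) (o_C o1 e3) (o_C y e3) (o_C y e2) => e.
  transitivity (o o1 e2 * o y e3 * m3); first by ring.
  by rewrite e; ring.
have hy : h o1 y != 0 by apply: form_h; case: Qy.
pose z2 := h o1 X / h o1 y.
pose W := dadd X (act y (- z2)).
have [adjy2 adjy3] : adj e2 y /\ adj e3 y by case: Qy => *; split; apply: adjC.
have [z Wz] : exists z, W = act o1 z.
  apply: (@perp_three _ p p01 o1 e2 e3) => //; first exact: form_h.
  - by rewrite /W h_add h_act /z2 mulrN [h o1 y * _]mulrC divfK // subrr.
  - by rewrite /W h_add h_act X_e2 (adj0 adjy2); ring.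
  - by rewrite /W h_add h_act X_e3 (adj0 adjy3); ring.
have z0 : z = 0.
  have nz : o e2 o1 * o e3 o1 * (m3 - m2) != 0.
    rewrite (o_C o1 e2) (o_C o1 e3) !mulf_neq0 ?oppr_eq0 ?(quad_o_neq0 Qy) ?(quad_o_neq0 (quad_swap Qy)) //.
    by rewrite /m3 /m2 -rmorphB realC_eq0 subr_eq0 eq_sym.
  apply: (mulfI nz); rewrite mulr0.
  transitivity (m3 * o e2 o1 * o e3 W - m2 * o e3 o1 * o e2 W).
    by rewrite Wz !o_act; ring.
  have oW e : o e W = o e X + o e y * (- z2) by rewrite /W o_add o_act.
  rewrite !oW.
  transitivity ((m3 * o e2 o1 * o e3 X - m2 * o e3 o1 * o e2 X) - z2 * (m3 * o e2 o1 * o e3 y - m2 * o e3 o1 * o e2 y)); first by ring.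
  by rewrite F FY; ring.
have XE : h y X = 0.
  have ny : form y y = 0 by case: Qy => _ _ _ [].
  have : h y W = 0 by rewrite Wz z0 h_act mulr0.
  by rewrite /W h_add h_act (h_self ny) mul0r addr0.
move: XE; rewrite !hE (h_C e2 y) (h_C e3 y) (adj0 adjy2) (adj0 adjy3).
have -> : ((0 : C)^*)%C = 0 by ceq.
rewrite !mul0r !addr0 => /eqP.
by move=> /eqP e; apply: (mulIf (mulf_neq0 t10 a10)); rewrite mul0r.
Qed.
End CubeM.

(** The two equations of adjacency are cube_hM for the first axis and, after
    dsig, for the second one. *)
Lemma cube e0 e1 e2 e3 o1 o2 o3 y :
  quad e0 o2 o3 e1 -> quad e0 o1 o3 e2 -> quad e0 o1 o2 e3 -> quad o1 e2 e3 y ->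
  lab e0 o2 != lab e0 o3 ->
  spread e0 e2 e3 != 0 -> spread e0 e1 e3 != 0 -> spread e0 e1 e2 != 0 ->
  spread (dsig e0) (dsig e2) (dsig e3) != 0 -> spread (dsig e0) (dsig e1) (dsig e3) != 0 ->
  spread (dsig e0) (dsig e1) (dsig e2) != 0 ->
  adj y e1.
Proof.
move=> Q1 Q2 Q3 Qy N Z1 Z2 Z3 Z1' Z2' Z3'.
have labsig a b : adj a b -> lab (dsig a) (dsig b) = lab a b.
  case=> _ _ h6; rewrite /lab rel_sig !nrm_sig; congr (_ / _).
  by move: h6; case: (rel a b) => ? ? ? ? ? ? ? ? /= h6; rewrite /sqn /= h6; ring.
apply/(inL_hM p01); split; first exact: (@cube_hM e0 e1 e2 e3 o1 o2 o3 y).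
rewrite -rel_sig; apply: (@cube_hM (dsig e0) (dsig e1) (dsig e2) (dsig e3) (dsig o1) (dsig o2) (dsig o3)) => //;
  try exact: quad_sig.
by rewrite !labsig //; case: Q1.
Qed.
End Cube.

(** * The opposite vertex as a polynomial function *)

Section Coords.
Variable R : rcfType.
Local Notation dq := (dq R).

Definition coords (a : dq) : seq R := [:: x0 a; x1 a; x2 a; x3 a; x4 a; x5 a; x6 a; x7 a].
Definition row_of (a : dq) : 'rV[R]_8 := \row_j (coords a)`_j.
Definition of_row (v : 'rV[R]_8) : dq :=
  DQ (v 0 (inord 0)) (v 0 (inord 1)) (v 0 (inord 2)) (v 0 (inord 3))
     (v 0 (inord 4)) (v 0 (inord 5)) (v 0 (inord 6)) (v 0 (inord 7)).

Lemma of_rowK : cancel row_of of_row.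
Proof. by case=> *; rewrite /of_row !mxE !inordK. Qed.

Lemma row_ofK : cancel of_row row_of.
Proof.
move=> v; apply/rowP => j; rewrite mxE /of_row /=.
case: j => [[|[|[|[|[|[|[|[|m]]]]]]]] hm] //=; congr (v 0 _); by apply/val_inj; rewrite /= inordK.
Qed.

Definition linear_dq (f : dq -> R) := forall k a b, f (dadd (dsc k a) b) = k * f a + f b.

Lemma linear_dq_row f : linear_dq f -> forall v : 'rV[R]_8,
  f (of_row v) = \sum_j v 0 j * f (of_row (delta_mx 0 j)).
Proof.
move=> lf v.
have f0 : f (dzero R) = 0.
  have := lf 1 (dzero R) (dzero R).
  have -> : dadd (dsc 1 (dzero R)) (dzero R) = dzero R by congr DQ; rewrite /=; ring.
  by rewrite mul1r => /eqP; rewrite -subr_eq0 opprD addrA subrr add0r oppr_eq0 => /eqP.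
have rowD (k : R) (u w : 'rV[R]_8) : of_row (k *: u + w) = dadd (dsc k (of_row u)) (of_row w).
  by rewrite /of_row !mxE.
rewrite [in LHS](row_sum_delta v).
elim/big_rec2: _ => [|j s w _ IH].
  by rewrite -f0; congr f; congr DQ; rewrite mxE.
by rewrite rowD lf IH.
Qed.
End Coords.

Section Flip.
Variable R : rcfType.
Variable p : R.
Local Notation q := (1 - p).
Local Notation dq := (dq R).
Local Notation rel := (rel p).
Local Notation form := (form p).
Local Notation adj := (adj p).
Local Notation proper := (proper p).
Local Notation lab := (lab p).
Local Notation quad := (quad p).

Definition dot (a b : dq) : R := \sum_j row_of a 0 j * row_of b 0 j.

(** Being adjacent to b and c are six linear equations whose solution space is
    spanned by a and one more vector.  The value of the Study form with a singles
    out the second vector up to a multiple of a, which the last entry fixes. *)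
Definition conds (a b c x : dq) : seq R :=
  [:: x4 (rel b x); x5 (rel b x) - q * x1 (rel b x); x6 (rel b x) + p * x2 (rel b x);
      x4 (rel c x); x5 (rel c x) - q * x1 (rel c x); x6 (rel c x) + p * x2 (rel c x);
      form a x; dot a x].

Definition flip_mx (a b c : dq) : 'M[R]_8 :=
  \matrix_(j, i) (conds a b c (of_row (delta_mx 0 j)))`_i.

Lemma flip_mxE a b c (v : 'rV[R]_8) i : (v *m flip_mx a b c) 0 i = (conds a b c (of_row v))`_i.
Proof.
rewrite mxE (eq_bigr (fun j => v 0 j * (conds a b c (of_row (delta_mx 0 j)))`_i)); last first.
  by move=> j _; rewrite mxE.
symmetry; apply: (@linear_dq_row _ (fun x => (conds a b c x)`_i)).
move=> k x y.
have ld : dot a (dadd (dsc k x) y) = k * dot a x + dot a y.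
  rewrite /dot mulr_sumr -big_split; apply: eq_bigr => j _ /=.
  rewrite !mxE; case: j => [[|[|[|[|[|[|[|[|m]]]]]]]] hm] //=; ring.
have lform : form a (dadd (dsc k x) y) = k * form a x + form a y by rewrite /form /=; ring.
rewrite /conds !rel_addr !rel_scr ld lform.
move: (rel b x) (rel b y) (rel c x) (rel c y) => s1 s2 s3 s4.
by case: i => [[|[|[|[|[|[|[|[|m]]]]]]]] hm] //=; ring.
Qed.

Hypothesis p01 : 0 < p < 1.

(** Cramer's rule for the conditions (0, ..., 0, 1, 0), followed by the reflection
    that moves the solution x along the line through a into the Study quadric.
    The inverse matrix is replaced by the adjugate, so that the coordinates of
    the result are polynomials, defined and continuous for all arguments. *)
Definition flip (a b c : dq) : dq :=
  let A := flip_mx a b c in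
  let x := of_row (row (inord 6) (\adj A)) in
  dadd (dsc (2%:R * \det A) x) (dsc (- form x x) a).

Lemma dot_eq0 a : dot a a = 0 -> a = dzero R.
Proof.
move=> h; rewrite -[a]of_rowK; have -> : row_of a = 0.
  apply/rowP => j; rewrite [RHS]mxE; apply/eqP; rewrite -sqrf_eq0; apply/eqP.
  move/eqP: h; rewrite /dot psumr_eq0; last by move=> i _; rewrite -expr2 sqr_ge0.
  by move/allP/(_ j); rewrite mem_index_enum => /(_ isT) /=; rewrite -expr2 => /eqP.
by rewrite /of_row; congr DQ; rewrite mxE.
Qed.

(** opposite_rigid is the statement that the matrix of the conditions is regular. *)
Lemma flipP a b c : proper a -> proper b -> proper c -> adj a b -> adj a c ->
  form b c != 0 -> lab a b != lab a c -> quad a b c (flip a b c).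
Proof.
move=> pa pb pc ab ac hbc hl; have [na a0] := pa.
pose A := flip_mx a b c.
have adjE x y : (x4 (rel x y) = 0) -> (x5 (rel x y) - q * x1 (rel x y) = 0) ->
    (x6 (rel x y) + p * x2 (rel x y) = 0) -> adj x y.
  rewrite /adj; move: (rel x y) => r e4 e5 e6; split; first exact: e4.
    by apply/eqP; move/eqP: e5; rewrite subr_eq0.
  by apply/eqP; move/eqP: e6; rewrite addr_eq0.
have dA : \det A != 0.
  apply/det0P => -[v v0 vA].
  have E i : (conds a b c (of_row v))`_i = 0.
    case: (ltnP i 8) => hi; last by rewrite nth_default.
    by rewrite -(flip_mxE a b c v (Ordinal hi)) -/A vA mxE.
  have [k xk] := opposite_rigid p01 pa pb pc ab ac
    (adjC (adjE _ _ (E 0%N) (E 1%N) (E 2%N))) (adjC (adjE _ _ (E 3%N) (E 4%N) (E 5%N))) hbc hl (E 6%N).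
  have := E 7%N; rewrite /= xk.
  have -> : dot a (dsc k a) = k * dot a a.
    rewrite /dot mulr_sumr; apply: eq_bigr => j _ /=.
    rewrite !mxE; case: j => [[|[|[|[|[|[|[|[|m]]]]]]]] hm] //=; ring.
  move/eqP; rewrite mulf_eq0 => /orP[/eqP k0|/eqP /dot_eq0 az]; last first.
    by case/eqP: a0; rewrite az /nrm /=; ring.
  case/eqP: v0; rewrite -[v]row_ofK xk k0.
  by apply/rowP => j; rewrite !mxE; case: j => [[|[|[|[|[|[|[|[|m]]]]]]]] hm] //=; ring.
pose x := of_row (row (inord 6) (\adj A)).
have E i : (conds a b c x)`_i = if i == 6%N then \det A else 0.
  case: (ltnP i 8) => hi; last first.
    by rewrite nth_default //; case: eqP hi => // ->.
  rewrite -(flip_mxE a b c _ (Ordinal hi)) -/A -row_mul mul_adj_mx !mxE -val_eqE /= inordK //.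
  by rewrite eq_sym; case: eqP => _; rewrite ?mulr1n ?mulr0n.
have e6 : form a x = \det A by apply: (E 6%N).
have xb : adj b x by apply: adjE; [apply: (E 0%N) | apply: (E 1%N) | apply: (E 2%N)].
have xc : adj c x by apply: adjE; [apply: (E 3%N) | apply: (E 4%N) | apply: (E 5%N)].
have fE : flip a b c = dadd (dsc (2%:R * \det A) x) (dsc (- form x x) a) by [].
have db : adj b (flip a b c) by rewrite fE; apply: adj_add; apply: adj_scr => //; apply: adjC.
have dc : adj c (flip a b c) by rewrite fE; apply: adj_add; apply: adj_scr => //; apply: adjC.
have nd : form (flip a b c) (flip a b c) = 0.
  rewrite fE; transitivity ((2%:R * \det A) ^+ 2 * form x x
     - 2%:R * (2%:R * \det A) * form x x * form a x + (form x x) ^+ 2 * form a a).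
    by rewrite /form /=; ring.
  by rewrite na e6; ring.
have had : form a (flip a b c) != 0.
  have -> : form a (flip a b c) = 2%:R * \det A ^+ 2.
    rewrite fE; transitivity ((2%:R * \det A) * form a x - form x x * form a a).
      by rewrite /form /=; ring.
    by rewrite na e6; ring.
  by rewrite mulf_neq0 ?expf_neq0 ?pnatr_eq0.
split=> //; try exact: adjC.
split=> //; apply: (common_neighbour_proper p01 pb pc hbc) => // dz.
by case/eqP: had; rewrite dz /form /=; ring.
Qed.
End Flip.

(** * Nets generated by their values along the axes of the lattice *)

Section Lattice.
Variable n : nat.
Local Notation idx := 'rV[int]_n.

(** A coordinate direction of the lattice with a sign; nets grow from the origin
    along signed directions in all orthants alike. *)
Definition dir := ('I_n * bool)%type.
Definition st (d : dir) : idx := if d.2 then delta_mx 0 d.1 else - delta_mx 0 d.1.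
Definition opp (d : dir) : dir := (d.1, ~~ d.2).
Definition out (v : idx) (d : dir) : bool := if d.2 then 0 <= v 0 d.1 else v 0 d.1 <= 0.
Definition size1 (v : idx) : nat := \sum_k absz (v 0%R k).

Lemma stE d k : st d 0 k = if k == d.1 then if d.2 then 1 else -1 else 0.
Proof. by rewrite /st; case: d.2; rewrite !mxE eqxx /=; case: eqP. Qed.

Lemma st_opp d : st (opp d) = - st d.
Proof. by rewrite /st /=; case: d.2; rewrite /= ?opprK. Qed.

Lemma out_st v d e : d.1 != e.1 -> out (v + st e) d = out v d.
Proof. by move=> h; rewrite /out mxE stE (negbTE h) addr0. Qed.

Lemma out_sub v d e : d.1 != e.1 -> out (v - st e) d = out v d.
Proof. by move=> h; rewrite -st_opp out_st. Qed.

Lemma out_opp v d : ~~ out v d -> out (v + st d) (opp d).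
Proof. by rewrite /out mxE stE eqxx /=; case: d.2 => /=; lia. Qed.

Lemma size1_out v d : out v d -> size1 (v + st d) = (size1 v).+1.
Proof.
move=> h; rewrite /size1 (bigD1 d.1) //= [in RHS](bigD1 d.1) //=.
rewrite (eq_bigr (fun k => absz (v 0%R k))); last first.
  by move=> k hk; rewrite mxE stE (negbTE hk) addr0.
move: (\sum_(k < n | k != d.1) _)%N h => m; rewrite mxE stE eqxx /out.
by case: d.2; move: (v 0 d.1) => z; lia.
Qed.

Lemma size1_eq0 v : size1 v = 0%N -> v = 0.
Proof.
move=> /eqP; rewrite /size1 sum_nat_eq0 => /forallP h; apply/rowP => k.
by move: (h k); rewrite /= absz_eq0 mxE => /eqP.
Qed.

(** The signed direction leading away from the origin at v, as long as v 0 k is nonzero. *)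
Definition outer (v : idx) k : dir := (k, 0 < v 0 k).

Lemma outer_out (v : idx) k : v 0 k != 0 -> out (v - st (outer v k)) (outer v k).
Proof.
rewrite /out /= !mxE stE eqxx /=; move: (v 0 k) => z.
by case: (boolP (0 < z)) => /=; lia.
Qed.

Lemma on_axis_ind (v : idx) : ~~ on_axis v ->
  exists k l, [/\ k != l, v 0 k != 0 & v 0 l != 0].
Proof.
move=> /forallPn[k /forallPn[l]]; rewrite negb_imply negb_or => /andP[h /andP[h1 h2]].
by exists k, l.
Qed.

Lemma on_axisP (v : idx) k l : on_axis v -> k != l -> v 0 k != 0 -> v 0 l = 0.
Proof.
by move=> /forallP/(_ k)/forallP/(_ l)/implyP h /h /orP[/eqP->|/eqP->] //; rewrite eqxx.
Qed.

Lemma outer_st (v : idx) d : out v d -> outer (v + st d) d.1 = d.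
Proof.
case: d => k b; rewrite /out /outer !mxE stE eqxx /= => h; congr (_, _).
by move: (v 0 k) h => z; case: b; lia.
Qed.

Lemma st_neq0 (v : idx) d : out v d -> (v + st d) 0 d.1 != 0.
Proof.
by case: d => k b; rewrite /out !mxE stE eqxx /=; move: (v 0 k) => z; case: b; lia.
Qed.

Lemma on_axis_tail (v : idx) d k : out v d -> on_axis (v + st d) -> k != d.1 -> v 0 k = 0.
Proof.
move=> o h kd; have dk : d.1 != k by rewrite eq_sym.
by have := on_axisP h dk (st_neq0 o); rewrite mxE stE (negbTE kd) addr0.
Qed.

Lemma on_axis_in (v : idx) d : out v d -> on_axis (v + st d) -> on_axis v.
Proof.
move=> o h; apply: contraT => /on_axis_ind [c [e [ce vc ve]]].
have [cd|cd] := eqVneq c d.1.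
  by move: ve; rewrite (on_axis_tail o h) ?eqxx // -cd eq_sym.
by move: vc; rewrite (on_axis_tail o h cd) eqxx.
Qed.

Lemma off_axis_coord (v : idx) d : ~~ on_axis (v + st d) -> exists2 k, k != d.1 & v 0 k != 0.
Proof.
move=> /on_axis_ind [c [e [ce vc ve]]].
have [cd|cd] := eqVneq c d.1.
  have ed : e != d.1 by rewrite -cd eq_sym.
  by exists e => //; move: ve; rewrite mxE stE (negbTE ed) addr0.
by exists c => //; move: vc; rewrite mxE stE (negbTE cd) addr0.
Qed.

Lemma on_axis0 : on_axis (0 : idx).
Proof. by apply/forallP => k; apply/forallP => l; rewrite !mxE eqxx implybT. Qed.
End Lattice.

Section Net.
Variables (R : rcfType) (n : nat) (p : R).
Local Notation idx := 'rV[int]_n.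
Local Notation dq := (dq R).
Local Open Scope complex_scope.
Local Notation flip := (flip p).

Section Rec.
Variable g : idx -> dq.

Definition corner (i : idx) :=
  [pick kl : 'I_n * 'I_n | [&& kl.1 != kl.2, i 0 kl.1 != 0 & i 0 kl.2 != 0]].

(** The first argument is fuel; net supplies the distance from the origin, which
    decreases with each backward step.  At an index off the axes one of the
    quadrilaterals ending there is chosen to define the value; that the choice
    does not matter is the three-dimensional consistency. *)
Fixpoint net_rec m (i : idx) : dq :=
  if m is m'.+1 then
    if corner i is Some kl then
      let s1 := st (outer i kl.1) in let s2 := st (outer i kl.2) in
      flip (net_rec m' (i - s1 - s2)) (net_rec m' (i - s2)) (net_rec m' (i - s1))
    else g i
  else g i.

Definition net i := net_rec (size1 i) i.

Lemma net_axis i : on_axis i -> net i = g i.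
Proof.
move=> h; rewrite /net; case: (size1 i) => //= m; rewrite /corner.
by case: pickP => // -[k l] /and3P[/= kl ik]; rewrite (on_axisP h kl ik) eqxx.
Qed.

Lemma size1_in (i : idx) k : i 0 k != 0 -> size1 i = (size1 (i - st (outer i k))).+1.
Proof. by move=> h; rewrite -(size1_out (outer_out h)) subrK. Qed.

Lemma corner_None i : corner i = None -> on_axis i.
Proof.
rewrite /corner; case: pickP => // h _; apply: contraT => /on_axis_ind [k [l [kl ik il]]].
by have := h (k, l); rewrite /= kl ik il.
Qed.

Lemma corner_Some i k l : corner i = Some (k, l) ->
  [/\ k != l, i 0 k != 0, i 0 l != 0 & (i - st (outer i k)) 0 l != 0] /\
  [/\ size1 i = (size1 (i - st (outer i k))).+1, size1 i = (size1 (i - st (outer i l))).+1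
    & size1 i = (size1 (i - st (outer i k) - st (outer i l))).+2].
Proof.
rewrite /corner; case: pickP => // -[k' l'] /= /and3P[kl ik il] [<- <-].
have lk : l' != k' by rewrite eq_sym.
have il' : (i - st (outer i k')) 0 l' != 0.
  by rewrite mxE [X in _ + X]mxE stE /= (negbTE lk) oppr0 addr0.
split=> //; split; [exact: size1_in | exact: size1_in|].
have := size1_in il'; have -> : outer (i - st (outer i k')) l' = outer i l'.
  by rewrite /outer mxE [X in _ + X]mxE stE /= (negbTE lk) oppr0 addr0.
by move <-; apply: size1_in.
Qed.

Lemma net_rec_fuel m m' i : (size1 i <= m)%N -> (size1 i <= m')%N -> net_rec m i = net_rec m' i.
Proof.
have c0 i' : size1 i' = 0%N -> corner i' = None.
  by move=> h; case E : (corner i') => [[k l]|] //; have [_ []] := corner_Some E; rewrite h.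
elim: m m' i => [|m IH] m' i.
  by rewrite leqn0 => /eqP h _; case: m' => //= m'; rewrite c0.
move=> hm; case: m' => [|m'].
  by rewrite leqn0 => /eqP h /=; rewrite c0.
move=> hm' /=; case E : (corner i) => [[k l]|] //.
have [_ [s1 s2 s3]] := corner_Some E.
by congr flip; apply: IH; rewrite /=; lia.
Qed.

Lemma net_flip i : ~~ on_axis i -> exists v d1 d2,
  [/\ i = v + st d1 + st d2, d1.1 != d2.1, out v d1, out v d2
    & net i = flip (net v) (net (v + st d1)) (net (v + st d2))].
Proof.
move=> /on_axis_ind [k [l [kl ik il]]]; rewrite /net.
have := size1_in ik; case E : (size1 i) => [//|m] _ /=.
rewrite /corner; case: pickP => [|/(_ (k, l))]; last by rewrite /= kl ik il.
move=> {k l kl ik il} [k l] /= /and3P[kl ik il].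
have lk : l != k by rewrite eq_sym.
set d1 := outer i k; set d2 := outer i l.
have s1 := size1_in ik; have s2 := size1_in il; rewrite -/d1 -/d2 in s1 s2.
have e1 : i - st d1 - st d2 + st d1 = i - st d2 by rewrite addrAC subrK.
have e2 : i - st d1 - st d2 + st d2 = i - st d1 by rewrite subrK.
have o1 : out (i - st d1 - st d2) d1 by rewrite out_sub // outer_out.
have o2 : out (i - st d1 - st d2) d2 by rewrite addrAC out_sub // outer_out.
exists (i - st d1 - st d2), d1, d2; split=> //.
  by rewrite e1 subrK.
have s3 : size1 (i - st d2) = (size1 (i - st d1 - st d2)).+1 by rewrite -e1 size1_out.
rewrite e1 e2; congr flip; apply: net_rec_fuel; lia.
Qed.

End Rec.

(** The recursion only visits indices between the origin and i, so a set closed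
    under steps towards the origin contains all data that are used. *)
Lemma net_local (S : pred idx) g g' :
  (forall i k, S i -> i 0 k != 0 -> S (i - st (outer i k))) ->
  (forall i, S i -> on_axis i -> g i = g' i) -> forall i, S i -> net g i = net g' i.
Proof.
move=> hS hg; suff H m : forall i, (size1 i <= m)%N -> S i -> net_rec g m i = net_rec g' m i.
  by move=> i Si; rewrite /net H.
elim: m => [|m IH] i.
  by rewrite leqn0 => /eqP /size1_eq0 -> S0; apply: hg => //; apply: on_axis0.
move=> hm Si /=; case E : (corner i) => [[k l]|]; last by apply: hg => //; apply: corner_None.
have [[kl ik il ikl] [s1 s2 s3]] := corner_Some E.
have S' : S (i - st (outer i k) - st (outer i l)).
  have lk : l != k by rewrite eq_sym.
  have -> : outer i l = outer (i - st (outer i k)) l.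
    by rewrite /outer [in RHS]mxE [X in _ + X]mxE stE /= (negbTE lk) oppr0 addr0.
  by apply/hS => //; apply/hS.
by rewrite /= !IH //; do ?[by apply/hS]; lia.
Qed.
End Net.

(** * Generic nets are motions *)

Section Inv.
Variables (R : rcfType) (n : nat) (p : R).
Hypothesis p01 : 0 < p < 1.
Local Notation idx := 'rV[int]_n.
Local Notation dir := (dir n).
Local Notation dq := (dq R).
Local Open Scope complex_scope.
Local Notation rel := (rel p).
Local Notation form := (form p).
Local Notation nrm := (nrm p).
Local Notation adj := (adj p).
Local Notation OM := (OM p).
Local Notation proper := (proper p).
Local Notation lab := (lab p).
Local Notation quad := (quad p).
Local Notation spread := (spread p).
Local Notation net := (net p).

(** The difference of the two labels, cleared of denominators. *)
Definition labdiff (a b c : dq) : R :=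
  nrm b * sqn (OM (rel a c)) - nrm c * sqn (OM (rel a b)).

Lemma labdiff_lab a b c : proper a -> proper b -> proper c -> adj a b -> adj a c ->
  form b c != 0 -> (labdiff a b c != 0) = (lab a b != lab a c).
Proof.
move=> pa [nb b0] [nc c0] ab ac h; have [_ a0] := pa.
have o0 x y : adj a x -> adj a y -> form x x = 0 -> form x y != 0 -> sqn (OM (rel a x)) != 0.
  move=> ax ay nx hxy; have [w [c' [d' [-> c'0 d'0]]]] := adj_edge p01 pa nx ax ay hxy.
  by rewrite sqn_OM_edge !mulf_neq0 ?pnatr_eq0 ?sqn_neq0.
have hb := o0 _ _ ab ac nb h.
have hc : sqn (OM (rel a c)) != 0 by apply: (o0 _ b) => //; rewrite formC.
have e : labdiff a b c * nrm a = (lab a b - lab a c) * (sqn (OM (rel a b)) * sqn (OM (rel a c))).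
  rewrite /labdiff /lab; move: hb hc; move: (sqn _) (sqn _) (nrm a) (nrm b) (nrm c) => s t x y z hs ht.
  by field; rewrite ?hs ?ht.
congr (~~ _); apply/eqP/eqP => h0.
  apply/eqP; rewrite -subr_eq0; apply/eqP; apply: (mulIf (mulf_neq0 hb hc)).
  by rewrite -e h0 !mul0r.
by apply: (mulIf a0); rewrite e h0 subrr !mul0r.
Qed.

Definition cond := (idx * (dir * dir * dir) * 'I_5)%type.

(** The genericity conditions at v require these numbers to be nonzero: the edges
    leaving v are of the general type (0), two of them are not conjugate (1) and
    have different labels (2), and the spread of two vertices two steps away
    from v - st d0 does not vanish for the first (3) and the second axis (4).
    Inapplicable conditions have the value 1. *)
Definition cval (g : idx -> dq) (c : cond) : R :=
  let: (v, (d0, d1, d2), k) := c in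
  let A := net g in
  let u := v - st d0 in
  let two := [&& d1.1 != d2.1, out v d1 & out v d2] in
  let three := [&& two, d0.1 != d1.1, d0.1 != d2.1 & out u d0] in
  match val k with
  | 0 => if out v d1 then x3 (rel (A v) (A (v + st d1))) else 1
  | 1 => if two then form (A (v + st d1)) (A (v + st d2)) else 1
  | 2 => if two then labdiff (A v) (A (v + st d1)) (A (v + st d2)) else 1
  | 3 => if three then sqn (spread (A u) (A (v + st d1)) (A (v + st d2))) else 1
  | _ => if three then sqn (spread (dsig (A u)) (dsig (A (v + st d1))) (dsig (A (v + st d2)))) else 1
  end.

Definition good m g := forall v ds k, (size1 v < m)%N -> cval g (v, ds, k) != 0.

(** The values along the axes in the model.  Only on_axis indices matter; total
    functions avoid a dependent type. *)
Record axis_data (g : idx -> dq) : Prop := AxisData {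
  ad_proper : forall i, on_axis i -> proper (g i);
  ad_adj : forall i d, on_axis i -> on_axis (i + st d) -> adj (g i) (g (i + st d));
  ad_fin : forall i d, on_axis i -> on_axis (i + st d) -> x3 (rel (g i) (g (i + st d))) != 0 }.

Section One.
Variable g : idx -> dq.
Hypothesis gd : axis_data g.
Variable m : nat.
Hypothesis gm : good m g.
Local Notation A := (net g).

Lemma good_fin v d : (size1 v < m)%N -> out v d -> x3 (rel (A v) (A (v + st d))) != 0.
Proof. by move=> h o; have := gm (d, d, d) (inord 0) h; rewrite /= inordK //= o. Qed.

Lemma good_form v d1 d2 : (size1 v < m)%N -> d1.1 != d2.1 -> out v d1 -> out v d2 ->
  form (A (v + st d1)) (A (v + st d2)) != 0.
Proof. by move=> h n12 o1 o2; have := gm (d1, d1, d2) (inord 1) h; rewrite /= inordK //= n12 o1 o2. Qed.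

Lemma good_labdiff v d1 d2 : (size1 v < m)%N -> d1.1 != d2.1 -> out v d1 -> out v d2 ->
  labdiff (A v) (A (v + st d1)) (A (v + st d2)) != 0.
Proof. by move=> h n12 o1 o2; have := gm (d1, d1, d2) (inord 2) h; rewrite /= inordK //= n12 o1 o2. Qed.

(** The index of this condition is u + st d0, one step further out than u. *)
Lemma good_spread u d0 d1 d2 : ((size1 u).+1 < m)%N -> d1.1 != d2.1 -> d0.1 != d1.1 -> d0.1 != d2.1 ->
  out u d0 -> out u d1 -> out u d2 ->
  spread (A u) (A (u + st d0 + st d1)) (A (u + st d0 + st d2)) != 0 /\
  spread (dsig (A u)) (dsig (A (u + st d0 + st d1))) (dsig (A (u + st d0 + st d2))) != 0.
Proof.
move=> h n12 n01 n02 o0 o1 o2; rewrite -(size1_out o0) in h.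
have := gm (d0, d1, d2) (inord 4) h; have := gm (d0, d1, d2) (inord 3) h.
rewrite /= !inordK //= addrK n12 n01 n02 o0.
have -> : out (u + st d0) d1 by rewrite out_st // eq_sym.
have -> : out (u + st d0) d2 by rewrite out_st // eq_sym.
by rewrite /= !sqn_neq0.
Qed.

(** The parts of the net at distance at most k from the origin form a motion. *)
Record inv k : Prop := Inv {
  inv_proper : forall i, (size1 i <= k)%N -> proper (A i);
  inv_adj : forall v d, (size1 v < k)%N -> out v d -> adj (A v) (A (v + st d));
  inv_quad : forall v d1 d2, ((size1 v).+1 < k)%N -> d1.1 != d2.1 -> out v d1 -> out v d2 ->
    quad (A v) (A (v + st d1)) (A (v + st d2)) (A (v + st d1 + st d2)) }.

Lemma good_lab k v d1 d2 : inv k -> (size1 v < k)%N -> (size1 v < m)%N ->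
  d1.1 != d2.1 -> out v d1 -> out v d2 ->
  lab (A v) (A (v + st d1)) != lab (A v) (A (v + st d2)).
Proof.
move=> I hk hm n12 o1 o2; rewrite -labdiff_lab; first exact: good_labdiff.
- by apply: (inv_proper I); apply: ltnW.
- by apply: (inv_proper I); rewrite size1_out.
- by apply: (inv_proper I); rewrite size1_out.
- exact: (inv_adj I).
- exact: (inv_adj I).
- exact: good_form.
Qed.

(** The step from one face of a cube at its eighth vertex y to another one.  By
    cube the vertex y is adjacent to its third inner neighbour.  If the new face
    were folded, y would be proportional to A (a + st d2) by opposite_rigid, and
    quad_lab around the cube would identify the labels of the edges st d1 and
    st d3 at a. *)
Let turn k a d1 d2 d3 : inv k -> (k <= m)%N -> ((size1 a).+2 <= k)%N ->
  d1.1 != d2.1 -> d1.1 != d3.1 -> d2.1 != d3.1 -> out a d1 -> out a d2 -> out a d3 ->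
  let y := A (a + st d1 + st d2 + st d3) in
  quad (A (a + st d1)) (A (a + st d1 + st d3)) (A (a + st d1 + st d2)) y ->
  adj y (A (a + st d2 + st d3)) /\
  quad (A (a + st d2)) (A (a + st d2 + st d3)) (A (a + st d1 + st d2)) y.
Proof.
move=> I km sa n12 n13 n23 u1 u2 u3 y Qy.
have n21 : d2.1 != d1.1 by rewrite eq_sym.
have n31 : d3.1 != d1.1 by rewrite eq_sym.
have n32 : d3.1 != d2.1 by rewrite eq_sym.
have sk : (size1 a < k)%N by exact: ltnW.
have sm : (size1 a < m)%N by exact: leq_trans sk km.
have [z1 z1'] := good_spread (leq_trans sa km) n23 n12 n13 u1 u2 u3.
have [z2 z2'] := good_spread (leq_trans sa km) n13 n21 n23 u2 u1 u3.
have [z3 z3'] := good_spread (leq_trans sa km) n12 n31 n32 u3 u1 u2.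
have Q12 := inv_quad I sa n12 u1 u2.
have Q13 := inv_quad I sa n13 u1 u3.
have Q23 := inv_quad I sa n23 u2 u3.
set e0 := A a in z1 z2 z3 z1' z2' z3' Q12 Q13 Q23.
set o1 := A (a + st d1) in Q12 Q13 Qy *.
set o2 := A (a + st d2) in Q12 Q23 *.
set o3 := A (a + st d3) in Q13 Q23.
have e12 : a + st d2 + st d1 = a + st d1 + st d2 by rewrite addrAC.
have e13 : a + st d3 + st d1 = a + st d1 + st d3 by rewrite addrAC.
have e23 : a + st d3 + st d2 = a + st d2 + st d3 by rewrite addrAC.
rewrite e12 in z2 z2'; rewrite e13 e23 in z3 z3'.
have spC a' b' c' : spread a' b' c' != 0 -> spread a' c' b' != 0.
  by apply: contra => /eqP e; rewrite -oppr_eq0 -e /spread; apply/eqP; ring.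
have adjy : adj y (A (a + st d2 + st d3)).
  apply: (@cube _ _ p01 e0 _ (A (a + st d1 + st d3)) (A (a + st d1 + st d2)) o1 o2 o3) => //; try exact: spC.
  exact: (good_lab I sk sm n23 u2 u3).
split=> //.
have [po1 pe2 pe3 py o1e2 o1e3 ye2 ye3 he ho] := Qy.
have [pe0 po2 po3 pe1 e0o2 e0o3 e1o2 e1o3 ho23 he1] := Q23.
have v2 : out (a + st d2) d3 by rewrite out_st.
have w2 : out (a + st d2) d1 by rewrite out_st.
have s2 : (size1 (a + st d2) < k)%N by rewrite size1_out.
have s2m : (size1 (a + st d2) < m)%N by apply: leq_trans s2 km.
have hf := good_form s2m n31 v2 w2; rewrite e12 in hf.
have o2e3 : adj o2 (A (a + st d1 + st d2)) by rewrite -e12; apply: (inv_adj I).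
split=> //; try exact: adjC.
apply/eqP => h0.
have hl := good_lab I s2 s2m n31 v2 w2; rewrite e12 in hl.
have [c yE] := opposite_rigid p01 po2 pe1 pe3 (adjC e1o2) o2e3 adjy ye3 hf hl h0.
have c0 : c != 0.
  by apply: contraTneq isT => c0; have [_] := py; rewrite yE nrm_sc c0 expr0n mul0r eqxx.
have ly : lab y (A (a + st d1 + st d2)) = lab o2 (A (a + st d1 + st d2)).
  rewrite yE /lab rel_scl OM_sc sqnM sqn_real nrm_sc -[c ^+ 2 * _ * _]mulrA -mulf_div.
  by rewrite divff ?mul1r // sqrf_eq0.
have := good_lab I sk sm n13 u1 u3; rewrite -/e0 -/o1 -/o3 => /eqP; apply.
rewrite (quad_lab p01 Q12) (quad_lab p01 (quad_swap Q13)) labC -ly.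
by rewrite -(quad_lab p01 Qy) labC.
Qed.

(** One face at i is a quadrilateral by definition, turn spreads this to the
    faces sharing a direction with it, and two turns reach any face. *)
Let stepQ k i : inv k -> (k <= m)%N -> size1 i = k.+1 -> ~~ on_axis i ->
  let s c := st (outer i c) in
  let Q c e := quad (A (i - s c - s e)) (A (i - s e)) (A (i - s c)) (A i) in
  (forall c e, c != e -> i 0 c != 0 -> i 0 e != 0 -> Q c e) /\
  (forall c, i 0 c != 0 -> adj (A i) (A (i - s c))).
Proof.
move=> I km si iax s Q.
have Qsw c e : Q c e -> Q e c.
  by move/quad_swap; rewrite /Q [i - s e - s c]addrAC.
have outc c e : c != e -> out (i - s e) (outer i c) = out i (outer i c).
  by move=> h; rewrite /s out_sub.
have osc c : i 0 c != 0 -> out (i - s c) (outer i c) by exact: outer_out.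
have sz c : i 0 c != 0 -> size1 (i - s c) = k.
  by move=> /size1_in; rewrite si => -[].
have osb c e : i 0 c != 0 -> c != e -> out (i - s c - s e) (outer i c).
  by move=> h ce; rewrite out_sub //; apply: osc.
have [v [d1 [d2 [iE n12 u1 u2 yE]]]] := net_flip p g iax.
have Q0 : exists c e, [/\ c != e, i 0 c != 0, i 0 e != 0 & Q c e].
  have n21 : d2.1 != d1.1 by rewrite eq_sym.
  have o1 : outer i d1.1 = d1 by rewrite iE addrAC outer_st // out_st.
  have o2 : outer i d2.1 = d2 by rewrite iE outer_st // out_st.
  have i1 : i 0 d1.1 != 0 by rewrite iE addrAC st_neq0 // out_st.
  have i2 : i 0 d2.1 != 0 by rewrite iE st_neq0 // out_st.
  exists d1.1, d2.1; split=> //.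
  have Ev : i - s d1.1 - s d2.1 = v by rewrite /s o1 o2 iE addrAC addrK addrK.
  have E2 : i - s d2.1 = v + st d1 by rewrite /s o2 iE addrK.
  have E1 : i - s d1.1 = v + st d2 by rewrite /s o1 iE addrAC addrK.
  rewrite /Q Ev E1 E2 yE.
  have sv : (size1 v).+1 = k by rewrite -(size1_out u1) -E2 sz.
  have vk : (size1 v < k)%N by rewrite -sv.
  have vm : (size1 v < m)%N by exact: leq_trans km.
  apply: flipP => //.
  - by apply: (inv_proper I); apply: ltnW.
  - by apply: (inv_proper I); rewrite size1_out.
  - by apply: (inv_proper I); rewrite size1_out.
  - exact: (inv_adj I).
  - exact: (inv_adj I).
  - exact: good_form.
  - exact: (good_lab I).
have turnQ c e f : c != e -> f != c -> f != e -> i 0 c != 0 -> i 0 e != 0 -> i 0 f != 0 ->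
    Q c e -> adj (A i) (A (i - s f)) /\ Q f e.
  move=> ce fc fe ic ie iF /quad_swap Qce.
  have cf : c != f by rewrite eq_sym.
  have ec : e != c by rewrite eq_sym.
  have ef : e != f by rewrite eq_sym.
  pose a := i - s c - s e - s f.
  have E1 : a + s f = i - s c - s e by rewrite subrK.
  have E2 : a + s f + s e = i - s c by rewrite E1 subrK.
  have E3 : a + s f + s c = i - s e by rewrite E1 addrAC subrK.
  have E4 : a + s c = i - s f - s e.
    by rewrite /a addrAC [i - s c - s e]addrAC subrK addrAC.
  have E5 : a + s c + s e = i - s f by rewrite E4 subrK.
  have E6 : a + s f + s c + s e = i by rewrite E3 subrK.
  have oc : out a (outer i c) by rewrite out_sub // osb.
  have oe : out a (outer i e) by rewrite out_sub // addrAC osb.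
  have oF : out a (outer i f) by rewrite /a addrAC out_sub // addrAC out_sub // osc.
  have sa : (size1 a).+2 = k.
    by rewrite -(sz c ic) -E2 size1_out ?size1_out // E1 addrAC osb.
  have := @turn k a (outer i f) (outer i c) (outer i e) I km.
  rewrite -!/(s _) E6 E2 E3 E5 E4 E1 => /(_ _ fc fe ce oF oc oe Qce) [].
    by rewrite sa.
  by move=> h /quad_swap; split.
(* a face at i containing a given direction c *)
have toQ c : i 0 c != 0 -> exists2 e, (c != e) && (i 0 e != 0) & Q c e.
  move=> ic; have [c0 [e0 [ce i1 i2 Qce]]] := Q0.
  have [->|ne] := eqVneq c c0; first by exists e0; rewrite ?ce.
  have [->|ne2] := eqVneq c e0; first by exists c0; [rewrite eq_sym ce|apply: Qsw].
  by exists e0; [rewrite ne2|case: (turnQ c0 e0 c)].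
split=> [c e ce ic ie|c ic].
  have [f /andP[cf iF] Qcf] := toQ _ ic.
  have [->//|ef] := eqVneq e f.
  by apply/Qsw; case: (turnQ f c e) => //; [rewrite eq_sym | rewrite eq_sym | apply: Qsw].
have [f /andP[cf iF] Qcf] := toQ _ ic.
by have [] := Qcf.
Qed.

Lemma inv_good : inv m.+1.
Proof.
suff all k : (k <= m.+1)%N -> inv k by exact: all.
elim: k => [_|k IH km].
  split=> // i; rewrite leqn0 => /eqP /size1_eq0 ->.
  by rewrite net_axis ?on_axis0 //; apply: (ad_proper gd); apply: on_axis0.
have I := IH (ltnW km).
have ax i : size1 i = k.+1 -> on_axis i -> proper (A i).
  by move=> _ h; rewrite net_axis //; apply: (ad_proper gd).
split.
- move=> i; rewrite leq_eqVlt => /orP[/eqP si|]; last by rewrite ltnS; apply: (inv_proper I).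
  case: (boolP (on_axis i)) => [|h]; first exact: ax.
  have [q0 _] := stepQ I km si h.
  have [c [e [ce ic ie]]] := on_axis_ind h.
  by have [] := q0 c e ce ic ie.
- move=> v d; rewrite ltnS leq_eqVlt => /orP[/eqP sv|]; last exact: (inv_adj I).
  move=> o; have si : size1 (v + st d) = k.+1 by rewrite size1_out // sv.
  case: (boolP (on_axis (v + st d))) => h.
    have h' := on_axis_in o h.
    by rewrite !net_axis //; apply: (ad_adj gd).
  have [_ /(_ _ (st_neq0 o))] := stepQ I km si h.
  by rewrite outer_st // addrK => /adjC.
- move=> v d1 d2; rewrite ltnS leq_eqVlt => /orP[/eqP sv|]; last exact: (inv_quad I).
  move=> n12 o1 o2; have n21 : d2.1 != d1.1 by rewrite eq_sym.
  have o1' : out (v + st d2) d1 by rewrite out_st.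
  have o2' : out (v + st d1) d2 by rewrite out_st.
  have si : size1 (v + st d1 + st d2) = k.+1 by rewrite !size1_out // sv.
  have i1 : (v + st d1 + st d2) 0 d1.1 != 0 by rewrite addrAC st_neq0.
  have i2 : (v + st d1 + st d2) 0 d2.1 != 0 by rewrite st_neq0.
  have h : ~~ on_axis (v + st d1 + st d2).
    by apply: contra i2 => h; rewrite (on_axisP h n12 i1) eqxx.
  have [/(_ d1.1 d2.1 n12 i1 i2) + _] := stepQ I km si h.
  have -> : outer (v + st d1 + st d2) d1.1 = d1 by rewrite addrAC outer_st.
  rewrite outer_st //.
  have -> : v + st d1 + st d2 - st d1 - st d2 = v by rewrite addrAC addrK addrK.
  have -> : v + st d1 + st d2 - st d1 = v + st d2 by rewrite addrAC addrK.
  by rewrite addrK.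
Qed.

Lemma outer_quad v d k : (size1 v <= m)%N -> out v d -> k != d.1 -> v 0 k != 0 ->
  let f := outer v k in let u := v - st f in
  [/\ out u f, out u d, v = u + st f, size1 v = (size1 u).+1
    & quad (A u) (A v) (A (u + st d)) (A (v + st d))].
Proof.
move=> sv o kd vk f u; have of_ : out u f by exact: outer_out.
have od : out u d by rewrite out_sub // eq_sym.
have vE : v = u + st f by rewrite subrK.
have su : size1 v = (size1 u).+1 by rewrite {1}vE size1_out.
have Q := @inv_quad _ inv_good u f d; rewrite -vE in Q.
by split=> //; apply: Q => //; rewrite ?ltnS -?su //.
Qed.

(** A neighbour across a face cannot coincide with v because the quadrilateral with the
    inner neighbour of v is not folded. *)
Lemma outer_edge v d : (size1 v <= m)%N -> out v d ->
  exists w c e, [/\ rel (A v) (A (v + st d)) = edge p w c e, c != 0 & e != 0].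
Proof.
move=> sv o; case: (boolP (on_axis (v + st d))) => h.
  have h' := on_axis_in o h.
  rewrite !net_axis //; apply: (edgeP p01); first exact: (ad_adj gd).
    have [n1 _] := ad_proper gd h'; have [n2 _] := ad_proper gd h.
    by rewrite form_rel n1 n2 mulr0 mul0r addr0.
  by move=> e; have := ad_fin gd h' h; rewrite e eqxx.
have [k kd vk] := off_axis_coord h.
have [of_ od vE su Q] := outer_quad sv o kd vk.
have [w1 [w2 [w3 [w4 [c1 [c2 [c3 [c4 [e1 [e2 [e3 [e4]]]]]]]]]]]] := quad_edges p01 Q.
case=> -[_ _ E _] [_ _ c30 _] [_ _ e30 _].
by exists w3, (- c3), e3; rewrite relC E edge_conj oppr_eq0.
Qed.
End One.

Section All.
Variable g : idx -> dq.
Hypothesis gd : axis_data g.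
Hypothesis gg : forall m, good m g.
Local Notation A := (net g).

Let I m : inv g m.+1. Proof. exact: inv_good. Qed.

Lemma net_proper i : proper (A i).
Proof. by apply: (inv_proper (I (size1 i))). Qed.

Lemma net_adj v d : adj (A v) (A (v + st d)).
Proof.
case: (boolP (out v d)) => o; first exact: (inv_adj (I (size1 v))).
have := out_opp o; move=> /(inv_adj (I (size1 (v + st d))) (leqnn _)).
by rewrite st_opp addrK => /adjC.
Qed.

Lemma net_fin v d : x3 (rel (A v) (A (v + st d))) != 0.
Proof.
case: (boolP (out v d)) => o; first exact: (good_fin (@gg (size1 v).+1)).
have := good_fin (@gg (size1 (v + st d)).+1) (leqnn _) (out_opp o).
by rewrite st_opp addrK relC /= oppr_eq0.
Qed.

Lemma net_quad v d1 d2 : d1.1 != d2.1 -> out v d1 -> out v d2 ->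
  quad (A v) (A (v + st d1)) (A (v + st d2)) (A (v + st d1 + st d2)).
Proof. by move=> *; apply: (inv_quad (I (size1 v).+1)). Qed.

(** Every elementary square has a vertex nearest to the origin; according to the
    signs, v and the opposite vertex are the ends of one or the other diagonal. *)
Lemma net_form v d1 d2 : d1.1 != d2.1 -> form (A v) (A (v + st d1 + st d2)) != 0.
Proof.
move=> n12; have n21 : d2.1 != d1.1 by rewrite eq_sym.
case: (boolP (out v d1)) => o1; case: (boolP (out v d2)) => o2.
- by have [] := net_quad n12 o1 o2.
- have o2' := out_opp o2; have o1' : out (v + st d2) d1 by rewrite out_st.
  by have [] := @net_quad (v + st d2) (opp d2) d1 n21 o2' o1'; rewrite st_opp addrK addrAC.
- have o1' := out_opp o1; have o2' : out (v + st d1) d2 by rewrite out_st.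
  by have [] := @net_quad (v + st d1) (opp d1) d2 n12 o1' o2'; rewrite st_opp addrK.
- have h1 : out (v + st d1 + st d2) (opp d1) by rewrite out_st // out_opp.
  have h2 : out (v + st d1 + st d2) (opp d2).
    by rewrite addrAC out_st // out_opp.
  have e : v + st d1 + st d2 - st d1 - st d2 = v by rewrite [X in X - _]addrAC !addrK.
  by have [_ _ _ _ _ _ _ _ _] := @net_quad _ (opp d1) (opp d2) n12 h1 h2; rewrite !st_opp e formC.
Qed.

(** Induction on the distance from the origin: a motion b is not folded, so its
    value at the far vertex of a square is not conjugate to the near one by
    opposite_rigid, and opposite_unique identifies it. *)
Lemma net_unique (b : idx -> dq) :
  (forall i, proper (b i)) -> (forall v d, adj (b v) (b (v + st d))) ->
  (forall v d1 d2, d1.1 != d2.1 -> ~ exists2 k, k != 0 & b (v + st d1 + st d2) = dsc k (b v)) ->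
  (forall i, on_axis i -> exists2 k, k != 0 & b i = dsc k (g i)) ->
  forall i, exists2 k, k != 0 & b i = dsc k (A i).
Proof.
move=> pb ab fb gb i.
suff H m : forall i, (size1 i <= m)%N -> exists2 k, k != 0 & b i = dsc k (A i) by exact: (H (size1 i)).
elim: m {i} => [i|m IH i].
  rewrite leqn0 => /eqP /size1_eq0 ->.
  by rewrite net_axis ?on_axis0 //; apply: gb; apply: on_axis0.
move=> si; case: (boolP (on_axis i)) => h; first by rewrite net_axis //; apply: gb.
have [v [d1 [d2 [iE n12 o1 o2 _]]]] := net_flip p g h.
have s1 : (size1 (v + st d1) <= m)%N.
  by rewrite -ltnS -(@size1_out _ _ d2) ?out_st 1?eq_sym // -iE.
have s2 : (size1 (v + st d2) <= m)%N.
  by rewrite -ltnS -(@size1_out _ _ d1) ?out_st // addrAC -iE.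
have s0 : (size1 v <= m)%N by rewrite (leq_trans _ s1) // size1_out.
have [k0 k00 e0] := IH _ s0; have [k1 k10 e1] := IH _ s1; have [k2 k20 e2] := IH _ s2.
have Q := net_quad n12 o1 o2; rewrite -iE in Q.
have [pa p1 p2 [ny _] a1 a2 y1 y2 hb hy] := Q.
have hl := good_lab (@gg (size1 v).+1) (I (size1 v)) (ltnSn _) (ltnSn _) n12 o1 o2.
have inv_sc k (x y : dq) : k != 0 -> x = dsc k y -> y = dsc k^-1 x.
  by move=> kn ->; rewrite dscA mulVf // dsc1.
have b1 : adj (b i) (A (v + st d1)).
  by rewrite (inv_sc _ _ _ k10 e1); apply: adj_scr; apply: adjC; rewrite iE; apply: ab.
have b2 : adj (b i) (A (v + st d2)).
  by rewrite (inv_sc _ _ _ k20 e2); apply: adj_scr; apply: adjC; rewrite iE addrAC; apply: ab.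
apply: (opposite_unique p01 pa p1 p2 a1 a2 hb hl) => //; first by have [] := pb i.
apply/eqP => h0; have [k bE] := opposite_rigid p01 pa p1 p2 a1 a2 b1 b2 hb hl h0.
apply: (fb v d1 d2 n12); rewrite -iE; exists (k / k0).
  rewrite mulf_neq0 ?invr_neq0 //; apply: contraTneq isT => kz.
  by have [_] := pb i; rewrite bE nrm_sc kz expr0n mul0r eqxx.
by rewrite bE -dscA -(inv_sc _ _ _ k00 e0).
Qed.
End All.
End Inv.

(** * Continuity *)

Section Continuity.
Variables (R : realType) (T : topologicalType).
Local Notation dq := (dq R).
Local Notation C := R[i].
Implicit Types f g : T -> R.

Definition cr (f : T -> R) := continuous f.
Definition cC (z : T -> C) := cr (fun t => complex.Re (z t)) /\ cr (fun t => complex.Im (z t)).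
Definition cmx m n (A : T -> 'M[R]_(m, n)) := forall i j, cr (fun t => A t i j).
Definition cts (u : T -> dq) := forall j : nat, cr (fun t => (coords (u t))`_j).

Lemma cr_cst (k : R) : cr (fun=> k). Proof. by move=> t; apply: cvg_cst. Qed.
Lemma cr_add f g : cr f -> cr g -> cr (fun t => f t + g t).
Proof. by move=> hf hg t; apply: cvgD; [apply: hf|apply: hg]. Qed.
Lemma cr_mul f g : cr f -> cr g -> cr (fun t => f t * g t).
Proof. by move=> hf hg t; apply: cvgM; [apply: hf|apply: hg]. Qed.
Lemma cr_opp f : cr f -> cr (fun t => - f t).
Proof. by move=> hf t; apply: cvgN; apply: hf. Qed.
Lemma cr_exp f k : cr f -> cr (fun t => f t ^+ k).
Proof.
move=> hf; elim: k => [|k IH]; first exact: cr_cst.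
by under eq_fun do rewrite exprS; apply: cr_mul.
Qed.

Lemma cr_if (b : bool) f k : cr f -> cr (fun t => if b then f t else k).
Proof. by case: b => // _; apply: cr_cst. Qed.

Lemma cr_sum I (r : seq I) (P : pred I) (F : I -> T -> R) :
  (forall i, cr (F i)) -> cr (fun t => \sum_(i <- r | P i) F i t).
Proof.
move=> h; elim: r => [|i r IH].
  by under eq_fun do rewrite big_nil; apply: cr_cst.
under eq_fun do rewrite big_cons.
by case: (P i) => //; apply: cr_add.
Qed.

Lemma cr_prod I (r : seq I) (P : pred I) (F : I -> T -> R) :
  (forall i, cr (F i)) -> cr (fun t => \prod_(i <- r | P i) F i t).
Proof.
move=> h; elim: r => [|i r IH].
  by under eq_fun do rewrite big_nil; apply: cr_cst.
under eq_fun do rewrite big_cons.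
by case: (P i) => //; apply: cr_mul.
Qed.

Ltac crs := lazymatch goal with
  | |- cr (fun t => @?f t + @?g t) => apply: (@cr_add f g); crs
  | |- cr (fun t => - @?f t) => apply: (@cr_opp f); crs
  | |- cr (fun t => @?f t * @?g t) => apply: (@cr_mul f g); crs
  | |- cr (fun t => @?f t ^+ _) => apply: (@cr_exp f); crs
  | |- cr (fun=> ?k) => exact: cr_cst
  | |- _ => assumption
  end.

Lemma cr_det n (A : T -> 'M[R]_n) : cmx A -> cr (fun t => \det (A t)).
Proof.
move=> hA; apply: cr_sum => s; apply: cr_mul; first exact: cr_cst.
by apply: cr_prod => i.
Qed.

Lemma cmx_adj n (A : T -> 'M[R]_n) : cmx A -> cmx (fun t => \adj (A t)).
Proof.
move=> hA i j; under eq_fun do rewrite mxE.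
apply: cr_mul; first exact: cr_cst.
by apply: cr_det => k l; under eq_fun do rewrite !mxE; apply: hA.
Qed.

Section WithP.
Variable p : R.

Lemma cts_DQ f0 f1 f2 f3 f4 f5 f6 f7 : cr f0 -> cr f1 -> cr f2 -> cr f3 ->
  cr f4 -> cr f5 -> cr f6 -> cr f7 ->
  cts (fun t => DQ (f0 t) (f1 t) (f2 t) (f3 t) (f4 t) (f5 t) (f6 t) (f7 t)).
Proof. by move=> *; case=> [|[|[|[|[|[|[|[|j]]]]]]]] //=; under eq_fun do rewrite nth_nil; apply: cr_cst. Qed.

Lemma cts_cst (a : dq) : cts (fun=> a). Proof. by move=> j; apply: cr_cst. Qed.

Section Ops.
Variables u v : T -> dq.
Hypotheses (cu : cts u) (cv : cts v).
Let u0 : cr (fun t => x0 (u t)) := @cu 0%N.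
Let u1 : cr (fun t => x1 (u t)) := @cu 1%N.
Let u2 : cr (fun t => x2 (u t)) := @cu 2%N.
Let u3 : cr (fun t => x3 (u t)) := @cu 3%N.
Let u4 : cr (fun t => x4 (u t)) := @cu 4%N.
Let u5 : cr (fun t => x5 (u t)) := @cu 5%N.
Let u6 : cr (fun t => x6 (u t)) := @cu 6%N.
Let u7 : cr (fun t => x7 (u t)) := @cu 7%N.
Let v0 : cr (fun t => x0 (v t)) := @cv 0%N.
Let v1 : cr (fun t => x1 (v t)) := @cv 1%N.
Let v2 : cr (fun t => x2 (v t)) := @cv 2%N.
Let v3 : cr (fun t => x3 (v t)) := @cv 3%N.
Let v4 : cr (fun t => x4 (v t)) := @cv 4%N.
Let v5 : cr (fun t => x5 (v t)) := @cv 5%N.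
Let v6 : cr (fun t => x6 (v t)) := @cv 6%N.
Let v7 : cr (fun t => x7 (v t)) := @cv 7%N.

Lemma cts_add : cts (fun t => dadd (u t) (v t)).
Proof. by rewrite /dadd; apply: cts_DQ; crs. Qed.
Lemma cts_sc f : cr f -> cts (fun t => dsc (f t) (u t)).
Proof. by rewrite /dsc => ?; apply: cts_DQ; crs. Qed.
Lemma cts_conj : cts (fun t => dconj (u t)).
Proof. by rewrite /dconj; apply: cts_DQ; crs. Qed.
Lemma cts_sig : cts (fun t => dsig (u t)).
Proof. by rewrite /dsig; apply: cts_DQ; crs. Qed.
Lemma cr_form : cr (fun t => form p (u t) (v t)).
Proof. by rewrite /form; crs. Qed.
Lemma cr_nrm : cr (fun t => nrm p (u t)).
Proof. by rewrite /nrm; crs. Qed.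
Lemma cts_mul : cts (fun t => dmul p (u t) (v t)).
Proof.
have E : (fun t => dmul p (u t) (v t)) = fun t => dmul p
   (DQ (x0 (u t)) (x1 (u t)) (x2 (u t)) (x3 (u t)) (x4 (u t)) (x5 (u t)) (x6 (u t)) (x7 (u t)))
   (DQ (x0 (v t)) (x1 (v t)) (x2 (v t)) (x3 (v t)) (x4 (v t)) (x5 (v t)) (x6 (v t)) (x7 (v t))).
  by apply/funext => t; case: (u t) => *; case: (v t).
by rewrite E /=; apply: cts_DQ; crs.
Qed.
Lemma cC_OM : cC (fun t => OM p (u t)).
Proof. by split; rewrite /OM /=; crs. Qed.
Lemma cC_hM : cC (fun t => hM p (u t)).
Proof. by split; rewrite /hM /=; crs. Qed.
End Ops.

Lemma cts_rel u v : cts u -> cts v -> cts (fun t => rel p (u t) (v t)).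
Proof. by move=> cu cv; apply: cts_mul => //; apply: cts_conj. Qed.

Lemma cC_mul z w : cC z -> cC w -> cC (fun t => z t * w t).
Proof.
move=> [z1 z2] [w1 w2].
have -> : (fun t => z t * w t) = fun t => Complex
   (complex.Re (z t) * complex.Re (w t) - complex.Im (z t) * complex.Im (w t))
   (complex.Re (z t) * complex.Im (w t) + complex.Im (z t) * complex.Re (w t)).
  by apply/funext => t; case: (z t) => *; case: (w t).
by split=> /=; crs.
Qed.

Lemma cts_edge (w : T -> R) z y : cr w -> cC z -> cC y -> cts (fun t => edge p (w t) (z t) (y t)).
Proof.
move=> cw [z1 z2] [y1 y2].
have -> : (fun t => edge p (w t) (z t) (y t)) = fun t => edge p (w t)
   (Complex (complex.Re (z t)) (complex.Im (z t))) (Complex (complex.Re (y t)) (complex.Im (y t))).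
  by apply/funext => t; case: (z t) => *; case: (y t).
by rewrite /edge /=; apply: cts_add; apply: cts_DQ; crs.
Qed.

Lemma cC_sub z w : cC z -> cC w -> cC (fun t => z t - w t).
Proof.
move=> [z1 z2] [w1 w2].
have -> : (fun t => z t - w t) = fun t => Complex
   (complex.Re (z t) - complex.Re (w t)) (complex.Im (z t) - complex.Im (w t)).
  by apply/funext => t; case: (z t) => *; case: (w t).
by split=> /=; crs.
Qed.

Lemma cr_sqn z : cC z -> cr (fun t => sqn (z t)).
Proof. by move=> [z1 z2]; rewrite /sqn; crs. Qed.

Lemma cC_spread u v w : cts u -> cts v -> cts w -> cC (fun t => spread p (u t) (v t) (w t)).
Proof.
move=> cu cv cw; rewrite /spread; apply: cC_sub; apply: cC_mul; do ?[apply: cC_OM|apply: cC_hM]; exact: cts_rel.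
Qed.

Lemma cr_labdiff u v w : cts u -> cts v -> cts w -> cr (fun t => labdiff p (u t) (v t) (w t)).
Proof.
move=> cu cv cw; rewrite /labdiff.
have h x y : cts x -> cts y -> cr (fun t => sqn (OM p (rel p (x t) (y t)))).
  by move=> cx cy; apply: cr_sqn; apply: cC_OM; apply: cts_rel.
apply: cr_add; first exact: (cr_mul (cr_nrm cv) (h _ _ cu cw)).
exact: (cr_opp (cr_mul (cr_nrm cw) (h _ _ cu cv))).
Qed.

Lemma cts_flip u v w : cts u -> cts v -> cts w -> cts (fun t => flip p (u t) (v t) (w t)).
Proof.
move=> cu cv cw; rewrite /flip.
have cA : cmx (fun t => flip_mx p (u t) (v t) (w t)).
  move=> j i; under eq_fun do rewrite mxE.
  set x := of_row _; have cx : cts (fun=> x) by exact: cts_cst.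
  have c1 := cts_rel cv cx; have c2 := cts_rel cw cx.
  case: i => [[|[|[|[|[|[|[|[|k]]]]]]]] hk] //=.
  - exact: (c1 4%N).
  - by apply: cr_add; [exact: (c1 5%N)|apply: cr_opp; apply: cr_mul; [exact: cr_cst|exact: (c1 1%N)]].
  - by apply: cr_add; [exact: (c1 6%N)|apply: cr_mul; [exact: cr_cst|exact: (c1 2%N)]].
  - exact: (c2 4%N).
  - by apply: cr_add; [exact: (c2 5%N)|apply: cr_opp; apply: cr_mul; [exact: cr_cst|exact: (c2 1%N)]].
  - by apply: cr_add; [exact: (c2 6%N)|apply: cr_mul; [exact: cr_cst|exact: (c2 2%N)]].
  - exact: cr_form.
  - rewrite /dot; apply: cr_sum => l; apply: cr_mul; last exact: cr_cst.
    by under eq_fun do rewrite mxE; apply: cu.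
have cx : cts (fun t => of_row (row (inord 6) (\adj (flip_mx p (u t) (v t) (w t))))).
  rewrite /of_row; have h k : cr (fun t => row (inord 6) (\adj (flip_mx p (u t) (v t) (w t))) 0 k).
    by under eq_fun do rewrite mxE; apply: (cmx_adj cA).
  by apply: cts_DQ; exact: h.
apply: cts_add; apply: cts_sc => //.
  by apply: cr_mul; [exact: cr_cst|exact: cr_det].
by apply: cr_opp; exact: cr_form.
Qed.

Section NetC.
Variables (n : nat) (G : T -> 'rV[int]_n -> dq).
Hypothesis cG : forall i, cts (fun t => G t i).

(** The net depends continuously on the axis values, because flip is polynomial. *)
Lemma cts_net i : cts (fun t => net p (G t) i).
Proof.
rewrite /net; move: (size1 i) => m; elim: m i => [|m IH] i; first exact: cG.
rewrite /=; case: (corner i) => [kl|]; last exact: cG.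
by apply: cts_flip; apply: IH.
Qed.

Lemma cr_cval c : cr (fun t => cval p (G t) c).
Proof.
case: c => [[v [[d0 d1] d2]] [k hk]].
case: k hk => [|[|[|[|k]]]] hk /=; apply: cr_if.
- by move: (cts_rel (@cts_net v) (@cts_net (v + st d1))) => /(_ 3%N).
- exact: (cr_form (@cts_net _) (@cts_net _)).
- exact: (cr_labdiff (@cts_net _) (@cts_net _) (@cts_net _)).
- exact: (cr_sqn (cC_spread (@cts_net _) (@cts_net _) (@cts_net _))).
- exact: (cr_sqn (cC_spread (cts_sig (@cts_net _)) (cts_sig (@cts_net _)) (cts_sig (@cts_net _)))).
Qed.
End NetC.
End WithP.
End Continuity.

(** * Density of the genericity conditions *)

Section Density.
Variables (R : realType) (n : nat) (p : R).
Local Notation q := (1 - p).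
Local Notation idx := 'rV[int]_n.
Local Notation dir := (dir n).
Local Notation dq := (dq R).
Local Open Scope complex_scope.
Local Notation rel := (rel p).
Local Notation form := (form p).
Local Notation nrm := (nrm p).
Local Notation adj := (adj p).
Local Notation inL := (inL p).
Local Notation dmul := (dmul p).
Local Notation edge := (edge p).
Local Notation OM := (OM p).
Local Notation hM := (hM p).
Local Notation proper := (proper p).
Local Notation lab := (lab p).
Local Notation labdiff := (labdiff p).
Local Notation quad := (quad p).
Local Notation flip := (flip p).
Local Notation spread := (spread p).
Local Notation net := (net p).
Local Notation axis_data := (axis_data p).
Local Notation good := (good p).
Local Notation cval := (cval p).

Lemma near_neq0 (f : R -> R) : cr f -> f 0 != 0 -> \forall h \near (0 : R), f h != 0.
Proof. by move=> hf h0; exact: (cvgr_neq0 (f 0) (hf 0) h0). Qed.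

Lemma dnear_lin (a b : R) : (a != 0) || (b != 0) -> \forall h \near (0 : R)^', a + h * b != 0.
Proof.
have [->|a0] := eqVneq a 0 => /= b0.
  near=> h; rewrite add0r mulf_neq0 //.
  near: h; exact: nbhs_dnbhs_neq.
apply: cvg_within; apply: near_neq0; last by rewrite mul0r addr0.
by apply: cr_add; [exact: cr_cst|apply: cr_mul; [move=> t; exact: cvg_id|exact: cr_cst]].
Unshelve. all: by end_near. Qed.

Definition curve (G : R -> idx -> dq) := forall i, cts (fun h => G h i).
(** Openness tested along curves.  It holds for the preimages of open sets of axis
    values as well as for the genericity conditions, and it is all that the
    perturbation arguments need, since every perturbation is a curve. *)
Definition copen (W : set (idx -> dq)) :=
  forall G, curve G -> W (G 0) -> \forall h \near (0 : R), W (G h).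

Lemma copenI W W' : copen W -> copen W' -> copen (W `&` W').
Proof. by move=> hW hW' G cG [w w']; apply: (@filterI _ _ (nbhs_filter (0 : R))); [apply: hW|apply: hW']. Qed.

Lemma copen_cval c : copen [set g | cval g c != 0].
Proof. by move=> G cG /= h; apply: near_neq0 => //; apply: cr_cval. Qed.

Lemma copen_seq (s : seq (cond n)) : copen [set g | forall c, c \in s -> cval g c != 0].
Proof.
elim: s => [|c s IH].
  by move=> G _ _; apply: (@nearW _ _ _ (nbhs_filter (0 : R))) => h c; rewrite in_nil.
have -> : [set g | forall c', c' \in c :: s -> cval g c' != 0] =
    [set g | cval g c != 0] `&` [set g | forall c', c' \in s -> cval g c' != 0].
  apply/seteqP; split=> g /=.
    by move=> h; split=> [|c' cs]; apply: h; rewrite in_cons ?eqxx ?cs ?orbT.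
  by move=> [h1 h2] c'; rewrite in_cons => /orP[/eqP ->|/h2].
by apply: copenI => //; apply: copen_cval.
Qed.

(** The lattice points of a cube are enumerated by finite functions, so that the
    conditions below a given level form a finite list. *)
Definition box_point (m : nat) (x : {ffun 'I_n -> 'I_(m.*2.+1)}) : idx :=
  \row_k ((x k : nat)%:Z - m%:Z).

Definition conds_below m : seq (cond n) :=
  [seq (box_point x.1.1, x.1.2, x.2)
     | x <- enum {: {ffun 'I_n -> 'I_(m.*2.+1)} * (dir * dir * dir) * 'I_5}
     & (size1 (box_point x.1.1) < m)%N].

Lemma mem_conds_below m (v : idx) ds k : (size1 v < m)%N = ((v, ds, k) \in conds_below m).
Proof.
apply/idP/mapP => [sv|[[[x ds'] k']]]; last first.
  by rewrite mem_filter /= => /andP[h _] [-> _ _].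
have hk i : (absz (v 0%R i) < m)%N.
  by apply: leq_ltn_trans sv; rewrite /size1 (bigD1 i) //= leq_addr.
have E : @box_point m [ffun i => inord (absz (v 0 i + m%:Z))] = v :> idx.
  apply/rowP => i; rewrite mxE ffunE; have := hk i; move: (v 0 i) => z hz.
  by rewrite inordK; lia.
exists ([ffun i => inord (absz (v 0 i + m%:Z))] : {ffun 'I_n -> 'I_(m.*2.+1)}, ds, k); last by rewrite /= E.
by rewrite mem_filter mem_enum inE andbT /= E.
Qed.

Lemma good_below m g : good m g <-> forall c, c \in conds_below m -> cval g c != 0.
Proof.
split=> [h [[v ds] k]|h v ds k sv]; first by rewrite -mem_conds_below => /h.
by apply: h; rewrite -mem_conds_below.
Qed.

Lemma copen_good m : copen [set g | good m g].
Proof.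
move=> G cG /good_below h; have := copen_seq cG h; apply: (@filterS _ _ (nbhs_filter (0 : R))) => t ht.
exact/good_below.
Qed.

Hypothesis p01 : 0 < p < 1.

(** The half-space cut off by the facet between v and v + st d; moving the edge at
    v in direction d affects the net only there. *)
Definition beyond (v : idx) (d : dir) (i : idx) : bool :=
  if d.2 then v 0 d.1 < i 0 d.1 else i 0 d.1 < v 0 d.1.

Lemma beyond_self v d : ~~ beyond v d v.
Proof. by rewrite /beyond ltxx; case: d.2. Qed.

Lemma beyond_side v d e : d.1 != e.1 -> ~~ beyond v d (v + st e).
Proof. by move=> h; rewrite /beyond mxE stE (negbTE h) addr0 ltxx; case: d.2. Qed.

Lemma beyond_st v d : beyond v d (v + st d).
Proof. by rewrite /beyond mxE stE eqxx; case: d.2; move: (v 0 d.1) => z; lia. Qed.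

Lemma net_beyond g g' v d : out v d -> (forall i, ~~ beyond v d i -> on_axis i -> g i = g' i) ->
  forall i, ~~ beyond v d i -> net g i = net g' i.
Proof.
move=> o h; apply: (@net_local _ _ _ (fun i => ~~ beyond v d i)) => // i k.
rewrite /beyond !mxE stE; move: o; rewrite /out /outer /=.
have [->|] := eqVneq d.1 k => [|_]; last by rewrite subr0.
by case: d.2; case: ifP => /=; move: (v 0 k) (i 0 k) => y z; lia.
Qed.

Lemma beyond_step (v i : idx) d f : out v d -> on_axis (v + st d) -> on_axis (i + st f) ->
  ~~ beyond v d i -> beyond v d (i + st f) -> i = v /\ f = d.
Proof.
move=> o h hf; rewrite /beyond mxE stE.
case: eqVneq => [e1|]; last by rewrite addr0 => _ /negbTE ->.
move=> b1 b2.
have [e2 ev] : f.2 = d.2 /\ i 0 d.1 = v 0 d.1.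
  move: b1 b2 o; rewrite /out; clear; move: (v 0 _) (i 0 _) => y z.
  by case: d.2; case: f.2 => /=; lia.
have fd : f = d by rewrite [f]surjective_pairing [RHS]surjective_pairing e2 e1.
split=> //; apply/rowP => k; have [->//|kd] := eqVneq k d.1.
rewrite (on_axis_tail o h kd); apply: (on_axis_tail (v := i) (d := d)) => //.
  by move: o; rewrite /out ev.
by rewrite -fd.
Qed.

(** A curve of axis values through g whose nets contain the prescribed curve e at
    v + st d and are unchanged outside the half-space beyond v. *)
Definition lifted g m v d (e : R -> dq) (G : R -> idx -> dq) :=
  [/\ curve G, G 0 = g, forall h i, ~~ beyond v d i -> net (G h) i = net g i &
    \forall h \near (0 : R), [/\ axis_data (G h), good m (G h)
      & exists2 k, k != 0 & net (G h) (v + st d) = dsc k (e h)]].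

Lemma mul_conj_null_r a b : form a a = 0 -> dmul (dmul b (dconj a)) a = dsc (nrm a) b.
Proof.
move=> na; rewrite -{2}[a]dconjK -(nrm_conj p a); apply: mul_conj_null.
by rewrite form_conj.
Qed.

Lemma mul_conj_null_l a b : form a a = 0 -> dmul (dconj a) (dmul a b) = dsc (nrm a) b.
Proof.
move=> na; rewrite -[X in dmul _ (dmul X b)]dconjK -(nrm_conj p a); apply: mul_null_conj.
by rewrite form_conj.
Qed.

Lemma form_dsc k a : form (dsc k a) (dsc k a) = k ^+ 2 * form a a.
Proof. by rewrite /form /=; ring. Qed.

(** All axis values beyond v are displaced from the left by the motion that takes
    the old value at v + st d to e h.  Relative positions are invariant under left
    multiplication, so only the edge starting at v changes. *)
Lemma lift_curve_axis g m v d e : axis_data g -> good m g -> out v d -> on_axis (v + st d) ->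
  cts e -> e 0 = g (v + st d) ->
  (\forall h \near (0 : R), proper (e h) /\ adj (g v) (e h)) ->
  exists G, lifted g m v d e G.
Proof.
move=> gd gm o h ce e0 he; have h' := on_axis_in o h.
set a := g (v + st d) in e0; have [na a0] : proper a by exact: (ad_proper gd).
pose X t := dmul (e t) (dconj a).
pose G t i := if on_axis i && beyond v d i then dsc (nrm a)^-1 (dmul (X t) (g i)) else g i.
have cX : cts X by apply: cts_mul => //; apply: cts_cst.
have Ga t : G t (v + st d) = e t.
  by rewrite /G h beyond_st /= /X mul_conj_null_r // dscA mulVf // dsc1.
have cG : curve G.
  move=> i; rewrite /G; case: (on_axis i && beyond v d i); last exact: cts_cst.
  by apply: cts_sc; [apply: cts_mul => //; apply: cts_cst | exact: cr_cst].
have G0 : G 0 = g.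
  apply/funext => i; rewrite /G; case: ifP => // _.
  by rewrite /X e0 -dmulA mul_null_conj // dscA mulVf // dsc1.
have Gl t i : ~~ beyond v d i -> net (G t) i = net g i.
  apply: net_beyond => // j jb _; by rewrite /G (negbTE jb) andbF.
exists G; split=> //.
have hx : \forall t \near (0 : R), x3 (rel (g v) (e t)) != 0.
  apply: near_neq0; last by rewrite e0; apply: (ad_fin gd).
  have H : cts (fun t => rel (g v) (e t)) by apply: cts_rel => //; apply: cts_cst.
  exact: (H 3%N).
have hg := copen_good cG (eq_ind_r (good m) gm G0 : [set g | good m g] (G 0)).
near=> t.
have [[ne en0] ae] : proper (e t) /\ adj (g v) (e t) by near: t.
have x0 : x3 (rel (g v) (e t)) != 0 by near: t.
have nX : form (X t) (X t) = 0.
  by rewrite /X form_mul form_conj na mulr0 add0r ne mul0r.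
have X0 : nrm (X t) != 0 by rewrite nrmM nrm_conj mulf_neq0.
have iv0 : (nrm a)^-1 != 0 by rewrite invr_eq0.
have relX b c : rel (dmul (X t) b) (dmul (X t) c) = dsc (nrm (X t)) (rel b c).
  by rewrite /rel dconjM -dmulA mul_conj_null_l // dscaler.
have step i f : on_axis i -> on_axis (i + st f) ->
    adj (G t i) (G t (i + st f)) /\ x3 (rel (G t i) (G t (i + st f))) != 0.
  move=> hi hf.
  have A1 := ad_adj gd hi hf; have A2 := ad_fin gd hi hf.
  case: (boolP (beyond v d i)) => b1; case: (boolP (beyond v d (i + st f))) => b2.
  - have Gb j : on_axis j -> beyond v d j -> G t j = dsc (nrm a)^-1 (dmul (X t) (g j)).
      by move=> hj bj; rewrite /G hj bj.
    rewrite !Gb //; split.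
      by apply: adj_scl; apply: adj_scr; rewrite /adj relX; apply: inL_sc.
    by rewrite rel_scl rel_scr relX /= !mulf_neq0.
  - have hb : on_axis (i + st f + st (opp f)) by rewrite st_opp addrK.
    have bb : beyond v d (i + st f + st (opp f)) by rewrite st_opp addrK.
    have [iv fd] := beyond_step o h hb b2 bb.
    have iE : i = v + st d by rewrite -fd -iv st_opp addrK.
    rewrite iv iE Ga /G (negbTE (beyond_self v d)) andbF; split; first exact: adjC.
    by rewrite relC /= oppr_eq0.
  - have [-> ->] := beyond_step o h hf b1 b2.
    by rewrite Ga /G (negbTE (beyond_self v d)) andbF.
  - by rewrite /G (negbTE b1) (negbTE b2) !andbF.
split.
- split=> [i hi|i f hi hf|i f hi hf]; [|by have [] := step i f hi hf|by have [] := step i f hi hf].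
  rewrite /G hi; have [ni i0] := ad_proper gd hi; case: ifP => _ //.
  split; last by rewrite nrm_sc nrmM !mulf_neq0 // sqrf_eq0.
  by rewrite form_dsc form_mul ni nX mulr0 mul0r addr0 mulr0.
- by near: t.
- by exists 1; [exact: oner_neq0 | rewrite net_axis // Ga dsc1].
Unshelve. all: by end_near. Qed.

Lemma nrm_dsc_neq0 k a : nrm (dsc k a) != 0 -> k != 0.
Proof. by rewrite nrm_sc mulf_eq0 negb_or sqrf_eq0 => /andP[]. Qed.

(** Completing the quadrilateral at v backwards transports the curve e at v + st d
    to a curve e' at u + st d for an inner neighbour u of v.  Repeating this
    reaches an axis, where lift_curve_axis applies.  Going back, the vertices
    v + st d of the perturbed nets are the positions e h because both are
    opposite to u in a quadrilateral with the same three other vertices. *)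
Lemma lift_curve g m v d e : axis_data g -> good m g -> (size1 v <= m)%N -> out v d ->
  cts e -> e 0 = net g (v + st d) ->
  (\forall h \near (0 : R), proper (e h) /\ adj (net g v) (e h)) ->
  exists G, lifted g m v d e G.
Proof.
move=> gd gm vm; have [s] := ubnP (size1 v); elim: s v d e vm => // s IH v d e vm vs o ce e0 he.
case: (boolP (on_axis (v + st d))) => h.
  have h' := on_axis_in o h.
  by apply: lift_curve_axis => //; rewrite ?e0 ?net_axis // -(net_axis p g h').
have [k kd vk] := off_axis_coord h.
have [of_ od vE su Q] := outer_quad p01 gd gm vm o kd vk.
set f := outer v k in of_ vE su Q; set u := v - st f in of_ od vE su Q.
have fd : f.1 != d.1 by [].
have um : (size1 u < m)%N by rewrite -su.
have us : (size1 u < s)%N by rewrite -ltnS -su.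
have Iu := inv_good p01 gd gm.
have [pu pv pud pvd uv uud vdv vdud hq hd] := Q.
have hlu : lab (net g u) (net g v) != lab (net g u) (net g (u + st d)).
  by have := good_lab p01 gm Iu (ltnW um : (size1 u < m.+1)%N) um fd of_ od; rewrite -vE.
have hlv : lab (net g v) (net g u) != lab (net g v) (net g (v + st d)).
  by rewrite [X in _ != X]labC -(quad_lab p01 (quad_swap Q)) labC.
pose o' t := flip (net g v) (net g u) (e t).
have co : cts o' by apply: cts_flip => //; apply: cts_cst.
have flipq t : proper (e t) -> adj (net g v) (e t) -> form (net g u) (e t) != 0 ->
    labdiff (net g v) (net g u) (e t) != 0 ->
    quad (net g v) (net g u) (e t) (o' t) /\ lab (net g v) (net g u) != lab (net g v) (e t).
  move=> pe ae fe le; have le' := le; rewrite labdiff_lab // in le'; last exact: adjC.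
  by split=> //; apply: flipP => //; exact: adjC.
have Qt : \forall t \near (0 : R), quad (net g v) (net g u) (e t) (o' t) /\
    lab (net g v) (net g u) != lab (net g v) (e t).
  have h1 : \forall t \near (0 : R), form (net g u) (e t) != 0.
    by apply: near_neq0; rewrite ?e0 //; apply: cr_form => //; apply: cts_cst.
  have h2 : \forall t \near (0 : R), labdiff (net g v) (net g u) (e t) != 0.
    apply: near_neq0; first by apply: cr_labdiff => //; apply: cts_cst.
    by rewrite e0 labdiff_lab //; exact: adjC.
  near=> t; have [pe ae] : proper (e t) /\ adj (net g v) (e t) by near: t.
  by apply: flipq => //; near: t.
have [Q0 _] : quad (net g v) (net g u) (e 0) (o' 0) /\
    lab (net g v) (net g u) != lab (net g v) (e 0).
  exact: nbhs_singleton Qt.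
have [l l0 lE] : exists2 l, l != 0 & net g (u + st d) = dsc l (o' 0).
  rewrite e0 in Q0; have [_ _ _ [no _] _ _ oau oav _ ho] := Q0.
  have [[nud _] [nvd _]] := (pud, pvd).
  by apply: (opposite_unique p01 pv pu pvd (adjC uv) (adjC vdv) hd hlv) => //;
    do ?[exact: adjC]; rewrite formC.
(* rescaled such that e' passes through the net itself at 0 *)
pose e' t := dsc l (o' t).
have ce' : cts e' by apply: cts_sc => //; apply: cr_cst.
have he' : \forall t \near (0 : R), proper (e' t) /\ adj (net g u) (e' t).
  near=> t; have [Qe _] : quad (net g v) (net g u) (e t) (o' t) /\
    lab (net g v) (net g u) != lab (net g v) (e t) by near: t.
  have [_ _ _ [no on] _ _ oau _ _ _] := Qe.
  split; last by apply: adj_scr; apply: adjC.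
  split; last by rewrite nrm_sc mulf_neq0 // sqrf_eq0.
  by rewrite form_dsc no mulr0.
have [G [cG G0 Gl GN]] := IH u d e' (ltnW um) us od ce' (esym lE) he'.
have vu j : beyond u d j = beyond v d j.
  by rewrite /beyond /u mxE [X in _ + X]mxE stE (negbTE (_ : d.1 != f.1)) ?subr0 // eq_sym.
exists G; split=> //.
  by move=> t i; rewrite -vu; apply: Gl.
near=> t.
have [Qe le] : quad (net g v) (net g u) (e t) (o' t) /\
    lab (net g v) (net g u) != lab (net g v) (e t) by near: t.
have [gd' gm' [k0 k00 kE]] : [/\ axis_data (G t), good m (G t)
      & exists2 k, k != 0 & net (G t) (u + st d) = dsc k (e' t)] by near: t.
split=> //.
have Gu : net (G t) u = net g u by apply: Gl; apply: beyond_self.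
have Gv : net (G t) v = net g v by apply: Gl; rewrite vu; apply: beyond_self.
have [_ _ _ _ Q'] := outer_quad p01 gd' gm' vm o kd vk.
rewrite -/f -/u Gu Gv kE in Q'.
have [_ _ _ [nvdt _] _ _ vdvt vdot _ hdt] := Q'.
have [_ _ [ne ne0] po _ ve ou oe ue vo] := Qe.
have kl0 : k0 * l != 0 by rewrite mulf_neq0.
have sc_adj x y c : c != 0 -> adj x (dsc c y) -> adj x y.
  by move=> c0 /(adj_scr c^-1); rewrite dscA mulVf // dsc1.
have vdo : adj (net (G t) (v + st d)) (o' t).
  by apply: (sc_adj _ _ _ kl0); rewrite -dscA.
have hlo : lab (net g u) (net g v) != lab (net g u) (o' t).
  by rewrite labC [X in _ != X]labC -(quad_lab p01 (quad_swap Qe)).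
exact: (opposite_unique p01 pu pv po uv (adjC ou) vo hlo (adjC ve) (adjC oe) vdvt vdo ne nvdt ue hdt).
Unshelve. all: by end_near. Qed.

Lemma rel_mul_l a r : form a a = 0 -> rel a (dmul a r) = dsc (nrm a) r.
Proof. exact: mul_conj_null_l. Qed.

(** The parameter r is the new relative displacement along the edge from v in direction d. *)
Definition perturbed g m v d (W : set (idx -> dq)) (r : dq) g' :=
  [/\ axis_data g' /\ good m g', W g', forall i, ~~ beyond v d i -> net g' i = net g i
    & exists2 k, k != 0 & net g' (v + st d) = dsc k (dmul (net g v) r)].

(** A curve of edges at v through the actual one gives axis values close to g with
    a prescribed generic property P of the curve parameter. *)
Lemma perturb g m v d r W (P : R -> Prop) : axis_data g -> good m g -> (size1 v <= m)%N -> out v d ->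
  cts r -> r 0 = rel (net g v) (net g (v + st d)) ->
  (forall h, inL (r h) /\ form (r h) (r h) = 0) -> copen W -> W g ->
  (\forall h \near (0 : R)^', P h) ->
  exists g' h, perturbed g m v d W (r h) g' /\ P h.
Proof.
move=> gd gm vm o cr_ r0 rL oW Wg nP.
have I := inv_good p01 gd gm.
have [na a0] := inv_proper I (leqW vm); set a := net g v in na a0 r0.
have [ny y0] : proper (net g (v + st d)) by apply: (inv_proper I); rewrite size1_out.
pose e h := dsc (nrm a)^-1 (dmul a (r h)).
have ce : cts e.
  by apply: cts_sc; [apply: cts_mul => //; apply: cts_cst | exact: cr_cst].
have e0 : e 0 = net g (v + st d) by rewrite /e r0 mul_null_conj // dscA mulVf // dsc1.
have he : \forall h \near (0 : R), proper (e h) /\ adj a (e h).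
  have ne : cr (fun h => nrm (e h)) by apply: cr_nrm.
  have : \forall h \near (0 : R), nrm (e h) != 0 by move: (near_neq0 ne); rewrite e0; apply.
  apply: (@filterS _ _ (nbhs_filter (0 : R))) => h h0; have [rh1 rh2] := rL h; split.
    by split=> //; rewrite form_dsc form_mul rh2 na !mulr0 mul0r addr0 mulr0.
  by apply: adj_scr; rewrite /adj rel_mul_l //; apply: inL_sc.
have [G [cG G0 Gl GN]] := lift_curve gd gm vm o ce e0 he.
have GW : \forall h \near (0 : R), W (G h) by apply: oW => //; rewrite G0.
have [h [[[gd' gm' [k k0 kE]] Wh] Ph]] : exists h, ([/\ axis_data (G h), good m (G h)
      & exists2 k, k != 0 & net (G h) (v + st d) = dsc k (e h)] /\ W (G h)) /\ P h.
  have H := @filterI _ _ (nbhs_filter (0 : R)) _ _ GN GW.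
  have H' : \forall h \near (0 : R)^', ([/\ axis_data (G h), good m (G h)
      & exists2 k, k != 0 & net (G h) (v + st d) = dsc k (e h)] /\ W (G h)).
    by move: H; apply: cvg_within.
  exact: (filter_ex (@filterI _ _ (dnbhs_filter (0 : R)) _ _ H' nP)).
exists (G h), h; split=> //; split=> //; first by move=> i; apply: Gl.
by exists (k * (nrm a)^-1); rewrite ?mulf_neq0 ?invr_eq0 // kE dscA.
Qed.

Definition fixed (m : nat) (W : set (idx -> dq)) c :=
  exists g', [/\ axis_data g', good m g', W g' & cval g' c != 0].

Lemma cC_lin (c c' : R[i]) : cC (fun h : R => Complex
  (complex.Re c + h * complex.Re c') (complex.Im c + h * complex.Im c')).
Proof.
split=> /=; apply: cr_add; try exact: cr_cst; apply: cr_mul; try exact: cr_cst;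
  move=> t; exact: cvg_id.
Qed.

(** Moving b in the direction of a changes the spread by a multiple of
    OM (rel u a) * hM (rel u c), as hM (rel u a) vanishes. *)
Lemma spread_shift u a b c nu k h : hM (rel u a) = 0 -> OM (rel u a) != 0 ->
  hM (rel u c) != 0 -> spread u b c = 0 -> k != 0 -> h != 0 ->
  spread u (dsc k (dadd (dsc nu b) (dsc h a))) c != 0.
Proof.
move=> h0 o0 c0 s0 k0 hn.
have -> : spread u (dsc k (dadd (dsc nu b) (dsc h a))) c =
    k%:C * (nu%:C * spread u b c - h%:C * (OM (rel u a) * hM (rel u c))).
  rewrite /spread rel_scr rel_addr !rel_scr hM_sc OM_sc hM_add OM_add !hM_sc !OM_sc h0.
  by move: (OM (rel u a)) (OM (rel u b)) (OM (rel u c)) (hM (rel u b)) (hM (rel u c)) => *; ring.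
rewrite s0 mulr0 sub0r mulrN oppr_eq0.
apply: mulf_neq0; first by rewrite realC_eq0.
by apply: mulf_neq0; [rewrite realC_eq0 | apply: mulf_neq0].
Qed.

Lemma edge_shift w h c e : edge (w + h) c e = dadd (edge w c e) (scal h).
Proof. by case: c => *; case: e => *; congr DQ; rewrite /=; ring. Qed.

Lemma dmul_scal a h : dmul a (scal h) = dsc h a.
Proof. by case: a => *; congr DQ; rewrite /=; ring. Qed.

Lemma sig_add (a b : dq) : dsig (dadd a b) = dadd (dsig a) (dsig b).
Proof. by congr DQ; rewrite /=; ring. Qed.

Lemma sig_sc k (a : dq) : dsig (dsc k a) = dsc k (dsig a).
Proof. by congr DQ; rewrite /=; ring. Qed.

Section Fix.
Variables (g : idx -> dq) (m : nat) (W : set (idx -> dq)) (v : idx) (d0 d1 d2 : dir).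
Hypotheses (gd : axis_data g) (gm : good m g) (vm : (size1 v <= m)%N) (oW : copen W) (Wg : W g).
Let I := inv_good p01 gd gm.
Let pv : proper (net g v). Proof. exact: (inv_proper I (leqW vm)). Qed.

(** Both edge parameters are shifted along the real axis. *)
Lemma fix_finite (k : 'I_5) : val k = 0%N -> fixed m W (v, (d0, d1, d2), k).
Proof.
move=> k0; case: (boolP (out v d1)) => o; last first.
  by exists g; split=> //; rewrite /= k0 (negbTE o) oner_neq0.
have [w [c [e [E c0 e0]]]] := outer_edge p01 gd gm vm o.
pose lin (c : R[i]) (h : R) : R[i] := Complex (complex.Re c + h * 1) (complex.Im c + h * 0).
have cl c' : cC (lin c') := cC_lin c' 1.
have lin0 c' : lin c' 0 = c' by case: c' => x y; rewrite /lin /= !mul0r !addr0.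
have [] := @perturb g m v d1 (fun h => edge w (lin c h) (lin e h)) W
  (fun h => complex.Re c + h * 1 != 0 /\ complex.Re e + h * 1 != 0) gd gm vm o.
- by apply: cts_edge => //; apply: cr_cst.
- by rewrite !lin0.
- by move=> h; split; [exact: inL_edge | exact: null_edge].
- exact: oW.
- exact: Wg.
- by apply: filterI; apply: dnear_lin; rewrite oner_neq0 orbT.
move=> g' [h [[[gd' gm'] Wg' gl [k' k'0 kE]] [h1 h2]]]; exists g'; split=> //.
rewrite /= k0 o kE gl ?beyond_self // rel_scr rel_mul_l; last by case: pv.
have [_ a0] := pv.
have -> x (y : dq) : x3 (dsc x y) = x * x3 y by [].
have -> x (y : dq) : x3 (dsc x y) = x * x3 y by [].
have -> : x3 (edge w (lin c h) (lin e h)) = 2%:R * ((complex.Re c + h * 1) * (complex.Re e + h * 1)).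
  by rewrite /= add0r.
by rewrite !mulf_neq0 ?pnatr_eq0.
Qed.

Lemma form_mul_l a r b : form (dmul a r) b = x4 (rel r (rel a b)).
Proof. by rewrite -rel_form /rel dconjM dmulA. Qed.

Lemma form_scl k a b : form (dsc k a) b = k * form a b.
Proof. by rewrite /form /=; ring. Qed.

(** The Study form of two edges is cdet c c2 * cdet e e2 up to a constant; c and e
    are moved transversally to c2 and e2. *)
Lemma fix_form (k : 'I_5) : val k = 1%N -> fixed m W (v, (d0, d1, d2), k).
Proof.
move=> k1; case: (boolP [&& d1.1 != d2.1, out v d1 & out v d2]) => [t|nt]; last first.
  by exists g; split=> //; rewrite /= k1 (negbTE nt) oner_neq0.
have /and3P[n12 o1 o2] := t.
have [w [c [e [E c0 e0]]]] := outer_edge p01 gd gm vm o1.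
have [w2 [c2 [e2 [E2 c20 e20]]]] := outer_edge p01 gd gm vm o2.
pose rot (c : R[i]) : R[i] := Complex (complex.Im c) (- complex.Re c).
pose lin (c c' : R[i]) (h : R) : R[i] :=
  Complex (complex.Re c + h * complex.Re c') (complex.Im c + h * complex.Im c').
have cl c' c'' : cC (lin c' c'') by exact: cC_lin.
have lin0 c' c'' : lin c' c'' 0 = c' by case: c' => x y; rewrite /lin /= !mul0r !addr0.
have det_lin c' c'' h : cdet (lin c' (rot c'') h) c'' = cdet c' c'' + h * sqn c''.
  by rewrite /cdet /sqn /=; ring.
have [] := @perturb g m v d1 (fun h => edge w (lin c (rot c2) h) (lin e (rot e2) h)) W
  (fun h => cdet c c2 + h * sqn c2 != 0 /\ cdet e e2 + h * sqn e2 != 0) gd gm vm o1.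
- by apply: cts_edge => //; apply: cr_cst.
- by rewrite !lin0.
- by move=> h; split; [exact: inL_edge | exact: null_edge].
- exact: oW.
- exact: Wg.
- by apply: filterI; apply: dnear_lin; rewrite sqn_neq0 ?c20 ?e20 orbT.
move=> g' [h [[[gd' gm'] Wg' gl [k' k'0 kE]] [h1 h2]]]; exists g'; split=> //.
rewrite /= k1 t kE gl; last exact: beyond_side.
rewrite form_scl form_mul_l E2 form_edges !det_lin.
case/andP: p01 => p0 p1.
have q0 : q != 0 by rewrite subr_eq0 gt_eqF.
have p_neq0 : p != 0 by rewrite gt_eqF.
by rewrite !mulf_neq0 ?pnatr_eq0.
Qed.

(** Changing the scalar part w of an edge changes its angle of rotation and keeps
    its axis. *)
Lemma perturb_scalar (P : R -> R -> Prop) : out v d1 ->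
  (forall w, \forall h \near (0 : R)^', P w h) ->
  exists w c e h g', [/\ rel (net g v) (net g (v + st d1)) = edge w c e,
    perturbed g m v d1 W (edge (w + h) c e) g' & P w h].
Proof.
move=> o nP; have [w [c [e [E c0 e0]]]] := outer_edge p01 gd gm vm o.
have cc (z : R[i]) : cC (fun _ : R => z) by split; apply: cr_cst.
have cw : cts (fun h => edge (w + h) c e).
  apply: cts_edge; try exact: cc.
  by apply: cr_add; [exact: cr_cst | move=> t; exact: cvg_id].
have [|h|g' [h [g'P Ph]]] := @perturb g m v d1 _ W (P w) gd gm vm o cw _ _ oW Wg (nP w).
- by rewrite addr0.
- by split; [exact: inL_edge | exact: null_edge].
by exists w, c, e, h, g'.
Qed.

Lemma dnear_id : \forall h \near (0 : R)^', h != 0.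
Proof. exact: nbhs_dnbhs_neq. Qed.

(** OM does not see the scalar part of an edge, while nrm is quadratic in it. *)
Lemma fix_labdiff (k : 'I_5) : val k = 2%N -> fixed m W (v, (d0, d1, d2), k).
Proof.
move=> k2; case: (boolP [&& d1.1 != d2.1, out v d1 & out v d2]) => [t|nt]; last first.
  by exists g; split=> //; rewrite /= k2 (negbTE nt) oner_neq0.
have /and3P[n12 o1 o2] := t.
have [l0|l0] := eqVneq (labdiff (net g v) (net g (v + st d1)) (net g (v + st d2))) 0; last first.
  by exists g; split=> //; rewrite /= k2 t.
have [w2 [c2 [e2 [E2 c20 e20]]]] := outer_edge p01 gd gm vm o2.
have [|w [c [e [h [g' [E [[gd' gm'] Wg' gl [k' k'0 kE]] [h1 h2]]]]]]] :=
    perturb_scalar (P := fun w h => h != 0 /\ 2%:R * w + h * 1 != 0) o1.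
  by move=> w; apply: filterI; [exact: dnear_id | apply: dnear_lin; rewrite oner_neq0 orbT].
exists g'; split=> //; rewrite /= k2 t kE !gl ?beyond_self //; last exact: beyond_side.
have [na a0] := pv.
have S2 : sqn (OM (rel (net g v) (net g (v + st d2)))) != 0.
  by rewrite E2 sqn_OM_edge !mulf_neq0 ?sqn_neq0 ?pnatr_eq0.
move: l0; rewrite /labdiff rel_scr rel_mul_l // E !OM_sc !sqnM !sqn_real nrm_sc nrmM.
have := nrm_rel p (net g v) (net g (v + st d1)); rewrite E.
have -> : OM (edge (w + h) c e) = OM (edge w c e) by rewrite !OM_edge.
have -> : nrm (edge (w + h) c e) = nrm (edge w c e) + h * (2%:R * w + h * 1).
  by case: (c) => *; case: (e) => *; rewrite /nrm /=; ring.
move: S2 a0; set S := sqn (OM (rel _ _)); set T := sqn (OM (edge w c e)); set N := nrm (edge w c e).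
move: S T N (nrm (net g v)) (nrm (net g (v + st d1))) (nrm (net g (v + st d2))).
move=> S T N n0 n1 n2 S0 n00 -> l0.
have -> : k' ^+ 2 * (n0 * (n0 * n1 + h * (2%:R * w + h * 1))) * S - n2 * (k' ^+ 2 * (n0 ^+ 2 * T)) =
    k' ^+ 2 * n0 * (h * (2%:R * w + h * 1)) * S + k' ^+ 2 * n0 ^+ 2 * (n1 * S - n2 * T) by ring.
by rewrite l0 mulr0 addr0 !mulf_neq0.
Qed.

Let three := [&& [&& d1.1 != d2.1, out v d1 & out v d2], d0.1 != d1.1, d0.1 != d2.1 & out (v - st d0) d0].

(** The map sg is the identity for the first and dsig for the second axis. *)
Lemma fix_spread (sg : dq -> dq) (k : 'I_5) :
  (forall a b, sg (dadd a b) = dadd (sg a) (sg b)) -> (forall c a, sg (dsc c a) = dsc c (sg a)) ->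
  (forall a b1 b2 d, quad a b1 b2 d -> quad (sg a) (sg b1) (sg b2) (sg d)) ->
  (forall h, cval h (v, (d0, d1, d2), k) = if three then
     sqn (spread (sg (net h (v - st d0))) (sg (net h (v + st d1))) (sg (net h (v + st d2)))) else 1) ->
  fixed m W (v, (d0, d1, d2), k).
Proof.
move=> sD sZ sQ ck; case: (boolP three) => [t|nt]; last first.
  by exists g; split=> //; rewrite ck (negbTE nt) oner_neq0.
have /and4P[/and3P[n12 o1 o2] n01 n02 o0] := t; set u := v - st d0 in o0.
have Q : quad (sg (net g u)) (sg (net g v)) (sg (net g (u + st d2))) (sg (net g (v + st d2))).
  apply: sQ; have := @inv_quad _ _ _ _ _ I u d0 d2; rewrite subrK; apply=> //.
    by rewrite ltnS -(size1_out o0) subrK.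
  by rewrite out_sub // eq_sym.
have [l0|l0] := eqVneq (spread (sg (net g u)) (sg (net g (v + st d1))) (sg (net g (v + st d2)))) 0; last first.
  by exists g; split=> //; rewrite ck t sqn_neq0.
have [|w [c [e [h [g' [E [[gd' gm'] Wg' gl [k' k'0 kE]] h0]]]]]] :=
    perturb_scalar (P := fun _ h => h != 0) o1.
  by move=> _; exact: dnear_id.
have bu : ~~ beyond v d1 u by rewrite /u -st_opp; apply: beyond_side; rewrite eq_sym.
exists g'; split=> //; rewrite ck t sqn_neq0 kE !gl //; last exact: beyond_side.
have [na a0] := pv; rewrite edge_shift dmulDr dmul_scal -E mul_null_conj // sZ sD !sZ.
have [_ _ _ _ uv _ _ _ _ uc] := Q.
apply: spread_shift => //; first by rewrite (adj_hM p01 uv).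
  exact: (quad_o_neq0 p01 Q).
exact: form_h.
Qed.

Lemma fix_cond c : (size1 c.1.1 <= m)%N -> c.1.1 = v -> c.1.2 = (d0, d1, d2) -> fixed m W c.
Proof.
case: c => [[v' ds] k] /= _ -> ->; case: k => [[|[|[|[|[|k]]]]] hk] //.
- exact: fix_finite.
- exact: fix_form.
- exact: fix_labdiff.
- exact: (@fix_spread id).
- by apply: (@fix_spread (@dsig R)) => //; [exact: sig_add | exact: sig_sc | exact: quad_sig].
Qed.
End Fix.

(** The conditions are repaired one after the other; those repaired earlier persist
    under small perturbations and are added to W. *)
Lemma fix_seq m (s : seq (cond n)) : (forall c, c \in s -> (size1 c.1.1 <= m)%N) ->
  forall g W, axis_data g -> good m g -> copen W -> W g ->
  exists g', [/\ axis_data g', good m g', W g' & forall c, c \in s -> cval g' c != 0].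
Proof.
elim: s => [|c s IH] hs g W gd gm oW Wg; first by exists g; split.
have [|g1 [gd1 gm1 W1 s1]] := IH _ g W gd gm oW Wg.
  by move=> c' cs; apply: hs; rewrite in_cons cs orbT.
have hc : (size1 c.1.1 <= m)%N by apply: hs; rewrite mem_head.
pose W' := W `&` [set g | forall c, c \in s -> cval g c != 0].
have oW' : copen W' by apply: copenI => //; apply: copen_seq.
case E : c.1.2 => [[d0 d1] d2].
have [g2 [gd2 gm2 [W2 s2] c2]] := @fix_cond g1 m W' c.1.1 d0 d1 d2 gd1 gm1 hc oW' (conj W1 s1) c hc erefl E.
exists g2; split=> // c'; rewrite in_cons => /orP[/eqP ->//|]; exact: s2.
Qed.

Lemma good_dense m g W : axis_data g -> copen W -> W g ->
  exists g', [/\ axis_data g', good m g' & W g'].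
Proof.
move=> gd oW Wg; elim: m => [|m [g1 [gd1 gm1 W1]]]; first by exists g; split.
have [|g2 [gd2 gm2 W2 s2]] := @fix_seq m (conds_below m.+1) _ g1 W gd1 gm1 oW W1.
  by move=> [[v ds] k]; rewrite -mem_conds_below ltnS.
by exists g2; split=> //; apply/good_below.
Qed.
End Density.

(** * Quaternions and moved points *)

Section QuaternionAlgebra.
Variable R : realType.
Local Notation quat := (quaternion R).
Implicit Types a b c : quat.

Lemma quatP a b : a 0 0 = b 0 0 -> a 0 1 = b 0 1 -> a 0 2 = b 0 2 -> a 0 3 = b 0 3 -> a = b.
Proof.
move=> h0 h1 h2 h3; apply/rowP => -[[|[|[|[|k]]]] hk] //.
- by rewrite (_ : Ordinal hk = 0) //; apply/val_inj.
- by rewrite (_ : Ordinal hk = 1) //; apply/val_inj.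
- by rewrite (_ : Ordinal hk = 2) //; apply/val_inj.
- by rewrite (_ : Ordinal hk = 3) //; apply/val_inj.
Qed.

Lemma qmul0E a b : (qmul a b) 0 0 = a 0 0 * b 0 0 - a 0 1 * b 0 1 - a 0 2 * b 0 2 - a 0 3 * b 0 3.
Proof. by rewrite mxE. Qed.
Lemma qmul1E a b : (qmul a b) 0 1 = a 0 0 * b 0 1 + a 0 1 * b 0 0 + a 0 2 * b 0 3 - a 0 3 * b 0 2.
Proof. by rewrite mxE. Qed.
Lemma qmul2E a b : (qmul a b) 0 2 = a 0 0 * b 0 2 - a 0 1 * b 0 3 + a 0 2 * b 0 0 + a 0 3 * b 0 1.
Proof. by rewrite mxE. Qed.
Lemma qmul3E a b : (qmul a b) 0 3 = a 0 0 * b 0 3 + a 0 1 * b 0 2 - a 0 2 * b 0 1 + a 0 3 * b 0 0.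
Proof. by rewrite mxE. Qed.
Definition qmulE := (qmul0E, qmul1E, qmul2E, qmul3E).

Lemma qconjE a : ((qconj a) 0 0 = a 0 0) * ((qconj a) 0 1 = - a 0 1) *
  ((qconj a) 0 2 = - a 0 2) * ((qconj a) 0 3 = - a 0 3).
Proof. by do ![split]; rewrite mxE. Qed.

Lemma qoneE : ((qone R) 0 0 = 1) * ((qone R) 0 1 = 0) * ((qone R) 0 2 = 0) * ((qone R) 0 3 = 0).
Proof. by do ![split]; rewrite mxE. Qed.

Definition qnorm a := \sum_k a 0 k ^+ 2.
Lemma qnormE a : qnorm a = a 0 0 ^+ 2 + a 0 1 ^+ 2 + a 0 2 ^+ 2 + a 0 3 ^+ 2.
Proof.
rewrite /qnorm !big_ord_recl big_ord0 addr0 !addrA.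
by do ![congr (_ + _)]; congr (a _ _ ^+ 2); apply/val_inj.
Qed.

Lemma addqE a b k : (a + b) 0 k = a 0 k + b 0 k. Proof. by rewrite mxE. Qed.
Lemma oppqE a k : (- a) 0 k = - a 0 k. Proof. by rewrite mxE. Qed.
Lemma scaleqE (t : R) a k : (t *: a) 0 k = t * a 0 k. Proof. by rewrite mxE. Qed.

Ltac qring := apply: quatP; rewrite !(qmulE, qconjE, qoneE, addqE, oppqE, scaleqE); ring.

Lemma qmulA a b c : qmul a (qmul b c) = qmul (qmul a b) c. Proof. by qring. Qed.
Lemma qmulDl a b c : qmul (a + b) c = qmul a c + qmul b c. Proof. by qring. Qed.
Lemma qmulDr a b c : qmul a (b + c) = qmul a b + qmul a c. Proof. by qring. Qed.
Lemma qmulZl (t : R) a b : qmul (t *: a) b = t *: qmul a b. Proof. by qring. Qed.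
Lemma qmulZr (t : R) a b : qmul a (t *: b) = t *: qmul a b. Proof. by qring. Qed.
Lemma qmulNl a b : qmul (- a) b = - qmul a b. Proof. by qring. Qed.
Lemma qmulNr a b : qmul a (- b) = - qmul a b. Proof. by qring. Qed.
Lemma qmul1l a : qmul (qone R) a = a. Proof. by qring. Qed.
Lemma qmul1r a : qmul a (qone R) = a. Proof. by qring. Qed.
Lemma qconjM a b : qconj (qmul a b) = qmul (qconj b) (qconj a). Proof. by qring. Qed.
Lemma qconjK a : qconj (qconj a) = a. Proof. by qring. Qed.
Lemma qmul_conj a : qmul a (qconj a) = qnorm a *: qone R.
Proof. by rewrite qnormE; qring. Qed.
Lemma qconj_mul a : qmul (qconj a) a = qnorm a *: qone R.
Proof. by rewrite qnormE; qring. Qed.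
Lemma qnormM a b : qnorm (qmul a b) = qnorm a * qnorm b.
Proof. by rewrite !qnormE !qmulE; ring. Qed.
Lemma qnorm_conj a : qnorm (qconj a) = qnorm a.
Proof. by rewrite !qnormE !qconjE; ring. Qed.

Lemma qnorm_neq0 a : (qnorm a != 0) = (a != 0).
Proof.
congr (~~ _); apply/eqP/eqP => [|->]; last by rewrite qnormE !mxE; ring.
move=> /eqP; rewrite psumr_eq0 => [/allP h|i _]; last exact: sqr_ge0.
by apply/rowP => k; have := h k; rewrite mem_index_enum mxE sqrf_eq0 => /(_ isT) /eqP.
Qed.

Lemma qvecE (x : 'rV[R]_3) : ((qvec x) 0 0 = 0) * ((qvec x) 0 1 = x 0 0) *
  ((qvec x) 0 2 = x 0 1) * ((qvec x) 0 3 = x 0 2).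
Proof.
have l : (qvec x) 0 0 = 0.
  transitivity ((0 : 'rV[R]_1) 0 0); last by rewrite mxE.
  by rewrite -(row_mxEl (0 : 'rV[R]_1) x 0 0) /qvec; congr (_ _ _); apply/val_inj.
have r (k : 'I_3) (j : 'I_4) : val j = k.+1 -> (qvec x) 0 j = x 0 k.
  move=> jk; rewrite -(row_mxEr (0 : 'rV[R]_1) x 0 k) /qvec.
  by congr (_ _ _); apply/val_inj.
by do ![split] => //; apply: r.
Qed.

Lemma vector_partE a : ((vector_part a) 0 0 = a 0 1) * ((vector_part a) 0 1 = a 0 2) *
  ((vector_part a) 0 2 = a 0 3).
Proof.
by do ![split]; rewrite /vector_part !mxE; congr (a _ _); apply/val_inj.
Qed.

Lemma vector_partK a : a 0 0 = 0 -> qvec (vector_part a) = a.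
Proof. by move=> h; apply: quatP; rewrite !qvecE ?vector_partE. Qed.

Lemma vec3P (x y : 'rV[R]_3) : x 0 0 = y 0 0 -> x 0 1 = y 0 1 -> x 0 2 = y 0 2 -> x = y.
Proof.
move=> h0 h1 h2; apply/rowP => -[[|[|[|k]]] hk] //.
- by rewrite (_ : Ordinal hk = 0) //; apply/val_inj.
- by rewrite (_ : Ordinal hk = 1) //; apply/val_inj.
- by rewrite (_ : Ordinal hk = 2) //; apply/val_inj.
Qed.

Lemma qvecK x : vector_part (qvec x) = x :> 'rV[R]_3.
Proof. by apply: vec3P; rewrite !vector_partE !qvecE. Qed.

Lemma qvecD (x y : 'rV[R]_3) : qvec (x + y) = qvec x + qvec y.
Proof. by apply: quatP; rewrite !(addqE, qvecE) ?mxE ?addr0. Qed.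
Lemma qvecZ t (x : 'rV[R]_3) : qvec (t *: x) = t *: qvec x.
Proof. by apply: quatP; rewrite !(scaleqE, qvecE) ?mxE ?mulr0. Qed.
Lemma vector_partD a b : vector_part (a + b) = vector_part a + vector_part b.
Proof. by rewrite /vector_part linearD. Qed.
Lemma vector_partZ t a : vector_part (t *: a) = t *: vector_part a.
Proof. by rewrite /vector_part linearZ. Qed.

End QuaternionAlgebra.

Section Moves.
Variable R : realType.
Local Notation quat := (quaternion R).
Local Notation dquat := (dual_quaternion R).
Implicit Types a b : dquat.

Lemma primal_row (x y : quat) : primal_part (row_mx x y) = x.
Proof. exact: row_mxKl. Qed.
Lemma dual_row (x y : quat) : dual_part (row_mx x y) = y.
Proof. exact: row_mxKr. Qed.
Lemma dquatK a : row_mx (primal_part a) (dual_part a) = a.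
Proof. exact: hsubmxK. Qed.

Lemma study_formE a b : study_form a b =
  let: (x, x', y, y') := (primal_part a, dual_part a, primal_part b, dual_part b) in
  (qmul (qconj x) y' + qmul (qconj x') y) 0 0.
Proof.
rewrite /study_form addqE !qmulE !qconjE !big_ord_recl big_ord0.
have e1 : lift ord0 ord0 = 1 :> 'I_4 by apply/val_inj.
have e2 : lift ord0 (lift ord0 ord0) = 2 :> 'I_4 by apply/val_inj.
have e3 : lift ord0 (lift ord0 (lift ord0 ord0)) = 3 :> 'I_4 by apply/val_inj.
by rewrite e1 e2 e3; ring.
Qed.

(** The image of x under a, in closed form: A x A^-1 - 2 A' A^-1 for a = A + eps A'. *)
Definition moved a (x : 'rV[R]_3) : quat :=
  (qnorm (primal_part a))^-1 *: (qmul (qmul (primal_part a) (qvec x)) (qconj (primal_part a))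
   - 2%:R *: qmul (dual_part a) (qconj (primal_part a))).

Lemma move_pointE a x : primal_part a != 0 -> move_point a x = vector_part (moved a x).
Proof.
rewrite -qnorm_neq0 => n0; rewrite /move_point /moved; congr vector_part.
rewrite /dqmul /eps_conj /dqinv !primal_row !dual_row /qinv -/(qnorm (primal_part a)).
move: (primal_part a) (dual_part a) n0 => u v n0.
rewrite !(qmulZl, qmulZr, qmul1r, qmulNl, qmulNr, qmulDl) !qmulA qmul_conj !qmulZl qmul1l.
rewrite !scalerA -mulrA mulVf // mulr1.
by apply: quatP; rewrite !(addqE, oppqE, scaleqE); ring.
Qed.

(** The scalar part of A' A^-1 is the Study form of a with itself. *)
Lemma moved_pure a x : in_study a -> (moved a x) 0 0 = 0.
Proof.
rewrite /in_study study_formE /moved; move: (primal_part a) (dual_part a) => u v h.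
rewrite !(scaleqE, addqE, oppqE, qmulE, qconjE, qvecE); move: h.
rewrite !(addqE, qmulE, qconjE) => h.
move: (qnorm u)^-1 => k; rewrite -[RHS](mulr0 (- k)) -[X in _ = _ * X]h; ring.
Qed.

(** Multiplying by the conjugate of a from the left and by b from the right clears
    the denominators and leaves an expression in the relative displacement. *)
Lemma moved_eq a b x : in_study a -> in_study b -> primal_part a != 0 -> primal_part b != 0 ->
  let r := qmul (qconj (primal_part a)) (primal_part b) in
  let s := qmul (qconj (primal_part a)) (dual_part b) + qmul (qconj (dual_part a)) (primal_part b) in
  moved a x = moved b x <-> qmul r (qvec x) - qmul (qvec x) r = 2%:R *: s.
Proof.
rewrite -!qnorm_neq0 /in_study !study_formE /moved.
move: (primal_part a) (dual_part a) (primal_part b) (dual_part b) (qvec x) => u u' v v' X su sv nu nv.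
set r := qmul (qconj u) v.
have E1 : qmul (qmul (qconj u) ((qnorm u)^-1 *: (qmul (qmul u X) (qconj u) - 2%:R *: qmul u' (qconj u)))) v
    = qmul X r + 2%:R *: qmul (qconj u') v.
  have hu : qmul (qconj u) u' = - qmul (qconj u') u.
    have e : qmul (qconj u') u = qconj (qmul (qconj u) u') by rewrite qconjM qconjK.
    rewrite e; apply: quatP; rewrite !(oppqE, qconjE) ?opprK //.
    by move: su; rewrite addqE e qconjE; lra.
  rewrite qmulZr qmulZl qmulDr qmulDl qmulNr qmulNl qmulZr qmulZl !qmulA.
  rewrite qconj_mul !qmulZl qmul1l hu !qmulNl -!qmulA (qmulA u) qmul_conj qmulZl qmul1l qmulZr.
  rewrite /r; apply: quatP; rewrite !(addqE, oppqE, scaleqE); field; exact: nu.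
have E2 : qmul (qmul (qconj u) ((qnorm v)^-1 *: (qmul (qmul v X) (qconj v) - 2%:R *: qmul v' (qconj v)))) v
    = qmul r X - 2%:R *: qmul (qconj u) v'.
  rewrite qmulZr qmulZl qmulDr qmulDl qmulNr qmulNl qmulZr qmulZl -!qmulA.
  rewrite qconj_mul !qmulZr !qmul1r !qmulA.
  rewrite /r; apply: quatP; rewrite !(addqE, oppqE, scaleqE); field; exact: nv.
have fin (y z w t : quat) : y + 2%:R *: z = w - 2%:R *: t <-> w - y = 2%:R *: (t + z).
  rewrite scalerDr; split=> h.
    by rewrite -[w](subrK (2%:R *: t)) -h; apply: quatP; rewrite !(addqE, oppqE, scaleqE); ring.
  by rewrite -[w](subrK y) h; apply: quatP; rewrite !(addqE, oppqE, scaleqE); ring.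
split=> [h|h].
  by apply/fin; rewrite -E1 -E2 h.
move/fin: h; rewrite -E1 -E2 => h.
move: h; set p := _^-1 *: _; set q := _^-1 *: _ => h.
have K (z : quat) : (qnorm u * qnorm v)^-1 *: qmul (qmul u (qmul (qmul (qconj u) z) v)) (qconj v) = z.
  rewrite !qmulA -[qmul (qmul (qmul _ _) v) _]qmulA !qmul_conj qmulZr qmul1r !qmulZl qmul1l.
  by apply: quatP; rewrite !scaleqE; field; rewrite nu nv.
by rewrite -[p]K h K.
Qed.
End Moves.

(** * Coordinates adapted to two lines *)

Section Contacts.
Variable R : realType.
Local Notation quat := (quaternion R).
Local Notation dquat := (dual_quaternion R).
Implicit Types a b : dquat.

Definition spin a (v : 'rV[R]_3) : quat :=
  (qnorm (primal_part a))^-1 *: qmul (qmul (primal_part a) (qvec v)) (qconj (primal_part a)).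

Lemma moved_affine a x t v : moved a (x + t *: v) = moved a x + t *: spin a v.
Proof.
rewrite /moved /spin qvecD qvecZ qmulDr qmulDl qmulZr qmulZl.
by apply: quatP; rewrite !(addqE, oppqE, scaleqE); ring.
Qed.

Lemma spin_pure a v : (spin a v) 0 0 = 0.
Proof. by rewrite /spin !(scaleqE, qmulE, qconjE, qvecE); ring. Qed.

Lemma qnorm_spin a v : primal_part a != 0 -> qnorm (spin a v) = qnorm (qvec v).
Proof.
rewrite -qnorm_neq0 => n0; rewrite /spin.
have -> k x : qnorm (k *: x) = k ^+ 2 * qnorm x :> R by rewrite !qnormE !scaleqE; ring.
by rewrite !qnormM qnorm_conj; field.
Qed.

Lemma sum3 (f : 'I_3 -> R) : \sum_k f k = f 0 + f 1 + f 2.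
Proof.
rewrite !big_ord_recl big_ord0 addr0 addrA.
by congr (_ + f _ + f _); apply/val_inj.
Qed.

Lemma move_contactE a (c : contact_element R) : primal_part a != 0 ->
  move_contact a c = (vector_part (moved a c.1), vector_part (spin a c.2)).
Proof.
move=> a0; rewrite /move_contact !move_pointE //; congr (_, _).
rewrite -{1}[c.2]scale1r moved_affine scale1r vector_partD addrAC subrr add0r //.
Qed.

Lemma move_is_contact a (c : contact_element R) : displacement a -> is_contact c ->
  is_contact (move_contact a c).
Proof.
move=> [sa a0]; rewrite /is_contact move_contactE // !sum3 /= !vector_partE.
have := qnorm_spin c.2 a0; rewrite !qnormE spin_pure !qvecE expr0n /= !add0r => -> //.
Qed.

Lemma spin_inj a v w : primal_part a != 0 -> spin a v = spin a w -> v = w.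
Proof.
move=> a0 h; have n0 : qnorm (primal_part a) != 0 by rewrite qnorm_neq0.
have K (z : 'rV[R]_3) : (qnorm (primal_part a))^-1 *:
    qmul (qmul (qconj (primal_part a)) (spin a z)) (primal_part a) = qvec z.
  rewrite /spin qmulZr qmulZl !qmulA -[qmul (qmul _ (qconj _)) (primal_part a)]qmulA.
  rewrite !qconj_mul qmulZr qmul1r qmulZl qmul1l.
  by apply: quatP; rewrite !scaleqE; field.
by rewrite -[v]qvecK -[w]qvecK -!K h.
Qed.

(** A common tangent sphere is centred at a point of the axis that both
    displacements move to the same place. *)
Lemma tangent_meet a b (c : contact_element R) : displacement a -> displacement b ->
  common_tangent_sphere (move_contact a c) (move_contact b c) <->
  exists t, moved a (c.1 + t *: c.2) = moved b (c.1 + t *: c.2).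
Proof.
move=> [sa a0] [sb b0]; rewrite !move_contactE // /common_tangent_sphere /=.
split=> -[t h]; exists t; last by rewrite -!vector_partZ -!vector_partD -!moved_affine h.
have := h; rewrite -!vector_partZ -!vector_partD -!moved_affine => e.
by rewrite -[LHS]vector_partK ?moved_pure // e vector_partK ?moved_pure.
Qed.

Lemma line_in_studyP a b : in_study a -> in_study b -> line_in_study a b <-> study_form a b = 0.
Proof.
move=> sa sb.
have E s t : study_form (s *: a + t *: b) (s *: a + t *: b) =
    s ^+ 2 * study_form a a + 2%:R * s * t * study_form a b + t ^+ 2 * study_form b b.
  rewrite /study_form !mulr_sumr -!big_split; apply: eq_bigr => i _ /=.
  by rewrite /primal_part /dual_part !linearD !linearZ !mxE /=; ring.
split=> [h|h s t]; last by rewrite /in_study E sa sb h; ring.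
have := h 1 1; rewrite /in_study E sa sb; lra.
Qed.
End Contacts.

Section Coordinates.
Variable R : realType.
Local Notation quat := (quaternion R).
Local Notation dquat := (dual_quaternion R).
Local Notation vec := 'rV[R]_3.

Definition dot3 (x y : vec) : R := x 0 0 * y 0 0 + x 0 1 * y 0 1 + x 0 2 * y 0 2.
Definition crs3 (x y : vec) : vec := \row_k
  [:: x 0 1 * y 0 2 - x 0 2 * y 0 1; x 0 2 * y 0 0 - x 0 0 * y 0 2; x 0 0 * y 0 1 - x 0 1 * y 0 0]`_k.
Lemma crs3E x y : ((crs3 x y) 0 0 = x 0 1 * y 0 2 - x 0 2 * y 0 1) *
  ((crs3 x y) 0 1 = x 0 2 * y 0 0 - x 0 0 * y 0 2) * ((crs3 x y) 0 2 = x 0 0 * y 0 1 - x 0 1 * y 0 0).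
Proof. by do ![split]; rewrite mxE. Qed.

Variables (I J o : vec) (tau p : R).
Local Notation q := (1 - p).
Hypotheses (p01 : 0 < p < 1) (t0 : tau != 0).
Hypotheses (II : dot3 I I = p) (JJ : dot3 J J = q) (IJ : dot3 I J = 0).
Let K := crs3 I J.
Let O := qvec o.
Let p_neq0 : p != 0. Proof. by case/andP: p01 => h _; rewrite gt_eqF. Qed.
Let q_neq0 : q != 0. Proof. by case/andP: p01 => _ h; rewrite subr_eq0 gt_eqF. Qed.

Definition dotq (a : quat) (x : vec) : R := a 0 1 * x 0 0 + a 0 2 * x 0 1 + a 0 3 * x 0 2.
Definition y0 (a : quat) := a 0 0.
Definition y1 (a : quat) := dotq a I / p.
Definition y2 (a : quat) := dotq a J / q.
Definition y3 (a : quat) := dotq a (crs3 I J) / (p * q).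

Lemma dotq_add a b x : dotq (a + b) x = dotq a x + dotq b x.
Proof. by rewrite /dotq !addqE; ring. Qed.
Lemma dotq_sc k a x : dotq (k *: a) x = k * dotq a x.
Proof. by rewrite /dotq !scaleqE; ring. Qed.

Lemma yD a b : (y0 (a + b) = y0 a + y0 b) * (y1 (a + b) = y1 a + y1 b) *
  (y2 (a + b) = y2 a + y2 b) * (y3 (a + b) = y3 a + y3 b).
Proof. by rewrite /y0 /y1 /y2 /y3 addqE !dotq_add !mulrDl. Qed.
Lemma yZ k a : (y0 (k *: a) = k * y0 a) * (y1 (k *: a) = k * y1 a) *
  (y2 (k *: a) = k * y2 a) * (y3 (k *: a) = k * y3 a).
Proof. by rewrite /y0 /y1 /y2 /y3 scaleqE !dotq_sc !mulrA. Qed.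

Lemma dotq_mul a b x : dotq (qmul a b) x = a 0 0 * dotq b x + b 0 0 * dotq a x +
  dot3 (crs3 (vector_part a) (vector_part b)) x.
Proof. by rewrite /dotq /dot3 !crs3E !vector_partE !qmulE; ring. Qed.

(** Lagrange's identity for the orthogonal frame I, J, I x J. *)
Lemma parseval a b : p * q * dot3 (vector_part a) (vector_part b) =
  q * (dotq a I * dotq b I) + p * (dotq a J * dotq b J) + dotq a K * dotq b K.
Proof.
transitivity (dot3 J J * (dotq a I * dotq b I) + dot3 I I * (dotq a J * dotq b J) + dotq a K * dotq b K
   - dot3 I J * (dotq a I * dotq b J + dotq a J * dotq b I) + dot3 I J ^+ 2 * dot3 (vector_part a) (vector_part b)).
  rewrite -[in LHS]JJ -[in LHS]II /dot3 /dotq /K !crs3E !vector_partE; ring.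
by rewrite II JJ IJ; ring.
Qed.

Lemma cross_dots (a b : vec) :
  [/\ q * dot3 (crs3 a b) I = dot3 a J * dot3 b K - dot3 a K * dot3 b J,
      p * dot3 (crs3 a b) J = dot3 a K * dot3 b I - dot3 a I * dot3 b K
    & dot3 (crs3 a b) K = dot3 a I * dot3 b J - dot3 a J * dot3 b I].
Proof.
split.
- transitivity (dot3 a J * dot3 b K - dot3 a K * dot3 b J + dot3 I J * dot3 (crs3 a b) J).
    by rewrite -JJ /dot3 /K !crs3E; ring.
  by rewrite IJ mul0r addr0.
- transitivity (dot3 a K * dot3 b I - dot3 a I * dot3 b K + dot3 I J * dot3 (crs3 a b) I).
    by rewrite -II /dot3 /K !crs3E; ring.
  by rewrite IJ mul0r addr0.
- by rewrite /dot3 /K !crs3E; ring.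
Qed.

Lemma dotqE a x : dotq a x = dot3 (vector_part a) x.
Proof. by rewrite /dotq /dot3 !vector_partE. Qed.

Lemma yM a b :
  [/\ y0 (qmul a b) = y0 a * y0 b - p * (y1 a * y1 b) - q * (y2 a * y2 b) - p * q * (y3 a * y3 b),
      y1 (qmul a b) = y0 a * y1 b + y1 a * y0 b + q * (y2 a * y3 b - y3 a * y2 b),
      y2 (qmul a b) = y0 a * y2 b + y2 a * y0 b + p * (y3 a * y1 b - y1 a * y3 b)
    & y3 (qmul a b) = y0 a * y3 b + y3 a * y0 b + y1 a * y2 b - y2 a * y1 b].
Proof.
have [c1 c2 c3] := cross_dots (vector_part a) (vector_part b).
rewrite -!dotqE in c1 c2 c3.
split.
- have := parseval a b; rewrite /y0 /y1 /y2 /y3 -/K => h.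
  have -> : (qmul a b) 0 0 = a 0 0 * b 0 0 - dot3 (vector_part a) (vector_part b).
    by rewrite qmulE /dot3 !vector_partE; ring.
  have -> : dot3 (vector_part a) (vector_part b) = (p * q)^-1 * (q * (dotq a I * dotq b I) + p * (dotq a J * dotq b J) + dotq a K * dotq b K).
    by rewrite -h mulKf // mulf_neq0.
  by field; rewrite p_neq0 q_neq0.
- rewrite /y1 dotq_mul /y0 /y2 /y3 -/K.
  have -> : dot3 (crs3 (vector_part a) (vector_part b)) I = q^-1 * (dotq a J * dotq b K - dotq a K * dotq b J).
    by rewrite -c1 mulKf.
  by field; rewrite p_neq0 q_neq0.
- rewrite /y2 dotq_mul /y0 /y1 /y3 -/K.
  have -> : dot3 (crs3 (vector_part a) (vector_part b)) J = p^-1 * (dotq a K * dotq b I - dotq a I * dotq b K).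
    by rewrite -c2 mulKf.
  by field; rewrite p_neq0 q_neq0.
- rewrite /y3 dotq_mul /y0 /y1 /y2 -/K c3.
  by field; rewrite p_neq0 q_neq0.
Qed.

Lemma y_conj a : (y0 (qconj a) = y0 a) * (y1 (qconj a) = - y1 a) *
  (y2 (qconj a) = - y2 a) * (y3 (qconj a) = - y3 a).
Proof. by rewrite /y0 /y1 /y2 /y3 /dotq !qconjE; do ![split]; field; rewrite ?p_neq0 ?q_neq0. Qed.

Lemma y_norm a : qnorm a = y0 a ^+ 2 + p * y1 a ^+ 2 + q * y2 a ^+ 2 + p * q * y3 a ^+ 2.
Proof.
have [h _ _ _] := yM a (qconj a); rewrite !y_conj in h.
rewrite qmul_conj /y0 scaleqE qoneE mulr1 in h; rewrite h /y0; ring.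
Qed.

Lemma y_eq0 a : y0 a = 0 -> y1 a = 0 -> y2 a = 0 -> y3 a = 0 -> a = 0.
Proof.
move=> h0 h1 h2 h3; apply/eqP; rewrite -[_ == _]negbK -qnorm_neq0 y_norm h0 h1 h2 h3.
by rewrite negbK; apply/eqP; ring.
Qed.

Lemma y_inj a b : y0 a = y0 b -> y1 a = y1 b -> y2 a = y2 b -> y3 a = y3 b -> a = b.
Proof.
move=> h0 h1 h2 h3; apply/eqP; rewrite -subr_eq0; apply/eqP.
by rewrite -scaleN1r; apply: y_eq0; rewrite yD yZ ?h0 ?h1 ?h2 ?h3 mulN1r subrr.
Qed.


(** Conjugation by the translation that takes the origin to o adds a commutator to
    the dual part, so it is an automorphism. *)
Definition tr (a : dquat) : quat := dual_part a -
  2%:R^-1 *: (qmul (primal_part a) (qvec o) - qmul (qvec o) (primal_part a)).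

(** An isomorphism onto the model: coordinates with respect to 1, I, J, I x J after
    moving the origin to o; the dual unit is rescaled by - 1 / tau. *)
Definition psi (a : dquat) : dq R :=
  let A := primal_part a in let B := tr a in
  DQ (y0 A) (y1 A) (y2 A) (y3 A)
     (- tau^-1 * y0 B) (- tau^-1 * y1 B) (- tau^-1 * y2 B) (- tau^-1 * y3 B).

Definition qcomb (s x y z : R) : quat := s *: qone R + qvec (x *: I + y *: J + z *: crs3 I J).

Definition phi (x : dq R) : dquat :=
  let A := qcomb (x0 x) (x1 x) (x2 x) (x3 x) in
  row_mx A (- tau *: qcomb (x4 x) (x5 x) (x6 x) (x7 x)
    + 2%:R^-1 *: (qmul A (qvec o) - qmul (qvec o) A)).

Lemma y_qcomb s x y z :
  (y0 (qcomb s x y z) = s) * (y1 (qcomb s x y z) = x) * (y2 (qcomb s x y z) = y) * (y3 (qcomb s x y z) = z).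
Proof.
have E (v : vec) : dotq (qcomb s x y z) v = x * dot3 I v + y * dot3 J v + z * dot3 K v.
  by rewrite /dotq /qcomb /dot3 /K !(addqE, scaleqE, qoneE, qvecE) !mxE /=; ring.
have dC u v : dot3 u v = dot3 v u by rewrite /dot3; ring.
have kI : dot3 K I = 0 by rewrite /dot3 /K !crs3E; ring.
have kJ : dot3 K J = 0 by rewrite /dot3 /K !crs3E; ring.
have kK : dot3 K K = p * q.
  transitivity (dot3 I I * dot3 J J - dot3 I J ^+ 2); last by rewrite II JJ IJ; ring.
  by rewrite /dot3 /K !crs3E; ring.
do ![split].
- by rewrite /y0 /qcomb !(addqE, scaleqE, qoneE, qvecE); ring.
- by rewrite /y1 E II (dC J) IJ kI; field.
- by rewrite /y2 E JJ IJ kJ; field.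
- by rewrite /y3 E -/K (dC I) (dC J) kI kJ kK; field; rewrite p_neq0 q_neq0.
Qed.

Lemma qcombK a : qcomb (y0 a) (y1 a) (y2 a) (y3 a) = a.
Proof. by apply: y_inj; rewrite y_qcomb. Qed.

Lemma phiK x : psi (phi x) = x.
Proof.
rewrite /psi /tr /phi primal_row dual_row addrK !yZ !y_qcomb !mulrA.
by case: x => *; congr DQ => //=; rewrite mulNr mulrN opprK mulVf // mul1r.
Qed.

Lemma psiK a : phi (psi a) = a.
Proof.
rewrite -[RHS]dquatK /phi /psi /= qcombK; congr row_mx.
have -> : qcomb (- tau^-1 * y0 (tr a)) (- tau^-1 * y1 (tr a)) (- tau^-1 * y2 (tr a)) (- tau^-1 * y3 (tr a))
    = - tau^-1 *: tr a.
  by apply: y_inj; rewrite y_qcomb yZ.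
rewrite scalerA mulrN mulNr opprK divff // scale1r /tr subrK //.
Qed.

Lemma psi_sc k a : psi (k *: a) = dsc k (psi a).
Proof.
have hp : primal_part (k *: a) = k *: primal_part a by rewrite /primal_part linearZ.
have ht : tr (k *: a) = k *: tr a.
  rewrite /tr hp qmulZl qmulZr; have -> : dual_part (k *: a) = k *: dual_part a by rewrite /dual_part linearZ.
  by apply: quatP; rewrite !(addqE, oppqE, scaleqE); ring.
by rewrite /psi hp ht; congr DQ; rewrite !yZ //= mulrCA.
Qed.

Definition dqconj (a : dquat) : dquat := row_mx (qconj (primal_part a)) (qconj (dual_part a)).

Lemma psiM a b : psi (dqmul a b) = dmul p (psi a) (psi b).
Proof.
have ht : tr (dqmul a b) = qmul (primal_part a) (tr b) + qmul (tr a) (primal_part b).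
  rewrite /tr /dqmul primal_row dual_row.
  move: (primal_part a) (primal_part b) (dual_part a) (dual_part b) (qvec o) => A B A' B' X.
  rewrite !(qmulDr, qmulDl, qmulNl, qmulNr, qmulZl, qmulZr) !qmulA.
  by apply: quatP; rewrite !(addqE, oppqE, scaleqE); ring.
rewrite /psi ht /dqmul primal_row.
have [e0 e1 e2 e3] := yM (primal_part a) (primal_part b).
have [f0 f1 f2 f3] := yM (primal_part a) (tr b).
have [g0 g1 g2 g3] := yM (tr a) (primal_part b).
rewrite /dmul; congr DQ => //; rewrite [in LHS]yD ?f0 ?f1 ?f2 ?f3 ?g0 ?g1 ?g2 ?g3; ring.
Qed.

Lemma psi_conj a : psi (dqconj a) = dconj (psi a).
Proof.
have ht : tr (dqconj a) = qconj (tr a).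
  rewrite /tr /dqconj primal_row dual_row.
  by apply: quatP; rewrite !(qmulE, qconjE, addqE, oppqE, scaleqE, qvecE); ring.
by rewrite /psi ht /dqconj primal_row /dconj; congr DQ; rewrite ?y_conj //= mulrN.
Qed.

Lemma rel_psi a b : rel p (psi a) (psi b) = psi (dqmul (dqconj a) b).
Proof. by rewrite /rel psiM psi_conj. Qed.

Lemma nrm_psi a : nrm p (psi a) = qnorm (primal_part a).
Proof. by rewrite y_norm. Qed.

Lemma form_psi a b : form p (psi a) (psi b) = - tau^-1 * study_form a b.
Proof.
rewrite -rel_form rel_psi study_formE /= /y0 /tr /dqmul /dqconj !primal_row !dual_row.
by congr (_ * _); rewrite !(qmulE, addqE, oppqE, scaleqE, qvecE); ring.
Qed.

Lemma proper_psi a : displacement a <-> proper p (psi a).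
Proof.
rewrite /displacement /in_study /proper form_psi nrm_psi qnorm_neq0.
split=> -[h ->]; split=> //; first by rewrite h mulr0.
by move/eqP: h; rewrite mulf_eq0 oppr_eq0 invr_eq0 (negbTE t0) => /eqP.
Qed.

Lemma proj_eq_psi a b : proj_eq a b <-> exists2 k, k != 0 & psi b = dsc k (psi a).
Proof.
split=> -[k k0 h]; exists k => //; first by rewrite h psi_sc.
by rewrite -[b]psiK h -psi_sc psiK.
Qed.

(** For e = 1 and e = -1 the points x run through the two axes.  Expanding the
    commutator of moved_eq in the basis I, J, K gives one equation for each
    coordinate. *)
Lemma moved_coord a b (e t : R) : e ^+ 2 = 1 -> displacement a -> displacement b ->
  let r := rel p (psi a) (psi b) in
  let x := o + (e * tau) *: crs3 I J + t *: (I + e *: J) in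
  moved a x = moved b x <->
  [/\ x4 r = 0, tau * x5 r = q * (e * t * x3 r - e * tau * x2 r),
      tau * x6 r = p * (e * tau * x1 r - t * x3 r) & tau * x7 r = t * (x2 r - e * x1 r)].
Proof.
move=> e2 [sa a0] [sb b0] r x; rewrite (moved_eq x sa sb a0 b0) /r rel_psi.
set c := dqmul (dqconj a) b.
have pc : qmul (qconj (primal_part a)) (primal_part b) = primal_part c.
  by rewrite /c /dqmul /dqconj !primal_row.
have dc : qmul (qconj (primal_part a)) (dual_part b) + qmul (qconj (dual_part a)) (primal_part b) = dual_part c.
  by rewrite /c /dqmul /dqconj !primal_row !dual_row.
rewrite pc dc; set A := primal_part c.
pose Y := qcomb 0 t (e * t) (e * tau).
have Yx : qvec x = qvec o + Y.
  rewrite /Y /qcomb scale0r add0r -qvecD /x; congr qvec.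
  by apply: vec3P; rewrite !mxE; ring.
have tc : dual_part c = tr c + 2%:R^-1 *: (qmul A (qvec o) - qmul (qvec o) A) by rewrite /tr subrK.
have E : qmul A (qvec x) - qmul (qvec x) A = 2%:R *: dual_part c <->
    qmul A Y - qmul Y A = 2%:R *: tr c.
  rewrite Yx tc qmulDr qmulDl scalerDr scalerA divff ?pnatr_eq0 // scale1r.
  split=> h.
    apply: (addIr (qmul A (qvec o) - qmul (qvec o) A)); rewrite -h.
    by apply: quatP; rewrite !(addqE, oppqE); ring.
  by rewrite -h; apply: quatP; rewrite !(addqE, oppqE); ring.
have [l0 l1 l2 l3] := yM A Y; have [m0 m1 m2 m3] := yM Y A.
rewrite !y_qcomb in l0 l1 l2 l3 m0 m1 m2 m3.
have n2 : (2%:R : R) != 0 by rewrite pnatr_eq0.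
have tv (z : R) : tau * (- tau^-1 * z) = - z by rewrite mulrA mulrN divff // mulN1r.
rewrite /psi -/A /= !tv E; split=> [h|[h0 h1 h2 h3]].
  have g0 := congr1 y0 h; have g1 := congr1 y1 h; have g2 := congr1 y2 h; have g3 := congr1 y3 h.
  rewrite -scaleN1r !yD !yZ ?l0 ?l1 ?l2 ?l3 ?m0 ?m1 ?m2 ?m3 in g0 g1 g2 g3.
  have k0 : y0 (tr c) = 0 by apply: (mulfI n2); rewrite -g0; ring.
  split; first by rewrite k0 mulr0.
  - by apply: (mulfI n2); rewrite mulrN -g1; ring.
  - by apply: (mulfI n2); rewrite mulrN -g2; ring.
  - by apply: (mulfI n2); rewrite mulrN -g3; ring.
have {}h0 : y0 (tr c) = 0.
  by move/eqP: h0; rewrite mulf_eq0 oppr_eq0 invr_eq0 (negbTE t0) => /eqP.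
apply: y_inj; rewrite -scaleN1r !yD !yZ ?l0 ?l1 ?l2 ?l3 ?m0 ?m1 ?m2 ?m3.
- by rewrite h0; ring.
- by rewrite -[y1 (tr c)]opprK h1; ring.
- by rewrite -[y2 (tr c)]opprK h2; ring.
- by rewrite -[y3 (tr c)]opprK h3; ring.
Qed.
End Coordinates.

(** * Topology of the space of axis values *)

Section Topo.
Variable R : realType.

Lemma cmx_continuous (T : topologicalType) m n (A : T -> 'M[R]_(m, n)) : cmx A -> continuous A.
Proof.
move=> hA t U [P MP sP]; rewrite /= nbhs_simpl /=.
have : \forall s \near t, forall ij : 'I_m * 'I_n, P ij.1 ij.2 (A s ij.1 ij.2).
  by apply: filter_forall => -[i j] /=; apply: (hA i j t); apply: MP.
by apply: filterS => s h; apply: sP => i j; apply: (h (i, j)).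
Qed.

Lemma ptws_continuous (T : topologicalType) (X : Type) (Y : topologicalType) (F : T -> {ptws X -> Y}) :
  (forall x, continuous (fun t => F t x)) -> continuous F.
Proof.
move=> hF t; apply/cvg_sup => x U [V [[W] oW <-] Wx WU].
rewrite nbhs_simpl /=.
have H : nbhs (F t x) W by exact: open_nbhs_nbhs.
have := hF x t _ H; rewrite nbhs_simpl /=.
by apply: filterS => s Ws; apply: WU.
Qed.

Lemma ptws_eval (X : Type) (Y : topologicalType) (x : X) : continuous (fun f : {ptws X -> Y} => f x).
Proof.
move=> f; have h : {for f, continuous (fun g : initial_topology (fun g : X -> Y => g x) => g x)} by exact: initial_continuous.
have /cvg_sup /(_ x) k : (nbhs (f : {ptws X -> Y})) --> (f : {ptws X -> Y}) by exact: cvg_id.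
by move=> U /h /k.
Qed.
End Topo.

Section PsiContinuity.
Variables (R : realType) (T : topologicalType).
Variables (I J o : 'rV[R]_3) (tau p : R).
Local Notation quat := (quaternion R).
Local Notation dquat := (dual_quaternion R).

Implicit Types u v : T -> quat.

Definition cq (u : T -> quat) := forall k, cr (fun t => u t 0 k).

Lemma cq_cst (a : quat) : cq (fun=> a). Proof. by move=> k; apply: cr_cst. Qed.
Lemma cq_add u v : cq u -> cq v -> cq (fun t => u t + v t).
Proof. by move=> cu cv k; under eq_fun do rewrite mxE; apply: cr_add; [apply: cu|apply: cv]. Qed.
Lemma cq_opp u : cq u -> cq (fun t => - u t).
Proof. by move=> cu k; under eq_fun do rewrite mxE; apply: cr_opp; apply: cu. Qed.
Lemma cq_sc f u : cr f -> cq u -> cq (fun t => f t *: u t).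
Proof. by move=> cf cu k; under eq_fun do rewrite mxE; apply: cr_mul => //; apply: cu. Qed.

Lemma cq_quat u : cr (fun t => u t 0 0) -> cr (fun t => u t 0 1) -> cr (fun t => u t 0 2) ->
  cr (fun t => u t 0 3) -> cq u.
Proof.
move=> h0 h1 h2 h3; case=> [[|[|[|[|k]]]] hk] //.
- by rewrite (_ : Ordinal hk = 0) //; apply/val_inj.
- by rewrite (_ : Ordinal hk = 1) //; apply/val_inj.
- by rewrite (_ : Ordinal hk = 2) //; apply/val_inj.
- by rewrite (_ : Ordinal hk = 3) //; apply/val_inj.
Qed.

Lemma cq_mul u v : cq u -> cq v -> cq (fun t => qmul (u t) (v t)).
Proof.
move=> cu cv; have m i j : cr (fun t => u t 0 i * v t 0 j) by apply: cr_mul; [apply: cu|apply: cv].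
have mN i j : cr (fun t => - (u t 0 i * v t 0 j)) by apply: cr_opp.
by apply: cq_quat; under eq_fun do rewrite qmulE; apply: cr_add => //; apply: cr_add => //; apply: cr_add.
Qed.

Lemma cr_dotq u x : cq u -> cr (fun t => dotq (u t) x).
Proof.
move=> cu; have m i j : cr (fun t => u t 0 i * x 0 j) by apply: cr_mul; [apply: cu|apply: cr_cst].
by rewrite /dotq; apply: cr_add => //; apply: cr_add.
Qed.

Lemma cts_psi (a : T -> dquat) : (forall j, cr (fun t => a t 0 j)) -> cts (fun t => psi I J o tau p (a t)).
Proof.
move=> ca.
have cA : cq (fun t => primal_part (a t)) by move=> k; under eq_fun do rewrite mxE; apply: ca.
have cD : cq (fun t => dual_part (a t)) by move=> k; under eq_fun do rewrite mxE; apply: ca.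
have cB : cq (fun t => tr o (a t)).
  rewrite /tr; apply: cq_add => //; apply: cq_opp; apply: cq_sc; first exact: cr_cst.
  apply: cq_add; first by apply: cq_mul => //; apply: cq_cst.
  by apply: cq_opp; apply: cq_mul => //; apply: cq_cst.
have cy u : cq u -> [/\ cr (fun t => y0 (u t)), cr (fun t => y1 I p (u t)),
    cr (fun t => y2 J p (u t)) & cr (fun t => y3 I J p (u t))].
  rewrite /y1 /y2 /y3 => cu.
  split; first exact: cu.
  - by apply: cr_mul; [exact: cr_dotq | exact: cr_cst].
  - by apply: cr_mul; [exact: cr_dotq | exact: cr_cst].
  - by apply: cr_mul; [exact: cr_dotq | exact: cr_cst].
have [a0 a1 a2 a3] := cy _ cA; have [b0 b1 b2 b3] := cy _ cB.
by rewrite /psi; apply: cts_DQ => //; apply: cr_mul => //; exact: cr_cst.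
Qed.

Lemma cr_phi (x : T -> dq R) : cts x -> forall j, cr (fun t => phi I J o tau (x t) 0 j).
Proof.
move=> cx; have cc s y z w : cr s -> cr y -> cr z -> cr w -> cq (fun t => qcomb I J (s t) (y t) (z t) (w t)).
  move=> cs cy cz cw; rewrite /qcomb; apply: cq_add; first by apply: cq_sc => //; apply: cq_cst.
  have m f (v : 'rV[R]_3) i : cr f -> cr (fun t => f t * v 0 i).
    by move=> cf; apply: cr_mul => //; apply: cr_cst.
  have e i : cr (fun t => (y t *: I + z t *: J + w t *: crs3 I J) 0 i).
    have -> : (fun t => (y t *: I + z t *: J + w t *: crs3 I J) 0 i) =
       fun t => y t * I 0 i + z t * J 0 i + w t * (crs3 I J) 0 i.
      by apply/funext => t; rewrite !mxE.
    by apply: cr_add; [apply: cr_add|]; apply: m.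
  by apply: cq_quat; under eq_fun do rewrite qvecE; first [exact: e | exact: cr_cst].
have cA := cc _ _ _ _ (cx 0%N) (cx 1%N) (cx 2%N) (cx 3%N).
have cB := cc _ _ _ _ (cx 4%N) (cx 5%N) (cx 6%N) (cx 7%N).
move=> j; case: (split_ordP j) => k ->.
  rewrite /phi; under eq_fun do rewrite row_mxEl; exact: cA.
rewrite /phi; under eq_fun do rewrite row_mxEr.
move: k; apply: cq_add; first by apply: cq_sc => //; exact: cr_cst.
apply: cq_sc; first exact: cr_cst.
apply: cq_add; first by apply: cq_mul => //; apply: cq_cst.
by apply: cq_opp; apply: cq_mul => //; apply: cq_cst.
Qed.
End PsiContinuity.

(** * Skew lines and common tangent spheres *)

Section Axes.
Variables (R : realType).
Local Notation vec := 'rV[R]_3.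

(** Normal form of two skew lines: o is the midpoint of the common perpendicular,
    whose feet are o + tau (I x J) and o - tau (I x J). *)
Record axes_frame (M N : oriented_line R) (I J o : vec) (tau p : R) : Prop := AxesFrame {
  af_p : 0 < p < 1;
  af_tau : tau != 0;
  af_II : dot3 I I = p;
  af_JJ : dot3 J J = 1 - p;
  af_IJ : dot3 I J = 0;
  af_M : M = (I + J, [set x | exists t : R, x = o + tau *: crs3 I J + t *: (I + J)]);
  af_N : N = (I - J, [set x | exists t : R, x = o - tau *: crs3 I J + t *: (I - J)]) }.

Lemma dot3E (x y : vec) : dot3 x y = x 0 0 * y 0 0 + x 0 1 * y 0 1 + x 0 2 * y 0 2.
Proof. by []. Qed.

Lemma dot3_eq0 (x : vec) : dot3 x x = 0 -> x = 0.
Proof.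
rewrite dot3E -!expr2 => h.
have [h0 h1 h2] : [/\ x 0 0 = 0, x 0 1 = 0 & x 0 2 = 0].
  have s0 := sqr_ge0 (x 0 0); have s1 := sqr_ge0 (x 0 1); have s2 := sqr_ge0 (x 0 2).
  by split; apply/eqP; rewrite -sqrf_eq0; apply/eqP; lra.
by apply: vec3P; rewrite ?h0 ?h1 ?h2 mxE.
Qed.

Lemma dot3_ge0 (x : vec) : 0 <= dot3 x x.
Proof. by rewrite dot3E -!expr2 !addr_ge0 ?sqr_ge0. Qed.

Lemma line_shift (c : vec) (v : vec) (t1 : R) :
  [set x | exists t : R, x = c + t *: v] = [set x | exists t : R, x = c + t1 *: v + t *: v].
Proof.
apply/seteqP; split=> x [t ->].
  by exists (t - t1); rewrite -addrA -scalerDl [t1 + _]addrC subrK.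
by exists (t1 + t); rewrite -addrA -scalerDl.
Qed.

(** I and J are orthogonal because mu and nu have the same length; the feet of the
    common perpendicular are found from two equations, which the basis I, J
    decouples and in which p and 1 - p are nonzero as the lines are not parallel. *)
Lemma skew_frame (M N : oriented_line R) : is_line M -> is_line N -> skew_lines M N ->
  exists I J o tau p, axes_frame M N I J o tau p.
Proof.
move=> [[c mu] cc cM] [[d nu] dc dN] [disj npar].
rewrite /is_contact !sum3 /= in cc dc.
have mm : dot3 mu mu = 1 by rewrite dot3E -!expr2.
have nn : dot3 nu nu = 1 by rewrite dot3E -!expr2.
pose I := 2%:R^-1 *: (mu + nu); pose J := 2%:R^-1 *: (mu - nu).
have muE : mu = I + J by apply: vec3P; rewrite !mxE; field.
have nuE : nu = I - J by apply: vec3P; rewrite !mxE; field.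
pose p := dot3 I I.
have IJ : dot3 I J = 0.
  transitivity (4%:R^-1 * (dot3 mu mu - dot3 nu nu)); last by rewrite mm nn subrr mulr0.
  by rewrite !dot3E !mxE; field.
have JJ : dot3 J J = 1 - p.
  apply/eqP; rewrite -subr_eq0; apply/eqP.
  transitivity (2%:R^-1 * (dot3 mu mu + dot3 nu nu) - 1); last by rewrite mm nn; field.
  by rewrite /p !dot3E !mxE; field.
have p01 : 0 < p < 1.
  rewrite lt_def dot3_ge0 andbT -subr_gt0 -JJ lt_def dot3_ge0 andbT.
  apply/andP; split; apply/eqP => /dot3_eq0 h; apply: npar.
    by exists (-1); rewrite -cM -dN /= muE nuE h add0r sub0r scaleN1r opprK.
  by exists 1; rewrite -cM -dN /= muE nuE h addr0 subr0 scale1r.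
have [p0 q0] : p != 0 /\ 1 - p != 0.
  by case/andP: p01 => h1 h2; rewrite gt_eqF // subr_eq0 gt_eqF.
pose w0 := c - d.
pose s1 := - dot3 w0 I / p; pose s2 := - dot3 w0 J / (1 - p).
pose t1 := 2%:R^-1 * (s1 + s2); pose t2 := 2%:R^-1 * (s2 - s1).
pose c1 := c + t1 *: mu; pose d1 := d + t2 *: nu.
pose tau := 2%:R^-1 * (dot3 (c1 - d1) (crs3 I J) / (p * (1 - p))).
pose o := 2%:R^-1 *: (c1 + d1).
have w1 : c1 - d1 = w0 + s1 *: I + s2 *: J.
  rewrite /c1 /d1 muE nuE /w0 /t1 /t2.
  by apply: vec3P; rewrite !mxE; field.
have wE : c1 - d1 = (2%:R * tau) *: crs3 I J.
  have dq_ (x : vec) v : dotq (qvec x) v = dot3 x v by rewrite /dotq !qvecE.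
  have dD (x y z : vec) (k : R) : dot3 (x + k *: y) z = dot3 x z + k * dot3 y z.
    by rewrite !dot3E !mxE; ring.
  have JI : dot3 J I = 0 by rewrite -IJ !dot3E; ring.
  have wI : dot3 (c1 - d1) I = 0 by rewrite w1 !dD JI -/p /s1; field.
  have wJ : dot3 (c1 - d1) J = 0 by rewrite w1 !dD JJ IJ /s2; field.
  rewrite -[LHS]qvecK -[RHS]qvecK; congr vector_part.
  have qE : qvec ((2%:R * tau) *: crs3 I J) = qcomb I J 0 0 0 (2%:R * tau).
    by rewrite /qcomb !scale0r !add0r.
  apply: (y_inj p01 (erefl : dot3 I I = p) JJ IJ).
  - by rewrite /y0 !qvecE.
  - by rewrite qE (y_qcomb p01 erefl JJ IJ) /y1 dq_ wI mul0r.
  - by rewrite qE (y_qcomb p01 erefl JJ IJ) /y2 dq_ wJ mul0r.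
  - by rewrite qE (y_qcomb p01 erefl JJ IJ) /y3 dq_ /tau; field; rewrite p0 q0.
have c1E : c1 = o + tau *: crs3 I J.
  have : c1 = o + 2%:R^-1 *: (c1 - d1) by apply: vec3P; rewrite !mxE; field.
  by rewrite wE scalerA mulKf ?pnatr_eq0.
have d1E : d1 = o - tau *: crs3 I J.
  have : d1 = o - 2%:R^-1 *: (c1 - d1) by apply: vec3P; rewrite !mxE; field.
  by rewrite wE scalerA mulKf ?pnatr_eq0.
have t0 : tau != 0.
  apply/eqP => tz; have : (M.2 `&` N.2) c1.
    rewrite -cM -dN; split; first by exists t1.
    by exists t2; rewrite c1E -/d1 d1E tz !scale0r subr0 addr0.
  by rewrite disj.
exists I, J, o, tau, p; split=> //.
  by rewrite -cM /normal_line /= (line_shift c mu t1) -/c1 c1E {1}muE -muE.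
by rewrite -dN /normal_line /= (line_shift d nu t2) -/d1 d1E {1}nuE -nuE.
Qed.
End Axes.

Section Edge.
Variables (R : realType) (M N : oriented_line R) (I J o : 'rV[R]_3) (tau p : R).
Local Notation dquat := (dual_quaternion R).
Local Notation q := (1 - p).
Hypothesis af : axes_frame M N I J o tau p.
Local Notation psi := (psi I J o tau p).
Let p01 := af_p af.
Let t0 := af_tau af.
Let II := af_II af.
Let JJ := af_JJ af.
Let IJ := af_IJ af.
Let p_neq0 : p != 0. Proof. by case/andP: p01 => h _; rewrite gt_eqF. Qed.
Let q_neq0 : q != 0. Proof. by case/andP: p01 => _ h; rewrite subr_eq0 gt_eqF. Qed.

Let half_sum (x y z : R) : x - y = y - z -> x + z = 2%:R * y. Proof. by move=> h; lra. Qed.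
Let half_diff (x y z : R) : y - x = - (y + z) -> x - z = 2%:R * y. Proof. by move=> h; lra. Qed.
Let sum_diff (x y y' z : R) : x - z = 2%:R * y -> x + z = 2%:R * y' -> x = y + y'.
Proof. by move=> h h'; lra. Qed.

Lemma tangent_line (L : oriented_line R) (c : contact_element R) (a b : dquat) :
  displacement a -> displacement b -> normal_line c = L ->
  common_tangent_sphere (move_contact a c) (move_contact b c) <->
  exists2 x, L.2 x & moved a x = moved b x.
Proof.
move=> da db <-; rewrite (tangent_meet c da db); split.
  by move=> [t h]; exists (c.1 + t *: c.2) => //; exists t.
by move=> [x [t ->] h]; exists t.
Qed.

(** Equating the two expressions of moved_coord for x5 and x6 determines the
    parameters t x3 = tau (x1 + x2) and s x3 = tau (x2 - x1) of the sphere centres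
    and leaves the equations of L.  If x3 vanishes, all coordinates but x0 do, and
    the positions coincide.  Conversely these parameters solve the equations, the
    last one being the Study condition. *)
Lemma edge_psi a b : displacement a -> displacement b ->
  (~ proj_eq a b /\ line_in_study a b) /\
  (exists2 x, M.2 x & moved a x = moved b x) /\ (exists2 x, N.2 x & moved a x = moved b x) <->
  adj p (psi a) (psi b) /\ x3 (rel p (psi a) (psi b)) != 0.
Proof.
move=> da db; have [sa a0] := da; have [sb b0] := db.
have [na na0] := (proper_psi o p01 t0 II JJ IJ a).1 da.
have [nb nb0] := (proper_psi o p01 t0 II JJ IJ b).1 db.
have e1 : (1 : R) ^+ 2 = 1 by rewrite expr1n.
have eN1 : (-1 : R) ^+ 2 = 1 by rewrite sqrrN expr1n.
have cM t : moved a (o + tau *: crs3 I J + t *: (I + J)) = moved b (o + tau *: crs3 I J + t *: (I + J)) <->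
    let r := rel p (psi a) (psi b) in
    [/\ x4 r = 0, tau * x5 r = q * (t * x3 r - tau * x2 r),
      tau * x6 r = p * (tau * x1 r - t * x3 r) & tau * x7 r = t * (x2 r - x1 r)].
  by have := moved_coord o p01 t0 II JJ IJ t e1 da db; cbv zeta; rewrite !mul1r scale1r.
have cN t : moved a (o - tau *: crs3 I J + t *: (I - J)) = moved b (o - tau *: crs3 I J + t *: (I - J)) <->
    let r := rel p (psi a) (psi b) in
    [/\ x4 r = 0, tau * x5 r = q * (tau * x2 r - t * x3 r),
      tau * x6 r = - (p * (tau * x1 r + t * x3 r)) & tau * x7 r = t * (x2 r + x1 r)].
  have := moved_coord o p01 t0 II JJ IJ t eN1 da db.
  cbv zeta; rewrite !mulN1r scaleN1r scaleNr !mulNr !opprK.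
  by rewrite -[- (tau * x1 _) - _]opprD mulrN [- (t * _) + _]addrC.
have hr : form p (rel p (psi a) (psi b)) (rel p (psi a) (psi b)) = 0.
  by rewrite form_rel na nb mulr0 mul0r addr0.
have ha : dmul p (psi a) (rel p (psi a) (psi b)) = dsc (nrm p (psi a)) (psi b) by exact: mul_null_conj.
have hf : x4 (rel p (psi a) (psi b)) = - tau^-1 * study_form a b.
  by rewrite rel_form; apply: form_psi.
have hk k : psi b = dsc k (psi a) -> x3 (rel p (psi a) (psi b)) = 0.
  move=> ->; rewrite rel_scr; have := relC p (psi a) (psi a).
  by case: (rel p (psi a) (psi a)) => ? ? ? c ? ? ? ? [_ _ e _ _ _] /=; apply/eqP; rewrite mulf_eq0; apply/orP; right; apply/eqP; lra.
rewrite (line_in_studyP sa sb) (proj_eq_psi o p01 t0 II JJ IJ) (af_M af) (af_N af) /adj /inL.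
move: cM cN hr ha hf hk; move: (rel p (psi a) (psi b)) => r cM cN hr ha hf hk.
split.
- move=> [[npr _] [[x [t ->] /cM /= [r4 m5 m6 m7]] [y [s ->] /cN /= [_ n5 n6 n7]]]].
  have h2 : (t + s) * x3 r = 2%:R * tau * x2 r.
    have : q * (t * x3 r - tau * x2 r) = q * (tau * x2 r - s * x3 r) by rewrite -m5 -n5.
    by move/(mulfI q_neq0) => h; rewrite mulrDl -mulrA; apply: half_sum.
  have h1 : (t - s) * x3 r = 2%:R * tau * x1 r.
    have : p * (tau * x1 r - t * x3 r) = p * - (tau * x1 r + s * x3 r) by rewrite -m6 n6 mulrN.
    by move/(mulfI p_neq0) => h; rewrite mulrBl -mulrA; apply: half_diff.
  have ht : t * x3 r = tau * x1 r + tau * x2 r.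
    by apply: (sum_diff (z := s * x3 r)); rewrite -?mulrBl -?mulrDl ?h1 ?h2 mulrA.
  have r5 : x5 r = q * x1 r.
    by apply: (mulfI t0); rewrite m5 ht; ring.
  have r6 : x6 r = - (p * x2 r).
    by apply: (mulfI t0); rewrite m6 ht; ring.
  split=> //; apply/eqP => r3; apply: npr.
  have r1 : x1 r = 0.
    by apply: (mulfI (mulf_neq0 (_ : 2%:R != 0) t0)); rewrite ?pnatr_eq0 // -h1 r3 !mulr0.
  have r2 : x2 r = 0.
    by apply: (mulfI (mulf_neq0 (_ : 2%:R != 0) t0)); rewrite ?pnatr_eq0 // -h2 r3 !mulr0.
  have r7 : x7 r = 0 by apply: (mulfI t0); rewrite m7 r1 r2 subrr !mulr0.
  have rE : r = scal (x0 r).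
    by move: r1 r2 r3 r4 r5 r6 r7; case: (r) => ? ? ? ? ? ? ? ? /= -> -> -> -> -> -> ->; congr DQ; ring.
  have pb : psi b = dsc ((nrm p (psi a))^-1 * x0 r) (psi a).
    by rewrite -dscA -[dsc (x0 r) _](dmul_scal p) -rE ha dscA mulVf // dsc1.
  exists ((nrm p (psi a))^-1 * x0 r) => //.
  by apply: (nrm_dsc_neq0 (p := p) (a := psi a)); rewrite -pb.
- move=> [[r4 r5 r6] r3].
  have r37 : x3 r * x7 r = (x2 r - x1 r) * (x2 r + x1 r).
    apply: (mulfI (mulf_neq0 (mulf_neq0 (_ : 2%:R != 0) p_neq0) q_neq0)); first by rewrite pnatr_eq0.
    apply/eqP; rewrite -subr_eq0; apply/eqP; rewrite -[RHS]hr /form r4 r5 r6; ring.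
  split; first split.
  + by move=> [k k0 /hk r30]; rewrite r30 eqxx in r3.
  + by move/eqP: hf; rewrite r4 eq_sym mulf_eq0 oppr_eq0 invr_eq0 (negbTE t0) => /eqP.
  split.
  + pose t := tau * (x1 r + x2 r) / x3 r.
    have ht : t * x3 r = tau * (x1 r + x2 r) by rewrite /t divfK.
    exists (o + tau *: crs3 I J + t *: (I + J)); first by exists t.
    apply/cM; split=> //; rewrite ?ht ?r5 ?r6; try ring.
    apply: (mulfI r3); rewrite mulrCA r37.
    transitivity (t * x3 r * (x2 r - x1 r)); last by ring.
    by rewrite ht; ring.
  + pose t := tau * (x2 r - x1 r) / x3 r.
    have ht : t * x3 r = tau * (x2 r - x1 r) by rewrite /t divfK.
    exists (o - tau *: crs3 I J + t *: (I - J)); first by exists t.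
    apply/cN; split=> //; rewrite ?ht ?r5 ?r6; try ring.
    apply: (mulfI r3); rewrite mulrCA r37.
    transitivity (t * x3 r * (x2 r + x1 r)); last by ring.
    by rewrite ht; ring.
Qed.
End Edge.

(** * From generic axis values to the motion *)

Section Main.
Variables (R : realType) (n : nat) (M N : oriented_line R) (I J o : 'rV[R]_3) (tau p : R).
Local Notation dquat := (dual_quaternion R).
Local Notation idx := 'rV[int]_n.
Hypothesis af : axes_frame M N I J o tau p.
Local Notation psi := (psi I J o tau p).
Local Notation phi := (phi I J o tau).
Let p01 := af_p af.
Let t0 := af_tau af.
Let II := af_II af.
Let JJ := af_JJ af.
Let IJ := af_IJ af.

Definition linked (x y : dq R) := adj p x y /\ x3 (rel p x y) != 0.

(** The equalities are transported by explicit elimination terms: rewriting would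
    unfold psi when it compares psi (phi x) with psi (phi y). *)
Lemma linked_phi x y : linked x y -> linked (psi (phi x)) (psi (phi y)).
Proof.
move=> h; have hx := phiK o p01 t0 II JJ IJ x; have hy := phiK o p01 t0 II JJ IJ y.
exact: (eq_ind_r (linked^~ _) (eq_ind_r (linked x) h hy) hx).
Qed.

Section Family.
Variables (X : Type) (pos : X -> idx) (a : X -> dquat).

Lemma family_edges : rotating pos a -> principal_trajectories pos M N a ->
  (forall i, proper p (psi (a i))) /\
  forall i k, neighbours pos i k -> linked (psi (a i)) (psi (a k)).
Proof.
move=> [da ra] [c [d [_ [cM dN] [_ pc] [_ pd] _]]]; split=> [i|i k ik].
  exact: (proper_psi o p01 t0 II JJ IJ (a i)).1.
apply: (edge_psi af (da i) (da k)).1; split; first exact: ra.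
split; first by rewrite -(tangent_line (da i) (da k) cM); apply: pc.
by rewrite -(tangent_line (da i) (da k) dN); apply: pd.
Qed.

(** The two trajectories have different normals since rotations are injective and
    the directions I + J and I - J differ. *)
Lemma edges_family (i0 : X) : (forall i, proper p (psi (a i))) ->
  (forall i k, neighbours pos i k ->
     linked (psi (a i)) (psi (a k))) ->
  rotating pos a /\ principal_trajectories pos M N a.
Proof.
move=> pa ea.
have da i : displacement (a i) := (proper_psi o p01 t0 II JJ IJ (a i)).2 (pa i).
have E i k (ik : neighbours pos i k) := (edge_psi af (da i) (da k)).2 (ea i k ik).
split; first by split=> // i k /E [].
pose c : contact_element R := (o + tau *: crs3 I J, I + J).
pose d : contact_element R := (o - tau *: crs3 I J, I - J).
have cM : normal_line c = M by rewrite (af_M af).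
have dN : normal_line d = N by rewrite (af_N af).
have cc : is_contact c.
  rewrite /is_contact sum3 /=; transitivity (dot3 I I + dot3 J J + 2%:R * dot3 I J).
    by rewrite !dot3E !mxE; ring.
  by rewrite II JJ IJ; ring.
have dd : is_contact d.
  rewrite /is_contact sum3 /=; transitivity (dot3 I I + dot3 J J - 2%:R * dot3 I J).
    by rewrite !dot3E !mxE; ring.
  by rewrite II JJ IJ; ring.
exists c, d; split=> //.
- split=> [i|i k ik]; first exact: move_is_contact.
  by rewrite (tangent_line (da i) (da k) cM); have [_ []] := E i k ik.
- split=> [i|i k ik]; first exact: move_is_contact.
  by rewrite (tangent_line (da i) (da k) dN); have [_ []] := E i k ik.
exists i0; rewrite /normal_line /trajectory !move_contactE; try by case: (da i0).
move=> [/(congr1 (@qvec R)) + _]; rewrite !vector_partK ?spin_pure // => /spin_inj h.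
have {}h : I + J = I - J by apply: h; case: (da i0).
have J0 : J = 0.
  by apply: vec3P; have := congr1 (fun v : 'rV[R]_3 => v) h; move/rowP => e;
    [have := e 0|have := e 1|have := e 2]; rewrite !mxE; lra.
have := JJ; rewrite J0 dot3E !mxE !mul0r !addr0 => /esym /eqP.
by case/andP: p01 => _ p1; rewrite subr_eq0 gt_eqF.
Qed.
End Family.

Definition axis0 : axis_index n := exist _ (0 : idx) (on_axis0 n).
Definition axpt (i : idx) : axis_index n := insubd axis0 i.
Definition gof (f : axis_index n -> dquat) : idx -> dq R := fun i => psi (f (axpt i)).
Definition fof (g : idx -> dq R) : axis_index n -> dquat := fun i => phi (g (val i)).

Lemma axptK i : on_axis i -> val (axpt i) = i.
Proof. exact: insubdK. Qed.
Lemma val_axpt (i : axis_index n) : axpt (val i) = i.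
Proof. exact: valKd. Qed.

Lemma fofK f : fof (gof f) = f.
Proof. by apply/funext => i; rewrite /fof /gof val_axpt (psiK o p01 t0 II JJ IJ). Qed.

Lemma gofK g i : on_axis i -> gof (fof g) i = g i.
Proof. by move=> h; rewrite /gof /fof axptK // (phiK o p01 t0 II JJ IJ). Qed.

Lemma axis_data_of f : axis_values M N f -> axis_data p (gof f).
Proof.
move=> [rf pf]; have [pr ed] := family_edges rf pf.
have step i d : on_axis i -> on_axis (i + st d) ->
    adj p (gof f i) (gof f (i + st d)) /\ x3 (rel p (gof f i) (gof f (i + st d))) != 0.
  move=> hi hd; case: d hd => j [] hd; first by apply: ed; exists j; rewrite !axptK.
  have [ad x30] : adj p (gof f (i + st (j, false))) (gof f i) /\
      x3 (rel p (gof f (i + st (j, false))) (gof f i)) != 0.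
    by apply: ed; exists j; rewrite !axptK // /shift_index /st /= subrK.
  by split; [exact: adjC | rewrite relC /= oppr_eq0].
split=> [i hi|i d hi hd|i d hi hd]; [exact: pr | by have [] := step i d hi hd | by have [] := step i d hi hd].
Qed.

Lemma axis_values_of g : axis_data p g -> axis_values M N (fof g).
Proof.
move=> gd; apply: (edges_family axis0) => [i|i k [j ij]].
  by rewrite (phiK o p01 t0 II JJ IJ); apply: (ad_proper gd); apply: valP.
apply: linked_phi; have ax := valP k; move: ax; rewrite ij => ax.
by split; [apply: (ad_adj gd (d := (j, true))) | apply: (ad_fin gd (d := (j, true)))] => //; apply: valP.
Qed.

Lemma shiftE (i : idx) j : shift_index i j = i + st (j, true). Proof. by []. Qed.

(** net_form covers both diagonals of an elementary square by a change of sign. *)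
Lemma uniquely_defines_good f : axis_values M N f -> (forall m, good p m (gof f)) ->
  uniquely_defines M N f.
Proof.
move=> fv gg; have gd := axis_data_of fv.
pose A := net p (gof f); pose a i := phi (A i).
have aA i : psi (a i) = A i by rewrite /a (phiK o p01 t0 II JJ IJ).
have proj_form i k : proj_eq (a i) (a k) -> form p (A i) (A k) = 0.
  move/(proj_eq_psi o p01 t0 II JJ IJ) => -[c c0 h].
  have -> : A k = dsc c (A i) by rewrite -(aA k) h; congr dsc; apply: aA.
  have [nA _] := net_proper p01 gd gg i.
  by rewrite formC form_scl nA mulr0.
have [ra pa] : rotating id a /\ principal_trajectories id M N a.
  apply: (edges_family 0) => [i|i k [j ->]]; first by rewrite (aA i); exact: net_proper.
  by apply: linked_phi; split; [exact: (net_adj p01 gd gg i (j, true)) | exact: (net_fin gg i (j, true))].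
exists a; split.
- split=> //; split=> // i j k jk; split=> /proj_form e.
    by have := net_form p01 gd gg i (d1 := (j, true)) (d2 := (k, true)) jk; rewrite -!shiftE e eqxx.
  have := net_form p01 gd gg (shift_index i j) (d1 := (j, false)) (d2 := (k, true)) jk.
  by rewrite {2}/shift_index {2}/st /= addrK -shiftE e eqxx.
- move=> i; exists 1; first exact: oner_neq0.
  rewrite scale1r /a /A net_axis; last exact: (valP i).
  have h : fof (gof f) i = f i by rewrite fofK.
  exact h.
move=> b [[rb qb] tb] vb i.
have [pb eb] := family_edges rb tb.
have adjb v d : adj p (psi (b v)) (psi (b (v + st d))).
  case: d => j []; first by have [] := eb v (v + st (j, true)) (ex_intro _ j erefl).
  have [h _] : linked (psi (b (v + st (j, false)))) (psi (b v)).
    by apply: eb; exists j; rewrite /shift_index /st /= subrK.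
  exact: adjC.
have projC (x y : dquat) : proj_eq x y -> proj_eq y x.
  by move=> [k k0 ->]; exists k^-1; rewrite ?invr_eq0 // scalerA mulVf // scale1r.
have farb v d1 d2 : d1.1 != d2.1 -> ~ exists2 k, k != 0 & psi (b (v + st d1 + st d2)) = dsc k (psi (b v)).
  move=> n12 /(proj_eq_psi o p01 t0 II JJ IJ) h.
  case: d1 d2 n12 h => j [] [k []] /= jk h.
  - by have [+ _] := qb v j k jk; apply.
  - have [_] := qb (v - delta_mx 0 k) j k jk; apply; apply: projC.
    by rewrite /shift_index subrK addrAC.
  - have [_] := qb (v - delta_mx 0 j) j k jk; apply.
    by rewrite /shift_index subrK.
  - have [+ _] := qb (v - delta_mx 0 j - delta_mx 0 k) j k jk; apply; apply: projC.
    by rewrite /shift_index [v - _ - _ + delta_mx 0 j]addrAC subrK subrK.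
have gb v : on_axis v -> exists2 k, k != 0 & psi (b v) = dsc k (gof f v).
  move=> hv; apply/(proj_eq_psi o p01 t0 II JJ IJ).
  by have := vb (axpt v); rewrite axptK.
have [k k0 kE] := net_unique p01 gd gg pb adjb farb gb i.
by apply/(proj_eq_psi o p01 t0 II JJ IJ); exists k => //; rewrite aA.
Qed.

Local Notation T := {ptws axis_index n -> dual_quaternion R}.

Lemma gof_cts i : cts (fun f : T => gof f i).
Proof.
apply: cts_psi => j f.
apply: (@continuous_comp _ _ _ (fun f : T => f (axpt i)) (fun v : 'rV[R]_(4 + 4) => v 0 j)).
  exact: ptws_eval.
exact: coord_continuous.
Qed.

Lemma good_ext m (g g' : idx -> dq R) : (forall i, on_axis i -> g i = g' i) -> good p m g -> good p m g'.
Proof.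
move=> h gm v ds k vm; have := gm v ds k vm.
have e : net p g = net p g'.
  apply/funext => i; apply: (@net_local _ _ p xpredT g g') => // j _; exact: h.
by rewrite /cval e.
Qed.

Lemma good_open m : open [set f : T | @good R n p m (gof f)].
Proof.
have oc c : open [set f : T | cval p (gof f) c != 0].
  have cc : cr (fun f : T => cval p (gof f) c) by apply: cr_cval; exact: gof_cts.
  apply: (@open_comp _ _ (fun f : T => cval p (gof f) c) [set x | x != 0]) => [f _|].
    exact: cc.
  exact: open_neq.
have os (s : seq (cond n)) : open [set f : T | forall c, c \in s -> cval p (gof f) c != 0].
  elim: s => [|c s IH].
    have -> : [set f : T | forall c, c \in [::] -> cval p (gof f) c != 0] = setT.
      by apply/seteqP; split.
    exact: openT.
  have -> : [set f : T | forall c', c' \in c :: s -> cval p (gof f) c' != 0] =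
      [set f : T | cval p (gof f) c != 0] `&` [set f : T | forall c', c' \in s -> cval p (gof f) c' != 0].
    apply/seteqP; split=> f /=.
      by move=> h; split=> [|c' cs]; apply: h; rewrite in_cons ?eqxx ?cs ?orbT.
    by move=> [h1 h2] c'; rewrite in_cons => /orP[/eqP ->|/h2].
  exact: openI.
have -> : [set f : T | @good R n p m (gof f)] =
    [set f : T | forall c, c \in conds_below n m -> cval p (gof f) c != 0].
  by apply/seteqP; split=> f /= /good_below.
exact: os.
Qed.

(** The curves used in good_dense are continuous for pointwise convergence, hence
    they stay in any neighbourhood of f for small parameters. *)
Lemma good_closure m (f : T) : axis_values M N f ->
  closure ([set f : T | axis_values M N f] `&` [set f : T | @good R n p m (gof f)]) f.
Proof.
move=> fv B; rewrite nbhsE; case=> O [oO Of] OB.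
pose W : set (idx -> dq R) := [set g | O (fof g : T)].
have oW : copen W.
  move=> G cG WG; have cF : continuous (fun h => fof (G h) : T).
    apply: ptws_continuous => i; apply: cmx_continuous => k j.
    rewrite ord1; exact: cr_phi.
  apply: (cF 0); exact: open_nbhs_nbhs.
have [|g [gd gm Wg]] := good_dense p01 m (axis_data_of fv) oW.
  by rewrite /W /= fofK.
exists (fof g); split; last exact: OB.
split; first exact: axis_values_of.
by apply: good_ext gm => i hi; rewrite gofK.
Qed.
End Main.

Theorem theorem8 (R : realType) (n : nat) (M N : oriented_line R) :
  is_line M -> is_line N -> skew_lines M N ->
  @generically {ptws axis_index n -> dual_quaternion R}
    [set f | axis_values M N f] [set f | uniquely_defines M N f].
Proof.
move=> lM lN sk; have [I [J [c [tau [p af]]]]] := skew_frame lM lN sk.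
exists (fun m => [set f | @good R n p m (gof I J c tau p f)]); split.
  by move=> m; split; [exact: good_open | move=> f fv; exact: good_closure].
move=> f [fv fg]; apply: (uniquely_defines_good af fv) => m; exact: fg.
Qed.
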